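(* Let $D$ be a domain in $\mathbb{C}$ and let $A\subset D$ be a closed polar set. Assume $f$ is holomorphic on $D\setminus A$ and $f$ does not extend holomorphically over $A$. Then there exists a dense subset $B\subset A$ such that $(\Gamma_f)^\ast_{D\times\mathbb{C}}\cap(B\times\mathbb{C})=\varnothing$, where $\Gamma_f=\{(z,f(z)):z\in D\setminus A\}$.
   Context: For a pluripolar set $E$ in a domain $\Omega\subset\mathbb{C}^n$, $E^\ast_\Omega=\{z\in\Omega:\ \text{for every plurisubharmonic } v \text{ on }\Omega,\ v|_E\equiv-\infty\implies v(z)=-\infty\}$. ''$f$ does not extend holomorphically over $A$'' means: for no point $a\in A$ does $f$ extend holomorphically to a neighbourhood of $a$. *)

(* Defs.v *)
(* The complex plane is modelled as R[i]
   (mathcomp-real-closed `complex`) over an arbitrary R : realType, with the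
   normed/topological structure MathComp-Analysis gives every numFieldType. *)
From HB Require Import structures.
From mathcomp Require Import all_boot all_order all_algebra.
From mathcomp Require Import all_classical all_reals all_analysis.
From mathcomp Require Import complex.
Import Order.TTheory GRing.Theory Num.Theory.
Import numFieldNormedType.Exports.

Set Implicit Arguments.
Unset Strict Implicit.
Unset Printing Implicit Defensive.

Local Open Scope ring_scope.
Local Open Scope classical_set_scope.

Definition CC (R : realType) : numFieldType := R[i].

Section Defs.
Variable R : realType.
Local Notation C := (CC R).

Definition cmod (z : C) : R :=
  let: Complex a b := (z : R[i]) in Num.sqrt (a ^+ 2 + b ^+ 2).

Definition circ_pt (z : C) (r t : R) : C :=
  z + ((Complex r 0 : R[i]) * (Complex (cos t) (sin t) : R[i]) : C).

Definition disk (a : C) (r : R) : set C := [set z | cmod (z - a) < r].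

Definition circle_mean (u : C -> \bar R) (z : C) (r : R) : \bar R :=
  (((2 * pi)^-1)%:E *
   \int[lebesgue_measure]_(t in `[0%R, (2 * pi)%R]) u (circ_pt z r t))%E.

Definition usc_on (T : topologicalType) (U : set T) (u : T -> \bar R) : Prop :=
  forall z, U z -> forall c : R, (u z < c%:E)%E -> \forall w \near z, (u w < c%:E)%E.

(* subharmonic functions on an open set U of C (values in [-oo, +oo),
   upper semicontinuous, local sub-mean-value inequality); the constant -oo
   is allowed, as in Ransford's definition *)
Definition subharmonic (U : set C) (u : C -> \bar R) : Prop :=
  [/\ open U,
      (forall z, U z -> (u z < +oo)%E),
      usc_on U u &
      (forall z, U z -> exists2 rho : R, 0 < rho &
          disk z rho `<=` U /\
          forall r : R, 0 < r -> r < rho -> (u z <= circle_mean u z r)%E)].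

Definition line2 (a b : C * C) (l : C) : C * C := (a.1 + l * b.1, a.2 + l * b.2).

Definition psh (Om : set (C * C)) (v : C * C -> \bar R) : Prop :=
  [/\ open Om,
      (forall p, Om p -> (v p < +oo)%E),
      usc_on Om v &
      (forall a b : C * C,
          subharmonic [set l | Om (line2 a b l)] (fun l => v (line2 a b l)))].

Definition pstar (Om : set (C * C)) (E : set (C * C)) : set (C * C) :=
  [set z | Om z /\ forall v, psh Om v -> (forall e, E e -> v e = -oo%E) -> v z = -oo%E].

Definition polar (A : set C) : Prop :=
  forall a, A a -> exists2 r : R, 0 < r &
    exists u : C -> \bar R,
      [/\ subharmonic (disk a r) u,
          (exists2 z, disk a r z & u z <> -oo%E) &
          (forall z, disk a r z -> A z -> u z = -oo%E)].

Definition domain (D : set C) : Prop := [/\ open D, connected D & D !=set0].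

Definition rel_closed (D A : set C) : Prop :=
  A `<=` D /\ (forall z, D z -> closure A z -> A z).

Definition holomorphic_on (U : set C) (f : C -> C) : Prop :=
  forall z, U z -> derivable f z 1.

Definition no_holo_ext (D A : set C) (f : C -> C) : Prop :=
  forall a, A a -> ~ exists U : set C, exists g : C -> C,
      [/\ open U, U a, U `<=` D, holomorphic_on U g &
          (forall z, U z -> ~ A z -> g z = f z)].

Definition graph (D A : set C) (f : C -> C) : set (C * C) :=
  [set p | exists2 z, (D `\` A) z & p = (z, f z)].

End Defs.

(* Main.v *)
(* Near a point [a] of [A] one finds a circle missing [A] inside which [f] is
   unbounded. The components of [{|f| > k}] can be chosen nested as [k] grows,
   and they accumulate at a point [b] of [A], so that every small circle about
   [b] meets every set [{|f| > k}]. The points [b] obtained in this way form [B].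

   For such a [b] and [e > 0] a continuous plurisubharmonic function on a large
   compact part of [D x C] is glued from [c ln (max (|w - f z|) tau)] and, over
   [{|f| <= k}], a logarithmic potential with masses in [{|f| > k}] that is
   at most [-1] away from [b] but at least [-e] near [b]; the masses cause no
   harm because on [{|f| > k}] the first function is nonnegative for bounded
   [w]. Near [A] the result is cut off by means of a potential that is very
   negative on [A] but not on some small circle about [b]: inside this circle
   the cutoff value is close to [0], elsewhere it is below [-1]. Adding these
   functions for [e = 2^-j] gives a plurisubharmonic function which is [-oo] on
   the graph and finite on [{b} x C]. *)

Require Import Defs.
From HB Require Import structures.
From mathcomp Require Import all_boot all_order all_algebra.
From mathcomp Require Import all_classical all_reals all_analysis.
From mathcomp Require Import measurable_realfun complex.
From mathcomp Require Import ring lra zify.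
Import Order.TTheory GRing.Theory Num.Theory.
Import numFieldNormedType.Exports.
Set Implicit Arguments.
Unset Strict Implicit.
Unset Printing Implicit Defensive.
Local Open Scope ring_scope.
Local Open Scope classical_set_scope.

(** The point [b] cannot be prescribed: it is a limit of points at which [f] tends to infinity, and
    only its distance to [a] is controlled; hence a dense set and not all of [A].

    One estimate is used twice. Masses in an open set that meets all circles about [b] with radii
    between [s] and [r] give a potential that is at most [-1] at distance [r] and at least [- e]
    near [b], where [s] depends only on [r] and [e]. Applied to sets where a subharmonic function is
    very negative, it yields circles on which that function is bounded below. Such circles miss the
    polar set; they give the removability of bounded singularities, hence the unboundedness of [f],
    and they carry the cutoff.

    The cutoff would be circular if the bounds of the potential grew with its depth [- T] on [A]. So
    its upper bound, and its lower bound on the small circle, are kept independent of [T]: they fix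
    the scale [dl], and only then [T] is chosen.

    Almost everywhere the functions are real and continuous ([shl], [plh]), and means are real
    integrals. Semicontinuous functions enter through the polar potentials, by sup-convolution, and
    at the end, as decreasing limits. *)

Section RealContinuity.
Variables (R : realType) (T : topologicalType).
Implicit Types (f g : T -> R) (x : T) (c : R).

Lemma contD f g x : {for x, continuous f} -> {for x, continuous g} ->
  {for x, continuous (fun t => f t + g t)}.
Proof. exact: continuousD. Qed.

Lemma contB f g x : {for x, continuous f} -> {for x, continuous g} ->
  {for x, continuous (fun t => f t - g t)}.
Proof. exact: continuousB. Qed.

Lemma contZ c f x : {for x, continuous f} -> {for x, continuous (fun t => c * f t)}.
Proof. by move=> cf; apply: continuousM => //; exact: cst_continuous. Qed.

Lemma cont_max f g x : {for x, continuous f} -> {for x, continuous g} ->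
  {for x, continuous (fun t => Num.max (f t) (g t))}.
Proof. exact: continuous_max. Qed.

Lemma cont_sum (I : eqType) (s : seq I) (F : I -> T -> R) x :
  (forall i, i \in s -> {for x, continuous (F i)}) ->
  {for x, continuous (fun t => \sum_(i <- s) F i t)}.
Proof.
elim: s => [|i s IHs] H.
  have -> : (fun t => \sum_(i <- [::]) F i t) = cst 0.
    by apply/funext => t; rewrite big_nil.
  exact: cst_continuous.
have -> : (fun t => \sum_(j <- i :: s) F j t) =
          (fun t => F i t + \sum_(j <- s) F j t).
  by apply/funext => t; rewrite big_cons.
apply: contD; first by apply: H; rewrite mem_head.
by apply: IHs => j js; apply: H; rewrite inE js orbT.
Qed.

End RealContinuity.

(** * The real-valued modulus and the topology of the plane *)

Section ComplexModulus.
Variable R : realType.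
Local Notation C := (CC R).
Implicit Types (z w a b : C) (r e : R).

Definition re z : R := complex.Re (z : R[i]).
Definition im z : R := complex.Im (z : R[i]).
Definition rc r : C := (Complex r 0 : R[i]).
Definition cjg z : C := (conjc (z : R[i]) : R[i]).

Lemma cmodE z : cmod z = ComplexField.Normc.normc (z : R[i]).
Proof. by case: z. Qed.

Lemma cmod_norm z : `|z| = rc (cmod z) :> C.
Proof. by case: z. Qed.

Lemma cmod_ge0 z : 0 <= cmod z.
Proof. by case: z => x y; apply: sqrtr_ge0. Qed.

Lemma cmod0 : cmod (0 : C) = 0.
Proof. by rewrite cmodE; exact: ComplexField.Normc.normc0. Qed.

Lemma cmod1 : cmod (1 : C) = 1.
Proof. by rewrite cmodE; exact: ComplexField.Normc.normc1. Qed.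

Lemma cmod_eq0 z : (cmod z == 0) = (z == 0).
Proof.
apply/eqP/eqP => [|->]; last exact: cmod0.
by rewrite cmodE; exact: ComplexField.Normc.eq0_normc.
Qed.

Lemma cmod_gt0 z : (0 < cmod z) = (z != 0).
Proof. by rewrite lt_def cmod_ge0 andbT cmod_eq0. Qed.

Lemma cmodM z w : cmod (z * w) = cmod z * cmod w.
Proof. by rewrite !cmodE; exact: ComplexField.Normc.normcM. Qed.

Lemma cmodV z : cmod z^-1 = (cmod z)^-1.
Proof. by rewrite !cmodE; exact: ComplexField.Normc.normcV. Qed.

Lemma cmodD z w : cmod (z + w) <= cmod z + cmod w.
Proof. by rewrite !cmodE; exact: le_normcD. Qed.

Lemma cmodN z : cmod (- z) = cmod z.
Proof. by rewrite !cmodE; exact: normcN. Qed.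

Lemma cmodB z w : cmod (z - w) = cmod (w - z).
Proof. by rewrite -cmodN opprB. Qed.

Lemma cmod_prod (I : Type) (s : seq I) (P : pred I) (F : I -> C) :
  cmod (\prod_(i <- s | P i) F i) = \prod_(i <- s | P i) cmod (F i).
Proof. by apply: (big_morph _ cmodM cmod1). Qed.

Lemma cmod_tri (b a c : C) : cmod (a - c) <= cmod (a - b) + cmod (b - c).
Proof. by apply: le_trans (cmodD _ _); rewrite addrA subrK. Qed.

Lemma cmod_dist z w : `|cmod z - cmod w| <= cmod (z - w).
Proof.
rewrite ler_norml; have := cmod_tri 0 z w; have := cmod_tri w z 0.
have := cmod_tri z w 0; have := cmod_tri 0 w z.
rewrite !sub0r !subr0 !cmodN (cmodB w z); (clear; lra).
Qed.

Lemma cmod_rc r : cmod (rc r) = `|r|.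
Proof. by rewrite /rc /= expr0n /= addr0 sqrtr_sqr. Qed.

Lemma cmod_sqr z : cmod z ^+ 2 = re z ^+ 2 + im z ^+ 2.
Proof. by case: z => x y /=; rewrite sqr_sqrtr // addr_ge0 ?sqr_ge0. Qed.

Lemma re_le z : re z <= cmod z.
Proof.
apply: le_trans (ler_norm _) _; rewrite -(@ler_sqr R) ?nnegrE ?cmod_ge0//.
by rewrite cmod_sqr real_normK ?num_real// lerDl sqr_ge0.
Qed.

Lemma reN z : re (- z) = - re z. Proof. by case: z. Qed.
Lemma reD z w : re (z + w) = re z + re w. Proof. by case: z; case: w. Qed.
Lemma imD z w : im (z + w) = im z + im w. Proof. by case: z; case: w. Qed.
Lemma reB z w : re (z - w) = re z - re w. Proof. by case: z; case: w. Qed.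
Lemma imB z w : im (z - w) = im z - im w. Proof. by case: z; case: w. Qed.
Lemma reM z w : re (z * w) = re z * re w - im z * im w.
Proof. by case: z; case: w. Qed.
Lemma imM z w : im (z * w) = re z * im w + im z * re w.
Proof. by case: z; case: w => a b c d /=; rewrite /im /=; ring. Qed.

Lemma abs_re z : `|re z| <= cmod z.
Proof. by rewrite ler_norml re_le lerNl -reN -(cmodN z) re_le. Qed.

Lemma cjgD z w : cjg (z + w) = cjg z + cjg w.
Proof. by case: z => a b; case: w => c d; rewrite /cjg /= opprD. Qed.
Lemma cjgM z w : cjg (z * w) = cjg z * cjg w.
Proof.
case: z => a b; case: w => c d; rewrite /cjg /=.
by congr Complex; ring.
Qed.
Lemma cjgK z : cjg (cjg z) = z.
Proof. by case: z => a b; rewrite /cjg /= opprK. Qed.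
Lemma cmod_cjg z : cmod (cjg z) = cmod z.
Proof. by case: z => a b; rewrite /cjg /= sqrrN. Qed.
Lemma mul_cjg z : z * cjg z = rc (cmod z ^+ 2).
Proof.
rewrite cmod_sqr; case: z => a b; rewrite /cjg /rc /re /im /=.
by congr Complex; ring.
Qed.

Lemma rcM r e : rc (r * e) = rc r * rc e.
Proof. by rewrite /rc; congr Complex; ring. Qed.
Lemma rcD r e : rc (r + e) = rc r + rc e.
Proof. by rewrite /rc; congr Complex; ring. Qed.
Lemma rcN r : rc (- r) = - rc r.
Proof. by rewrite /rc; congr Complex; ring. Qed.
Lemma rc0 : rc 0 = 0. Proof. by []. Qed.
Lemma rc1 : rc 1 = 1. Proof. by []. Qed.
Lemma re_rcM r z : re (rc r * z) = r * re z.
Proof. by rewrite reM mul0r subr0. Qed.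
Lemma im_rcM r z : im (rc r * z) = r * im z.
Proof. by rewrite imM mul0r addr0. Qed.
Lemma Ceq z w : re z = re w -> im z = im w -> z = w.
Proof. by case: z => a b; case: w => c d /= <- <-. Qed.

Definition cis (t : R) : C := (Complex (cos t) (sin t) : R[i]).

Lemma cmod_cis t : cmod (cis t) = 1.
Proof. by rewrite /cis /= cos2Dsin2 sqrtr1. Qed.

Lemma cisD s t : cis (s + t) = cis s * cis t.
Proof.
by rewrite /cis cosD sinD; congr Complex; ring.
Qed.

Lemma cis2pi t : cis (t + 2 * pi) = cis t.
Proof. by rewrite /cis mulrC mulr_natr cosD2pi sinD2pi. Qed.

Lemma circ_ptE z r t : circ_pt z r t = z + rc r * cis t.
Proof. by []. Qed.

Lemma cis_surj z : cmod z = 1 -> exists2 t, 0 <= t <= 2 * pi & z = cis t.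
Proof.
move=> z1; have := cmod_sqr z; rewrite z1 expr1n => xy.
have x1 : -1 <= re z <= 1.
  by have := abs_re z; rewrite z1 ler_norml.
have a0 := acos_ge0 x1; have api := acos_lepi x1.
have := sin2cos2 (acos (re z)); rewrite acosK; last by rewrite in_itv.
have -> : 1 - re z ^+ 2 = im z ^+ 2 by rewrite xy addrAC subrr add0r.
(* The sine of [acos (re z)] is [im z] up to sign; the sign tells the upper half circle from the
   lower one. *)
move/eqP; rewrite eqf_sqr => /orP[/eqP sE|/eqP sE].
  exists (acos (re z)); first by rewrite a0/=; have := @pi_gt0 R; (clear - api; lra).
  by apply: Ceq; rewrite /cis /re /im /= ?acosK ?in_itv// sE.
exists (2 * pi - acos (re z)); first by have := @pi_gt0 R; (clear - a0 api; lra).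
rewrite addrC cis2pi.
by apply: Ceq; rewrite /cis /re /im /= ?cosN ?sinN ?acosK ?in_itv// sE opprK.
Qed.

Lemma polar_form z : exists2 t, 0 <= t <= 2 * pi & z = rc (cmod z) * cis t.
Proof.
have [->|z0] := eqVneq z 0.
  by exists 0; rewrite ?lexx ?mulr_ge0 ?pi_ge0// cmod0 rc0 mul0r.
have m0 : rc (cmod z) != 0 :> C.
  by rewrite -cmod_eq0 cmod_rc normr_eq0 cmod_eq0.
have [|t tP zE] := @cis_surj ((rc (cmod z))^-1 * z).
  by rewrite cmodM cmodV cmod_rc ger0_norm ?cmod_ge0// mulVf ?cmod_eq0.
by exists t => //; rewrite -zE mulrA divff ?mul1r.
Qed.

Lemma nbhs_cmodP z (P : set C) :
  nbhs z P <-> exists2 r : R, 0 < r & forall w, cmod (w - z) < r -> P w.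
Proof.
split.
  (* Radii of balls are elements of [C]; positivity for the order of [R[i]] forces the imaginary
     part [y] to vanish. *)
  move=> /nbhs_ballP[/= [e y] e0 eP]; move: e0; rewrite ltcE /= => /andP[/eqP yE e0].
  exists e => // w we; apply: eP; rewrite /ball /= -opprB normrN cmod_norm.
  by rewrite ltcE /= yE eqxx.
move=> [r r0 rP]; apply/nbhs_ballP; exists (rc r); first by rewrite /= ltcE /= eqxx.
move=> w; rewrite /ball /= -opprB normrN cmod_norm ltcE /= eqxx /= => wr.
exact: rP.
Qed.

Lemma near_all z (P : C -> Prop) : (forall w, P w) -> \forall w \near z, P w.
Proof. by move=> Pw; apply: (nbhs_cmodP z _).2; exists 1. Qed.

Lemma near_cmod z r : 0 < r -> \forall w \near z, cmod (w - z) < r.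
Proof. by move=> r0; apply: (nbhs_cmodP z _).2; exists r. Qed.

Lemma open_cmodP (U : set C) :
  open U <-> forall z, U z -> exists2 r, 0 < r & forall w, cmod (w - z) < r -> U w.
Proof.
rewrite openE; split => [oU z /oU /nbhs_cmodP//|oU z /oU /nbhs_cmodP//].
Qed.

Lemma open_disk a r : open (disk a r).
Proof.
apply/open_cmodP => z /= zr; exists (r - cmod (z - a)); first by rewrite subr_gt0.
by move=> w wz; rewrite /disk /=; have := cmod_tri z w a; (clear - wz; lra).
Qed.

Lemma cont_cmodP (F : C -> R) (z : C) : {for z, continuous F} <->
  forall e, 0 < e -> exists2 r, 0 < r & forall w, cmod (w - z) < r -> `|F w - F z| < e.
Proof.
split.
  move=> /cvgrPdist_lt + e e0 => /(_ e e0) /nbhs_cmodP[r r0 rP].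
  by exists r => // w /rP; rewrite distrC.
move=> h; apply/(@cvgrPdist_lt R R (CC R) (nbhs z) (nbhs_filter z)) => e /h[r r0 rP]; apply: (nbhs_cmodP z _).2; exists r => // w /rP.
by rewrite distrC.
Qed.

Lemma cont_cmodCP (F : C -> C) (z : C) : {for z, continuous F} <->
  forall e, 0 < e -> exists2 r, 0 < r & forall w, cmod (w - z) < r -> cmod (F w - F z) < e.
Proof.
split.
  move=> h e e0; have /h/nbhs_cmodP[r r0 rP] : nbhs (F z) (disk (F z) e) by apply/nbhs_cmodP; exists e.
  exists r => // w /rP.
move=> h P /nbhs_cmodP[e e0 eP]; apply: (nbhs_cmodP z _).2; have [r r0 rP] := h e e0.
by exists r => // w /rP /eP.
Qed.

Lemma continuous_cmod : continuous (@cmod R).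
Proof.
move=> z; apply/cont_cmodP => e e0; exists e => // w; apply: le_lt_trans.
exact: cmod_dist.
Qed.

Lemma continuous_re : continuous re.
Proof.
move=> z; apply/cont_cmodP => e e0; exists e => // w; apply: le_lt_trans.
by rewrite -reB; exact: abs_re.
Qed.

Lemma continuous_cjg : continuous cjg.
Proof.
move=> z; apply/cont_cmodCP => e e0; exists e => // w.
by rewrite -{1}(cmod_cjg (w - z)) cjgD; case: z => x y; rewrite /cjg /=.
Qed.

Lemma complex_sqr_lt (x y e : R) : 0 < e -> `|x| < e -> `|y| < e ->
  cmod (Complex x y : C) < 2 * e.
Proof.
move=> e0 xe ye; have -> : (Complex x y : C) = rc x + (Complex 0 1 : C) * rc y.
  by rewrite /rc; congr Complex; ring.
apply: le_lt_trans (cmodD _ _) _; rewrite cmodM !cmod_rc /= expr0n expr1n add0r.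
by rewrite sqrtr1 mul1r; (clear - xe ye; lra).
Qed.

Lemma continuous_pairC (T : topologicalType) (u v : T -> R) (t : T) :
  {for t, continuous u} -> {for t, continuous v} ->
  {for t, continuous (fun s => (Complex (u s) (v s) : C))}.
Proof.
move=> cu cv P /nbhs_cmodP[e e0 eP].
have e20 : 0 < e / 2 by rewrite divr_gt0.
move/cvgrPdist_lt : cu => /(_ _ e20) cu.
move/cvgrPdist_lt : cv => /(_ _ e20) cv.
apply: filterS2 cu cv => s us vs; apply: eP.
have := complex_sqr_lt e20 us vs; rewrite mulrC divfK ?pnatr_eq0// => h.
by rewrite cmodB.
Qed.

Lemma continuous_cis : continuous cis.
Proof.
by move=> t; apply: continuous_pairC; [exact: continuous_cos|exact: continuous_sin].
Qed.

Definition cball a r : set C := [set z | cmod (z - a) <= r].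

Lemma closed_cball a r : closed (cball a r).
Proof.
rewrite -[X in closed X]setCK; apply: open_closedC; apply/open_cmodP => z /= /negP.
rewrite -ltNge => zr; exists (cmod (z - a) - r); first by rewrite subr_gt0.
move=> w wz; apply/negP; rewrite -ltNge.
by have := cmod_tri w z a; rewrite (cmodB z w); (clear - wz; lra).
Qed.

(** A closed subset of the continuous image of a compact square of [R * R]. *)
Lemma compact_cball a r : compact (cball a r).
Proof.
pose Q := (`[(re a - r), (re a + r)] `*` `[(im a - r), (im a + r)])%classic : set (R * R).
have cQ : compact Q by apply: compact_setX; exact: segment_compact.
pose F := fun p : R * R => (Complex p.1 p.2 : C).
have cF : continuous F.
  by move=> p; apply: continuous_pairC; [exact: cvg_fst|exact: cvg_snd].
have cFQ : compact (F @` Q).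
  by apply: continuous_compact => //; apply: continuous_subspaceT.
have H := subclosed_compact (@closed_cball a r) cFQ.
apply: H => z zr.
exists (re z, im z); last by case: z {zr}.
have abs_im w : `|im w| <= cmod w.
  rewrite -(@ler_sqr R) ?nnegrE ?cmod_ge0//.
  by rewrite cmod_sqr real_normK ?num_real// lerDr sqr_ge0.
move: zr; rewrite /cball /= => zr.
have := le_trans (abs_re _) zr; have := le_trans (abs_im _) zr.
rewrite reB imB !ler_norml /Q /= !in_itv /=; (clear; lra).
Qed.

End ComplexModulus.
Arguments cball {R}.

(** The sets [Y] with [P (K \ Y)] form a filter containing [K], proper if [P K] fails; at a cluster
    point the local hypothesis contradicts this. It replaces the extraction of finite subcovers
    wherever uniformity over a compact set is needed. *)
Lemma compact_induction (T : topologicalType) (K : set T) (P : set T -> Prop) :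
  compact K -> P set0 ->
  (forall X Y, X `<=` Y -> P Y -> P X) ->
  (forall X Y, P X -> P Y -> P (X `|` Y)) ->
  (forall x, K x -> exists2 U, nbhs x U & P (K `&` U)) -> P K.
Proof.
move=> cK P0 PS PU Ploc; apply: contrapT => nPK.
pose F := [set Y : set T | P (K `\` Y)].
have FF : ProperFilter F.
  split; last split.
  - by rewrite /F /= setD0.
  - by rewrite /F /= setDT.
  - by move=> X Y PX PY; rewrite /F /= setDIr; exact: PU.
  - by move=> X Y XY; apply: PS => x [Kx nYx]; split => // /XY.
have FK : F K by rewrite /F /= setDv.
have [x [Kx clx]] := cK F FF FK.
have [U nU PKU] := Ploc x Kx.
have FU : F (~` U) by rewrite /F /= setDE setCK.
by have [y []] := clx _ _ FU nU.
Qed.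

(** * Integrals of continuous functions and means over a period *)

Section Average.
Variable R : realType.
Local Notation mu := (@lebesgue_measure R).
Implicit Types (h k : R -> R) (a b c t : R).

Definition Int a b h : R := \int[mu]_(t in `[a, b]) h t.
Definition avg h : R := (2 * pi)^-1 * Int 0 (2 * pi) h.

Lemma Int_integrable a b h : continuous h -> mu.-integrable `[a, b] (EFin \o h).
Proof.
move=> ch; apply: continuous_compact_integrable; first exact: segment_compact.
exact: continuous_subspaceT.
Qed.

Lemma IntD a b h k : continuous h -> continuous k ->
  Int a b (fun t => h t + k t) = Int a b h + Int a b k.
Proof. by move=> ch ck; apply: RintegralD => //; exact: Int_integrable. Qed.

Lemma IntB a b h k : continuous h -> continuous k ->
  Int a b (fun t => h t - k t) = Int a b h - Int a b k.
Proof. by move=> ch ck; apply: RintegralB => //; exact: Int_integrable. Qed.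

Lemma IntZ a b c h : continuous h -> Int a b (fun t => c * h t) = c * Int a b h.
Proof. by move=> ch; apply: RintegralZl => //; exact: Int_integrable. Qed.

Lemma Int_cst a b c : a <= b -> Int a b (fun=> c) = (b - a) * c.
Proof.
move=> ab; rewrite /Int Rintegral_cst//= lebesgue_measure_itv/= lte_fin.
case: ltP => [_|ba]; first by rewrite mulrC.
have -> : a = b by apply/le_anti/andP.
by rewrite subrr mulr0 mul0r.
Qed.

Lemma Int_le a b h k : continuous h -> continuous k ->
  (forall t, a <= t <= b -> h t <= k t) -> Int a b h <= Int a b k.
Proof.
move=> ch ck hk; apply: le_Rintegral => //; try exact: Int_integrable.
Qed.

Lemma Int_ge_cst a b c h : a <= b -> continuous h ->
  (forall t, a <= t <= b -> c <= h t) -> (b - a) * c <= Int a b h.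
Proof.
move=> ab ch hc; by rewrite -(Int_cst _ ab); apply: Int_le => //; exact: cst_continuous.
Qed.

Lemma Int_abs_cst a b c h : a <= b -> continuous h ->
  (forall t, a <= t <= b -> `|h t| <= c) -> `|Int a b h| <= (b - a) * c.
Proof.
move=> ab ch hc; rewrite ler_norml; apply/andP; split.
  rewrite -mulrN; apply: Int_ge_cst => // t /hc.
  by rewrite ler_norml => /andP[].
rewrite -(Int_cst _ ab); apply: Int_le => //; try exact: cst_continuous.
by move=> t /hc; rewrite ler_norml => /andP[].
Qed.

Lemma Int_chasles a b c h : a <= b -> b <= c -> continuous h ->
  Int a c h = Int a b h + Int b c h.
Proof.
move=> ab bc ch; rewrite /Int.
have := @Rintegral_itvB R h (BLeft a) (BRight c) b (Int_integrable a c ch).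
rewrite !bnd_simp => /(_ ab bc) H.
rewrite -(@Rintegral_itv_obnd_cbnd R b (BRight c) h); last first.
  by apply: integrableS (Int_integrable b c ch) => //; exact: subset_itv_oc_cc.
by rewrite -H addrC subrK.
Qed.

Lemma twopi_gt0 : 0 < 2 * pi :> R.
Proof. by rewrite mulr_gt0 ?pi_gt0. Qed.

Lemma avgD h k : continuous h -> continuous k ->
  avg (fun t => h t + k t) = avg h + avg k.
Proof. by move=> ch ck; rewrite /avg IntD// mulrDr. Qed.

Lemma avgB h k : continuous h -> continuous k ->
  avg (fun t => h t - k t) = avg h - avg k.
Proof. by move=> ch ck; rewrite /avg IntB// mulrBr. Qed.

Lemma avgZ c h : continuous h -> avg (fun t => c * h t) = c * avg h.
Proof. by move=> ch; rewrite /avg IntZ// mulrCA. Qed.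

Lemma avg_cst c : avg (fun=> c) = c.
Proof.
by rewrite /avg Int_cst ?ltW ?twopi_gt0// subr0 mulKf// gt_eqF// twopi_gt0.
Qed.

Lemma avg_le h k : continuous h -> continuous k ->
  (forall t, h t <= k t) -> avg h <= avg k.
Proof.
move=> ch ck hk; rewrite ler_pM2l ?invr_gt0 ?twopi_gt0//.
by apply: Int_le => // t _; exact: hk.
Qed.

Lemma avg_le_cst h c : continuous h -> (forall t, h t <= c) -> avg h <= c.
Proof.
move=> ch hc; rewrite -[leRHS]avg_cst; by apply: avg_le => //; exact: cst_continuous.
Qed.

Lemma avg_ge_cst h c : continuous h -> (forall t, c <= h t) -> c <= avg h.
Proof.
move=> ch hc; rewrite -[leLHS]avg_cst; by apply: avg_le => //; exact: cst_continuous.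
Qed.

Lemma avg_cos : avg (@cos R) = 0.
Proof.
rewrite /avg /Int /Rintegral (@continuous_FTC2 _ _ (@sin R)) ?twopi_gt0//.
- have -> : sin (2 * pi) = sin 0 :> R by rewrite mulr_natl -(add0r (pi *+ 2)) sinD2pi.
  by rewrite -EFinB subrr mulr0.
- by apply: continuous_subspaceT; exact: continuous_cos.
- split; first by move=> x _; exact: ex_derive.
    by apply: cvg_at_right_filter; exact: continuous_sin.
  by apply: cvg_at_left_filter; exact: continuous_sin.
- by move=> x _; rewrite derive1E; exact: derive_val.
Qed.

Lemma avg_sin : avg (@sin R) = 0.
Proof.
rewrite /avg /Int /Rintegral (@continuous_FTC2 _ _ (fun x => - @cos R x)) ?twopi_gt0//.
- have -> : cos (2 * pi) = cos 0 :> R by rewrite mulr_natl -(add0r (pi *+ 2)) cosD2pi.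
  by rewrite -EFinB subrr mulr0.
- by apply: continuous_subspaceT; exact: continuous_sin.
- split; first by move=> x _; exact: ex_derive.
    by apply: cvg_at_right_filter; apply: continuousN; exact: continuous_cos.
  by apply: cvg_at_left_filter; apply: continuousN; exact: continuous_cos.
- by move=> x _; rewrite derive1E; rewrite derive_val opprK.
Qed.

(** Heine's theorem, with only [s] confined to the interval: [t] may leave it. *)
Lemma unif_continuous_itv a b h : continuous h -> forall e : R, 0 < e ->
  exists2 d : R, 0 < d & forall s t, a <= s <= b -> `|s - t| < d -> `|h s - h t| < e.
Proof.
move=> ch e e0.
pose P (X : set R) := exists2 d : R, 0 < d & forall s t, X s -> `|s - t| < d -> `|h s - h t| < e.
have [||X Y XY [d d0 dP]|X Y [d d0 dP] [d' d'0 dP']|x _|d d0 dP] :=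
    @compact_induction R `[a, b] P.
- exact: segment_compact.
- by exists 1.
- by exists d => // s t /XY; exact: dP.
- exists (Num.min d d'); first by rewrite lt_min d0.
  by move=> s t [Xs|Xs]; rewrite lt_min => /andP[? ?]; [exact: dP|exact: dP'].
- have e20 : 0 < e / 2 by rewrite divr_gt0.
  have /cvgrPdist_lt/(_ _ e20)/nbhs_ballP[r/= r0 rP] := ch x.
  exists (ball x (r / 2)); first by apply: nbhsx_ballx; rewrite divr_gt0.
  exists (r / 2); first by rewrite divr_gt0.
  move=> s t [_ xs] st.
  have hs : `|h x - h s| < e / 2.
    by apply: rP; move: xs; rewrite /ball /=; (clear - r0; lra).
  have ht : `|h x - h t| < e / 2.
    apply: rP; move: xs; rewrite /ball /= => xs.
    by rewrite (_ : x - t = (x - s) + (s - t)); [apply: le_lt_trans (ler_normD _ _) _; lra|ring].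
  rewrite (_ : h s - h t = (h x - h t) - (h x - h s)); last by ring.
  by apply: le_lt_trans (ler_normB _ _) _; (clear - hs ht; lra).
by exists d => // s t sab; apply: dP; rewrite /= in_itv.
Qed.

Lemma Int_split (m : nat) (s : R) h : 0 <= s -> continuous h ->
  Int 0 (m%:R * s) h = \sum_(j < m) Int (j%:R * s) (j.+1%:R * s) h.
Proof.
move=> s0 ch; elim: m => [|m IHm].
  by rewrite big_ord0 mul0r /Int set_itv1 Rintegral_set1.
rewrite big_ord_recr /= -IHm; apply: Int_chasles => //.
  by rewrite mulr_ge0.
by rewrite ler_wpM2r// ler_nat.
Qed.

(* The equidistributed sums with [m] nodes have period [2 pi / m], so they
   oscillate little and are uniformly close to the mean. *)
Lemma le_avg_of_sums h c : continuous h -> (forall t, h (t + 2 * pi) = h t) ->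
  (forall m, (0 < m)%N -> exists2 t : R, 0 <= t &
     c <= m%:R^-1 * \sum_(j < m) h (t + j%:R * (2 * pi / m%:R))) ->
  c <= avg h.
Proof.
move=> ch ph hm; apply/ler_addgt0Pr => e e0.
have [d d0 dP] := @unif_continuous_itv 0 (2 * pi) h ch e e0.
have p0 := twopi_gt0.
pose m := (Num.truncn (2 * pi / d)).+1.
have m0 : 0 < m%:R :> R by rewrite ltr0n.
have [t t0 ct] := hm m isT.
pose s : R := 2 * pi / m%:R.
have s0 : 0 < s by rewrite divr_gt0.
have sd : s < d.
  rewrite /s ltr_pdivrMr// [d * _]mulrC -ltr_pdivrMr//.
  exact: truncnS_gt.
have ms : m%:R * s = 2 * pi by rewrite mulrC divfK// gt_eqF.
pose H (x : R) := \sum_(j < m) h (x + j%:R * s).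
(* A shift by one step permutes the nodes cyclically, as [m s] is the period of [h]. So [t] can be
   reduced to [x] in [[0, s[], and each cell of length [s] then contains exactly one node. *)
have HS x : H (x + s) = H x.
  pose g j := h (x + j%:R * s).
  have -> : H (x + s) = \sum_(j < m) g j.+1.
    by apply: eq_bigr => j _; congr h; rewrite -natr1; ring.
  have -> : H x = \sum_(j < m) g j by [].
  have E : \sum_(j < m.+1) g j = \sum_(j < m) g j + g m by rewrite big_ord_recr.
  have E' : \sum_(j < m.+1) g j = g 0%N + \sum_(j < m) g j.+1.
    by rewrite big_ord_recl.
  have g0 : g m = g 0%N by rewrite /g ms mul0r addr0 ph.
  by apply: (addrI (g 0%N)); rewrite -E' E g0 addrC.
have Hk (k : nat) x : H (x + k%:R * s) = H x.
  elim: k => [|k IHk]; first by rewrite mul0r addr0.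
  by rewrite -natr1 mulrDl mul1r addrA HS.
pose k := Num.truncn (t / s).
have ts0 : 0 <= t / s by rewrite divr_ge0// ltW.
have /andP[kl kr] : k%:R <= t / s < k.+1%:R by exact: truncn_itv.
pose x := t - k%:R * s.
have x0 : 0 <= x by rewrite subr_ge0 -ler_pdivlMr.
have xs : x < s by rewrite ltrBlDr -[X in X + _]mul1r -mulrDl nat1r -ltr_pdivrMr.
have cH : c <= m%:R^-1 * H x.
  by apply: le_trans ct _; rewrite -(Hk k) /x subrK.
(* Cell by cell: on each cell [h] differs by less than [e] from its value at the node of that
   cell. *)
have HI : s * (H x - m%:R * e) <= Int 0 (2 * pi) h.
  rewrite -ms (Int_split _ (ltW s0) ch).
  have -> : s * (H x - m%:R * e) = \sum_(j < m) s * (h (x + j%:R * s) - e).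
    rewrite -mulr_sumr big_split /= sumr_const card_ord; congr (_ * (_ + _)).
    by rewrite mulNrn mulr_natl.
  apply: ler_sum => j _.
  have js : j%:R * s <= j.+1%:R * s by rewrite ler_pM2r// ler_nat.
  have jsE : j.+1%:R * s = j%:R * s + s by rewrite -natr1 mulrDl mul1r.
  have -> : s * (h (x + j%:R * s) - e) = (j.+1%:R * s - j%:R * s) * (h (x + j%:R * s) - e).
    by rewrite jsE; ring.
  apply: Int_ge_cst => // y /andP[yl yr].
  have jm : j.+1%:R * s <= 2 * pi by rewrite -ms ler_pM2r// ler_nat ltn_ord.
  have j0 : 0 <= j%:R * s by rewrite mulr_ge0// ltW.
  have : `|h y - h (x + j%:R * s)| < e.
    apply: dP; first by rewrite (le_trans j0 yl) (le_trans yr jm).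
    by rewrite ltr_norml; move: yr; rewrite jsE; (clear - sd x0 xs yl; lra).
  by rewrite ltr_norml => /andP[]; (clear; lra).
have : c - e <= avg h.
  apply: le_trans (_ : (2 * pi)^-1 * (s * (H x - m%:R * e)) <= _).
    have -> : (2 * pi)^-1 * (s * (H x - m%:R * e)) = m%:R^-1 * H x - e.
      rewrite -ms; move: (H x) (m%:R : R) m0 => Hx M M0.
      by field; rewrite !gt_eqF.
    by rewrite lerD2r.
  by rewrite ler_pM2l// invr_gt0.
by (clear; lra).
Qed.

End Average.

(** * Rotation invariance of the mean *)

Section Shift.
Variable R : realType.
Implicit Types (h : R -> R) (a b s : R).

Lemma Int_shift a b s h : a <= b -> continuous h ->
  Int a b (fun t => h (t + s)) = Int (a + s) (b + s) h.
Proof.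
move=> ab ch; rewrite /Int /Rintegral; congr fine.
pose F : R -> R := fun x => x + s.
have dF x : is_derive x (1 : R) F 1.
  by have := is_deriveD (is_derive_id x (1:R)) (is_derive_cst s x (1:R)); rewrite addr0.
have F1 : F^`() = cst 1.
  by apply/funext => x; rewrite derive1E; apply: derive_val.
have cF : continuous F by move=> x; apply: contD => //; exact: cst_continuous.
have /= -> := @integration_by_substitution_increasing R F h a b ab.
- by apply: eq_integral => x _; rewrite F1 /= mulr1.
- by move=> x y _ _ xy; rewrite /F ltrD2r.
- by rewrite F1 => x _; exact: cst_continuous.
- by rewrite F1; exact: is_cvg_cst.
- by rewrite F1; exact: is_cvg_cst.
- split; first by move=> x _; exact: ex_derive.
    by apply: cvg_at_right_filter; exact: cF.
  by apply: cvg_at_left_filter; exact: cF.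
- by apply: continuous_subspaceT.
Qed.

(** The two intervals differ by [[0, s]] and its translate by a period, over which the integrals
    agree. *)
Lemma avg_shift_ge0 s h : 0 <= s -> continuous h -> (forall t, h (t + 2 * pi) = h t) ->
  avg (fun t => h (t + s)) = avg h.
Proof.
move=> s0 ch ph; rewrite /avg; congr (_ * _).
have p0 := @twopi_gt0 R; have p1 := ltW p0.
rewrite Int_shift// add0r.
have E1 := @Int_chasles R 0 s (2 * pi + s) h s0 ltac:(by rewrite lerDr) ch.
have E2 := @Int_chasles R 0 (2 * pi) (2 * pi + s) h p1 ltac:(by rewrite lerDl) ch.
have E3 : Int (2 * pi) (2 * pi + s) h = Int 0 s h.
  rewrite [X in Int _ X _]addrC -{1}[2 * pi]add0r -Int_shift//.
  by congr Int; apply/funext => t; rewrite ph.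
by move: E2; rewrite E1 E3 => /eqP; rewrite addrC eq_sym addrC => /eqP; (clear; lra).
Qed.
End Shift.

(** * Continuous subharmonic functions and the maximum principle *)

Section Submean.
Variable R : realType.
Local Notation C := (CC R).
Implicit Types (g h : C -> R) (z w b : C) (r e : R).

Definition cnear g z := \forall w \near z, {for w, continuous g}.

Definition smv g z := exists2 rho : R, 0 < rho & forall r : R, 0 < r -> r < rho ->
  g z <= avg (fun t => g (z + rc r * cis t)).

(** Subharmonicity at one point: the submean inequality is asked at [z] alone, so a glued function
    can be treated point by point, each time with the branch that is convenient there. *)
Definition shl g z := cnear g z /\ smv g z.

Lemma cmod_circ z b t : cmod (z + b * cis t - z) = cmod b.
Proof. by rewrite addrC addKr cmodM cmod_cis mulr1. Qed.

Lemma continuous_affine z b : continuous (fun w : C => z + b * w).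
Proof.
move=> w; apply/cont_cmodCP => e e0.
have b0 : 0 < cmod b + 1 by rewrite ltr_wpDl// cmod_ge0.
exists (e / (cmod b + 1)); first exact: divr_gt0.
move=> y; rewrite ltr_pdivlMr// => ye.
rewrite (_ : _ - _ = b * (y - w)); last by ring.
rewrite cmodM; have := cmod_ge0 (y - w); (clear - ye; lra).
Qed.

Lemma continuous_circ g z b : (forall t, {for z + b * cis t, continuous g}) ->
  continuous (fun t => g (z + b * cis t)).
Proof.
move=> cg t; apply: (@continuous_comp _ _ _ (fun t => z + b * cis t) g t); last exact: cg.
apply: (@continuous_comp _ _ _ (@cis R) (fun w => z + b * w) t).
  exact: continuous_cis.
exact: continuous_affine.
Qed.

Lemma cnear_circ g z : cnear g z -> exists2 rho : R, 0 < rho &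
  forall b, cmod b < rho -> continuous (fun t => g (z + b * cis t)).
Proof.
move=> /nbhs_cmodP[rho rho0 cg]; exists rho => // b br.
by apply: continuous_circ => t; apply: cg; rewrite cmod_circ.
Qed.

Lemma cnear_at g z : cnear g z -> {for z, continuous g}.
Proof. exact: nbhs_singleton. Qed.

Lemma shl_at g z : shl g z -> {for z, continuous g}.
Proof. by case=> /cnear_at. Qed.

(** A subharmonic minorant that touches [g] at [z] hands over its submean inequality. Maxima, moduli
    and truncated logarithms are all obtained in this way. *)
Lemma shl_dom h g z : shl h z -> cnear g z ->
  (\forall w \near z, h w <= g w) -> g z <= h z -> shl g z.
Proof.
move=> [ch [r1 r10 h1]] cg /nbhs_cmodP[r2 r20 hg] gh; split => //.
have [r3 r30 ch3] := cnear_circ ch; have [r4 r40 cg4] := cnear_circ cg.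
exists (Num.min (Num.min r1 r2) (Num.min r3 r4)); first by rewrite !lt_min r10 r20 r30.
move=> r r0; rewrite !lt_min => /andP[/andP[rr1 rr2] /andP[rr3 rr4]].
apply: le_trans gh _; apply: le_trans (h1 r r0 rr1) _; apply: avg_le.
- by apply: ch3; rewrite cmod_rc gtr0_norm.
- by apply: cg4; rewrite cmod_rc gtr0_norm.
- by move=> t; apply: hg; rewrite cmod_circ cmod_rc gtr0_norm.
Qed.

Lemma cnear_cst (c : R) z : cnear (fun=> c) z.
Proof. by apply: (nbhs_cmodP z _).2; exists 1 => // w _; exact: cst_continuous. Qed.

Lemma shl_cst (c : R) z : shl (fun=> c) z.
Proof.
split; first exact: cnear_cst.
by exists 1 => // r _ _; rewrite avg_cst.
Qed.

Lemma shl_min g z : cnear g z -> (\forall w \near z, g z <= g w) -> shl g z.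
Proof. by move=> cg gz; apply: (@shl_dom (fun=> g z)) => //; exact: shl_cst. Qed.

Lemma shl_near g h z : shl h z -> (\forall w \near z, h w = g w) -> shl g z.
Proof.
move=> [ch mh] hg; apply: (@shl_dom h) => //.
- have /nbhs_cmodP[r1 r10 c1] := ch; have /nbhs_cmodP[r2 r20 c2] := hg.
  apply: (nbhs_cmodP z _).2; exists (Num.min r1 r2); first by rewrite lt_min r10.
  move=> w; rewrite lt_min => /andP[w1 w2]; apply/cont_cmodP => e e0.
  have /cont_cmodP/(_ e e0)[r3 r30 c3] := c1 w w1.
  exists (Num.min r3 (r2 - cmod (w - z))); first by rewrite lt_min r30 subr_gt0.
  move=> y; rewrite lt_min => /andP[y3 y2]; have yz : cmod (y - z) < r2 by have := cmod_tri w y z; (clear - y2; lra).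
  by rewrite -!c2//; exact: c3.
- by apply: filterS hg => w ->.
- by rewrite (nbhs_singleton hg).
Qed.

Lemma cnear2 g h k z : cnear g z -> cnear h z ->
  (forall w, {for w, continuous g} -> {for w, continuous h} -> {for w, continuous k}) ->
  cnear k z.
Proof. by move=> cg ch H; apply: filterS2 cg ch => w; exact: H. Qed.

Lemma shlD g h z : shl g z -> shl h z -> shl (fun w => g w + h w) z.
Proof.
move=> [cg [r1 r10 h1]] [ch [r2 r20 h2]]; split.
  by apply: (cnear2 cg ch) => w cw1 cw2; exact: contD.
have [r3 r30 ch3] := cnear_circ ch; have [r4 r40 cg4] := cnear_circ cg.
exists (Num.min (Num.min r1 r2) (Num.min r3 r4)); first by rewrite !lt_min r10 r20 r30.
move=> r r0; rewrite !lt_min => /andP[/andP[rr1 rr2] /andP[rr3 rr4]].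
rewrite avgD ?lerD//; first exact: h1.
- exact: h2.
- by apply: cg4; rewrite cmod_rc gtr0_norm.
- by apply: ch3; rewrite cmod_rc gtr0_norm.
Qed.

Lemma shlZ (c : R) g z : 0 <= c -> shl g z -> shl (fun w => c * g w) z.
Proof.
move=> c0 [cg [r1 r10 g1]]; split.
  by apply: (cnear2 cg cg) => w cw _; apply: continuousM => //; exact: cst_continuous.
have [r3 r30 cg3] := cnear_circ cg.
exists (Num.min r1 r3); first by rewrite !lt_min r10.
move=> r r0; rewrite !lt_min => /andP[rr1 rr3].
rewrite avgZ ?ler_wpM2l//; first exact: g1.
by apply: cg3; rewrite cmod_rc gtr0_norm.
Qed.

Lemma shl_sum (I : eqType) (s : seq I) (G : I -> C -> R) z :
  (forall i, i \in s -> shl (G i) z) -> shl (fun w => \sum_(i <- s) G i w) z.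
Proof.
elim: s => [|i s IHs] H.
  by under eq_fun do rewrite big_nil; exact: shl_cst.
under eq_fun do rewrite big_cons; apply: shlD; first by apply: H; rewrite mem_head.
by apply: IHs => j js; apply: H; rewrite inE js orbT.
Qed.

Lemma cnear_max g h z : cnear g z -> cnear h z -> cnear (fun w => Num.max (g w) (h w)) z.
Proof.
by move=> cg ch; apply: (cnear2 cg ch) => w cw1 cw2; exact: continuous_max.
Qed.

Lemma shl_max g h z : shl g z -> shl h z -> shl (fun w => Num.max (g w) (h w)) z.
Proof.
move=> sg sh; have cm := cnear_max sg.1 sh.1.
case: (leP (g z) (h z)) => gh.
  apply: (shl_dom sh cm).
    by apply: near_all => w; rewrite le_max lexx orbT.
  by rewrite (max_idPr gh).
apply: (shl_dom sg cm).
  by apply: near_all => w; rewrite le_max lexx.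
by rewrite (max_idPl (ltW gh)).
Qed.

Lemma circ_sqr z r t : cmod (z + rc r * cis t) ^+ 2 =
  cmod z ^+ 2 + r ^+ 2 + (2 * r * re z * cos t + 2 * r * im z * sin t).
Proof.
rewrite !cmod_sqr reD imD re_rcM im_rcM; case: z => x y; rewrite /re /im /cis /=.
have := cos2Dsin2 t.
have -> : (x + r * cos t) ^+ 2 + (y + r * sin t) ^+ 2 =
  x ^+ 2 + y ^+ 2 + r ^+ 2 * (cos t ^+ 2 + sin t ^+ 2) +
  (2 * r * x * cos t + 2 * r * y * sin t) by ring.
by move=> ->; rewrite mulr1.
Qed.

(** The mean exceeds the central value by [r ^+ 2]: the squared modulus is strictly subharmonic,
    which makes it the perturbation in the maximum principle. *)
Lemma avg_circ_sqr z r : avg (fun t => cmod (z + rc r * cis t) ^+ 2) =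
  cmod z ^+ 2 + r ^+ 2.
Proof.
have ccos := @continuous_cos R; have csin := @continuous_sin R.
have cZ c (h : R -> R) : continuous h -> continuous (fun t => c * h t).
  by move=> ch t; exact: (contZ (ch t)).
under eq_fun do rewrite circ_sqr.
have c1 := cZ (2 * r * re z) _ ccos; have c2 := cZ (2 * r * im z) _ csin.
have c12 : continuous (fun t => 2 * r * re z * cos t + 2 * r * im z * sin t).
  by move=> t; exact: (contD (c1 t) (c2 t)).
have c0 : continuous (fun _ : R => cmod z ^+ 2 + r ^+ 2) by exact: cst_continuous.
by rewrite (avgD c0 c12) (avgD c1 c2) avg_cst !avgZ// avg_cos avg_sin !mulr0 !addr0.
Qed.

(** After adding [e |z|^2] the submean inequality is strict, so a maximum on [X] cannot lie at a
    point where [g] is subharmonic; it lies in [Y]. Then [e] tends to zero. The set [Y] plays the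
    boundary of [X]. *)
Lemma max_principle (X Y : set C) g (m : R) : compact X ->
  (forall z, X z -> {for z, continuous g}) ->
  (forall z, X z -> ~ Y z -> nbhs z X /\ shl g z) ->
  (forall z, X z -> Y z -> g z <= m) ->
  forall z, X z -> g z <= m.
Proof.
move=> cX cg sg gm z0 Xz0.
pose q w := cmod w ^+ 2.
have cq : continuous q.
  by move=> w; apply: continuousM; exact: continuous_cmod.
have [zB _ qB] : exists2 c, c \in X & forall t, t \in X -> q t <= q c.
  by apply: compact_EVT_max => //; [exists z0|exact: continuous_subspaceT].
pose B := q zB + 1.
have B0 : 0 < B by rewrite ltr_wpDl// sqr_ge0.
suff H e : 0 < e -> g z0 <= m + e * B.
  apply/ler_addgt0Pr => e e0; apply: le_trans (H (e / B) _) _; first exact: divr_gt0.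
  by rewrite divfK// gt_eqF.
move=> e0; pose G w := g w + e * q w.
have cG w : X w -> {for w, continuous G}.
  move=> Xw; apply: contD; first exact: cg.
  by apply: contZ; exact: cq.
have [z1 Xz1 Gz1] : exists2 c, c \in X & forall t, t \in X -> G t <= G c.
  apply: compact_EVT_max => //; first by exists z0.
  by apply: continuous_in_subspaceT => w /set_mem; exact: cG.
move: Xz1; rewrite inE => Xz1.
have qX w : X w -> 0 <= q w <= B.
  move=> Xw; rewrite sqr_ge0 /= (le_trans (qB w _)) ?inE// /B; (clear; lra).
have Gle := Gz1 z0 (mem_set Xz0).
have [Yz1|nYz1] := pselect (Y z1).
  have g1 := gm _ Xz1 Yz1.
  have /andP[_ q1] := qX _ Xz1; have /andP[q0 _] := qX _ Xz0.
  have : e * q z1 <= e * B by rewrite ler_pM2l.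
  by have : 0 <= e * q z0 by [rewrite mulr_ge0// ltW]; move: Gle; rewrite /G; (clear - g1; lra).
exfalso; have [/nbhs_cmodP[r1 r10 X1] [/cnear_circ[r2 r20 c2] [r3 r30 s3]]] := sg _ Xz1 nYz1.
pose r := Num.min r1 (Num.min r2 r3) / 2.
have rm : 0 < Num.min r1 (Num.min r2 r3) by rewrite !lt_min r10 r20.
have r0 : 0 < r by rewrite divr_gt0.
have : r < Num.min r1 (Num.min r2 r3) by rewrite /r; (clear - rm; lra).
rewrite !lt_min => /andP[rr1 /andP[rr2 rr3]].
have cgc : continuous (fun t => g (z1 + rc r * cis t)).
  by apply: c2; rewrite cmod_rc gtr0_norm.
have cqc : continuous (fun t => q (z1 + rc r * cis t)).
  by apply: continuous_circ => t; exact: cq.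
have ceqc : continuous (fun t => e * q (z1 + rc r * cis t)).
  by move=> t; exact: (contZ (cqc t)).
have : avg (fun t => G (z1 + rc r * cis t)) <= G z1.
  apply: avg_le_cst => [t|t]; first exact: (contD (cgc t) (ceqc t)).
  by apply: Gz1; rewrite inE; apply: X1; rewrite cmod_circ cmod_rc gtr0_norm.
rewrite avgD// avgZ// avg_circ_sqr /G -/(q _).
have := s3 r r0 rr3.
have : 0 < e * r ^+ 2 by rewrite mulr_gt0// exprn_gt0.
by rewrite mulrDr; (clear; lra).
Qed.

Lemma shl_rot g z0 s z : 0 <= s -> shl g (z0 + cis s * (z - z0)) ->
  shl (fun w => g (z0 + cis s * (w - z0))) z.
Proof.
move=> s0 [cg [r1 r10 g1]].
have E w : z0 + cis s * (w - z0) - (z0 + cis s * (z - z0)) = cis s * (w - z) by ring.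
have cL (w : C) : {for w, continuous (fun w => z0 + cis s * (w - z0))}.
  apply/cont_cmodCP => e e0; exists e => // y ye.
  by rewrite (_ : _ - _ = cis s * (y - w)); [rewrite cmodM cmod_cis mul1r|ring].
split.
  have /nbhs_cmodP[r r0 cr] := cg; apply: (nbhs_cmodP z _).2; exists r => // w wr.
  apply: (@continuous_comp _ _ _ (fun w => z0 + cis s * (w - z0)) g w); first exact: cL.
  by apply: cr; rewrite E cmodM cmod_cis mul1r.
have [r2 r20 c2] := cnear_circ cg.
exists (Num.min r1 r2); first by rewrite lt_min r10.
move=> r r0; rewrite lt_min => /andP[rr1 rr2].
apply: le_trans (g1 r r0 rr1) _.
rewrite -(avg_shift_ge0 s0).
- under [X in _ <= avg X]eq_fun => t.
    rewrite (_ : _ + _ = z0 + cis s * (z - z0) + rc r * cis (t + s)); first over.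
    by rewrite cisD; ring.
  by [].
- by apply: c2; rewrite cmod_rc gtr0_norm.
- by move=> t; rewrite cis2pi.
Qed.

(** Passes from small radii to the whole disk without a Poisson integral. The sum [G] of the [m]
    rotations of [g] about [z0] is subharmonic and equals [m g z0] at the centre, so the maximum
    principle gives a point of the circle where the equidistributed sum is at least that;
    [le_avg_of_sums] concludes. *)
Lemma submean_disk g z0 b :
  (forall z, cmod (z - z0) <= cmod b -> {for z, continuous g}) ->
  (forall z, cmod (z - z0) < cmod b -> shl g z) ->
  g z0 <= avg (fun t => g (z0 + b * cis t)).
Proof.
move=> cg sg; have [->|b0] := eqVneq b 0.
  by under eq_fun do rewrite mul0r addr0; rewrite avg_cst.
have bp : 0 < cmod b by rewrite cmod_gt0.
have ch : continuous (fun t => g (z0 + b * cis t)).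
  by apply: continuous_circ => t; apply: cg; rewrite cmod_circ.
apply: le_avg_of_sums => // [t|m m0]; first by rewrite cis2pi.
have m0R : 0 < m%:R :> R by rewrite ltr0n.
pose s : R := 2 * pi / m%:R.
have s0 : 0 < s by rewrite divr_gt0// twopi_gt0.
pose H (t : R) := \sum_(j <- iota 0 m) g (z0 + b * cis (t + j%:R * s)).
have cH : continuous H.
  move=> t; apply: cont_sum => j _.
  apply: (@continuous_comp _ _ _ (fun t : R => t + j%:R * s) (fun t => g (z0 + b * cis t))).
    by apply: contD => //; exact: cst_continuous.
  exact: ch.
have [t0] := @EVT_max R H 0 (2 * pi) (ltW (twopi_gt0 R)) (continuous_subspaceT cH).
rewrite in_itv /= => /andP[t00 _] Ht0; exists t0 => //.
rewrite ler_pdivlMl//.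
have -> : \sum_(j < m) g (z0 + b * cis (t0 + j%:R * (2 * pi / m%:R))) = H t0.
  by rewrite /H -[m in iota 0 m]subn0 -/(index_iota 0 m) big_mkord.
pose G w := \sum_(j <- iota 0 m) g (z0 + cis (j%:R * s) * (w - z0)).
have -> : m%:R * g z0 = G z0.
  rewrite /G; under eq_bigr do rewrite subrr mulr0 addr0.
  by rewrite big_const_seq count_predT size_iota iter_addr_0 mulr_natl.
have js0 (j : nat) : 0 <= j%:R * s by rewrite mulr_ge0// ltW.
have cmr (j : nat) w : cmod (z0 + cis (j%:R * s) * (w - z0) - z0) = cmod (w - z0).
  by rewrite addrC addKr cmodM cmod_cis mul1r.
apply: (@max_principle (cball z0 (cmod b)) [set w | cmod (w - z0) = cmod b] G (H t0)).
- exact: compact_cball.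
- move=> z zb; apply: cont_sum => j _.
  apply: (@continuous_comp _ _ _ (fun w => z0 + cis (j%:R * s) * (w - z0)) g z).
    apply/cont_cmodCP => e e0; exists e => // y ye.
    by rewrite (_ : _ - _ = cis (j%:R * s) * (y - z)); [rewrite cmodM cmod_cis mul1r|ring].
  by apply: cg; rewrite cmr.
- move=> z zb /eqP zb'.
  have zlt : cmod (z - z0) < cmod b by rewrite lt_neqAle zb'.
  split.
    apply: (nbhs_cmodP z _).2; exists (cmod b - cmod (z - z0)); first by rewrite subr_gt0.
    by move=> w wz; rewrite /cball /=; have := cmod_tri z w z0; (clear - wz; lra).
  apply: shl_sum => j _; apply: shl_rot => //.
  by apply: sg; rewrite cmr.
- move=> z _ /= zb.
  have [|t tP tE] := @cis_surj R ((z - z0) / b).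
    by rewrite cmodM cmodV zb divff// gt_eqF.
  have zE : z - z0 = b * cis t by rewrite -tE mulrC divfK.
  have -> : G z = H t.
    by apply: eq_bigr => j _; rewrite zE cisD; congr (g (_ + _)); ring.
  by apply: Ht0; rewrite in_itv.
- by rewrite /cball /= subrr cmod0 ltW.
Qed.

End Submean.

(** * Goursat's theorem on rectangles, in real coordinates *)

Section Goursat.
Variable R : realType.
Implicit Types (U V : R -> R -> R) (s t x y a b l e d : R).

(** Rectangles of fixed shape [a : b] are quartered. If [P] failed, it would fail on a nested
    sequence shrinking to a point, where the local hypothesis makes it hold for all small sizes. *)
Lemma bisection2 (P : R -> R -> R -> Prop) a b s0 t0 l0 : 0 < a -> 0 < b -> 0 < l0 ->
  (forall s t l, 0 < l -> P s t (l / 2) -> P (s + l / 2 * a) t (l / 2) ->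
     P s (t + l / 2 * b) (l / 2) -> P (s + l / 2 * a) (t + l / 2 * b) (l / 2) -> P s t l) ->
  (forall x y, s0 <= x <= s0 + l0 * a -> t0 <= y <= t0 + l0 * b ->
     exists2 d : R, 0 < d & forall s t l, 0 < l -> l < d ->
       s <= x <= s + l * a -> t <= y <= t + l * b -> P s t l) ->
  P s0 t0 l0.
Proof.
move=> a0 b0 l00 Pq Ploc; apply: contrapT => nP.
pose Q (p : R * R * R) (q : R * R) :=
  let: (s, t, l) := p in let: (s', t') := q in
  0 < l -> ~ P s t l ->
  ~ P s' t' (l / 2) /\ [/\ s <= s', s' + l / 2 * a <= s + l * a,
                            t <= t' & t' + l / 2 * b <= t + l * b].
have /choice[step stepP] : forall p, exists q, Q p q.
  move=> [[s t] l]; have [lp|lp] := ltP 0 l; last by exists (s, t) => /lt_geF; rewrite lp.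
  have la : l * a = l / 2 * a + l / 2 * a by field.
  have lb : l * b = l / 2 * b + l / 2 * b by field.
  have la0 : 0 < l / 2 * a by rewrite mulr_gt0// divr_gt0.
  have lb0 : 0 < l / 2 * b by rewrite mulr_gt0// divr_gt0.
  have [p1|p1] := pselect (P s t (l / 2)); last first.
    by exists (s, t) => _ _; split => //; split; (clear - la0 lb0; lra).
  have [p2|p2] := pselect (P (s + l / 2 * a) t (l / 2)); last first.
    by exists (s + l / 2 * a, t) => _ _; split => //; split; (clear - la0 lb0; lra).
  have [p3|p3] := pselect (P s (t + l / 2 * b) (l / 2)); last first.
    by exists (s, t + l / 2 * b) => _ _; split => //; split; (clear - la0 lb0; lra).
  have [p4|p4] := pselect (P (s + l / 2 * a) (t + l / 2 * b) (l / 2)); last first.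
    by exists (s + l / 2 * a, t + l / 2 * b) => _ _; split => //; split; (clear - la0 lb0; lra).
  by exists (s, t) => _ []; exact: Pq.
pose next (p : R * R * R) : R * R * R := (step p, p.2 / 2).
pose q n := iter n next (s0, t0, l0).
pose ss n := (q n).1.1; pose tt n := (q n).1.2; pose ll n := (q n).2.
have llE n : ll n = l0 / 2 ^+ n.
  elim: n => [|n IHn]; first by rewrite expr0 divr1.
  by rewrite /ll /q iterS /= -/(q n) -/(ll n) IHn exprSr invfM mulrA.
have ll0 n : 0 < ll n by rewrite llE divr_gt0// exprn_gt0.
have qE n : q n = (ss n, tt n, ll n) by rewrite /ss /tt /ll; case: (q n) => [[]].
have stepE n : 0 < ll n -> ~ P (ss n) (tt n) (ll n) ->
    ~ P (ss n.+1) (tt n.+1) (ll n.+1) /\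
    [/\ ss n <= ss n.+1, ss n.+1 + ll n.+1 * a <= ss n + ll n * a,
       tt n <= tt n.+1 & tt n.+1 + ll n.+1 * b <= tt n + ll n * b].
  have -> : ss n.+1 = (step (q n)).1 by [].
  have -> : tt n.+1 = (step (q n)).2 by [].
  have -> : ll n.+1 = ll n / 2 by [].
  by have := stepP (q n); rewrite {1}qE /Q; case: (step (q n)).
have inv n : ~ P (ss n) (tt n) (ll n).
  by elim: n => [|n IHn] //; have [] := stepE n (ll0 n) IHn.
have stp n := (stepE n (ll0 n) (inv n)).2.
have mono (u : nat -> R) : (forall n, u n <= u n.+1) -> forall m n, (m <= n)%N -> u m <= u n.
  by move=> h m n; apply: (homo_leq (r := <=%R)) => //; exact: le_trans.
have anti (u : nat -> R) : (forall n, u n.+1 <= u n) -> forall m n, (m <= n)%N -> u n <= u m.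
  by move=> h m n mn; rewrite -lerN2; apply: (mono (fun n => - u n)) => // k; rewrite lerN2.
have lim (u v : nat -> R) : (forall n, u n <= u n.+1) -> (forall n, v n.+1 <= v n) ->
    (forall n, u n <= v n) -> exists x, forall n, u n <= x <= v n.
  move=> hu hv uv; exists (sup (range u)) => n.
  have ub m : ubound (range u) (v m).
    move=> _ [k _ <-]; have [km|mk] := leqP k m.
      by apply: le_trans (uv m); exact: mono.
    by apply: le_trans (uv k) _; apply: anti => //; exact: ltnW.
  apply/andP; split; last by apply: ge_sup; [exists (u 0%N); exists 0%N|exact: ub].
  by apply: ub_le_sup; [exists (v 0%N); exact: ub|exists n].
have [x xP] := lim ss (fun n => ss n + ll n * a) (fun n => let: And4 h _ _ _ := stp n in h)
  (fun n => let: And4 _ h _ _ := stp n in h) (fun n => ltac:(by rewrite lerDl mulr_ge0// ltW)).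
have [y yP] := lim tt (fun n => tt n + ll n * b) (fun n => let: And4 _ _ h _ := stp n in h)
  (fun n => let: And4 _ _ _ h := stp n in h) (fun n => ltac:(by rewrite lerDl mulr_ge0// ltW)).
have [d d0 dP] := Ploc x y (xP 0%N) (yP 0%N).
pose n := (Num.truncn (l0 / d)).+1.
have : ll n < d.
  rewrite llE ltr_pdivrMr ?exprn_gt0// mulrC -ltr_pdivrMr//.
  apply: lt_le_trans (truncnS_gt _) _; rewrite -natrX ler_nat -/n.
  exact: ltnW (ltn_expl _ _).
by move=> lld; apply: (inv n); exact: dP.
Qed.

(** Differentiability of [U + i V] at [x + i y] with complex derivative [a + i b]; the
    Cauchy-Riemann equations are built into the two linear parts. *)
Definition CR_at U V x y := exists a b, forall e, 0 < e ->
  exists2 d : R, 0 < d & forall x' y', `|x' - x| < d -> `|y' - y| < d ->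
  `|U x' y' - U x y - (a * (x' - x) - b * (y' - y))| <= e * (`|x' - x| + `|y' - y|) /\
  `|V x' y' - V x y - (b * (x' - x) + a * (y' - y))| <= e * (`|x' - x| + `|y' - y|).

(** The imaginary part of the integral of [U + i V] along the rectangle, counterclockwise. *)
Definition flux U V s t k l :=
  Int t (t + l) (fun y => U (s + k) y - U s y) + Int s (s + k) (fun x => V x t - V x (t + l)).

Lemma goursat U V s t k l : 0 < k -> 0 < l ->
  (forall x, continuous (U x)) -> (forall y, continuous (V^~ y)) ->
  (forall x y, s <= x <= s + k -> t <= y <= t + l -> CR_at U V x y) ->
  flux U V s t k l = 0.
Proof.
move=> k0 l0 cU cV CR.
have cU2 x x' : continuous (fun y => U x y - U x' y).
  by move=> y; exact: (contB (cU x y) (cU x' y)).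
have cV2 y y' : continuous (fun x => V x y - V x y').
  by move=> x; exact: (contB (cV y x) (cV y' x)).
suff H e : 0 < e -> `|flux U V s t k l| <= e * (k + l) ^+ 2.
  apply/eqP; rewrite -normr_le0; apply/ler_addgt0Pr => e e0; rewrite add0r.
  have kl0 : 0 < (k + l) ^+ 2 by rewrite exprn_gt0// addr_gt0.
  by apply: le_trans (H (e / (k + l) ^+ 2) _) _; rewrite ?divr_gt0// divfK// gt_eqF.
move=> e0.
(* The bound is quadratic in the size [c], so the bounds of the four quarters add up to that of the
   rectangle. *)
pose P s t c := `|flux U V s t (c * k) (c * l)| <= e * (c * (k + l)) ^+ 2.
suff : P s t 1 by rewrite /P !mul1r.
apply: (@bisection2 P k l) => //.
- move=> {CR}s {}t c c0 P1 P2 P3 P4; rewrite /P.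
  have kh : 0 <= c / 2 * k by rewrite mulr_ge0 ?ltW// divr_gt0.
  have lh : 0 <= c / 2 * l by rewrite mulr_ge0 ?ltW// divr_gt0.
  have ck : c * k = c / 2 * k + c / 2 * k by field.
  have cl : c * l = c / 2 * l + c / 2 * l by field.
  have -> : flux U V s t (c * k) (c * l) =
    flux U V s t (c / 2 * k) (c / 2 * l) + flux U V (s + c / 2 * k) t (c / 2 * k) (c / 2 * l)
    + flux U V s (t + c / 2 * l) (c / 2 * k) (c / 2 * l)
    + flux U V (s + c / 2 * k) (t + c / 2 * l) (c / 2 * k) (c / 2 * l).
    rewrite /flux ck cl; move: (c / 2 * k) (c / 2 * l) kh lh => p q p0 q0.
    rewrite !addrA.
    rewrite (@Int_chasles R t (t + q) (t + q + q)) ?lerDl//.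
    rewrite (@Int_chasles R s (s + p) (s + p + p)) ?lerDl//.
    by rewrite !IntB//; ring.
  move: P1 P2 P3 P4; rewrite /P.
  set f1 := flux _ _ _ _ _ _; set f2 := flux _ _ _ _ _ _.
  set f3 := flux _ _ _ _ _ _; set f4 := flux _ _ _ _ _ _.
  rewrite (_ : c * (k + l) = 2 * (c / 2 * (k + l))); last by field.
  move: (c / 2 * (k + l)) => m; rewrite exprMn => h1 h2 h3 h4.
  have := ler_normD (f1 + f2 + f3) f4; have := ler_normD (f1 + f2) f3.
  by have := ler_normD f1 f2; (clear - h1 h2 h3 h4; lra).
- rewrite !mul1r => x y xs yt; have [a [b ab]] := CR x y xs yt.
  have e20 : 0 < e / 2 by rewrite divr_gt0.
  have [d d0 dP] := ab _ e20.
  have kl0 : 0 < k + l by rewrite addr_gt0.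
  exists (d / (k + l)); first by rewrite divr_gt0.
  move=> {CR xs yt}s {}t c c0; rewrite ltr_pdivlMr// => cd xs yt; rewrite /P.
  have ck0 : 0 < c * k by rewrite mulr_gt0.
  have cl0 : 0 < c * l by rewrite mulr_gt0.
  have mE : c * (k + l) = c * k + c * l by rewrite mulrDr.
  rewrite mE in cd *.
  move: (c * k) (c * l) ck0 cl0 xs yt cd {mE} => p q p0 q0 xs yt pqd.
  have sm x' y' : s <= x' <= s + p -> t <= y' <= t + q ->
      [/\ `|x' - x| < d, `|y' - y| < d & `|x' - x| + `|y' - y| <= p + q].
    move=> xs' yt'.
    have h1 : `|x' - x| <= p by rewrite ler_norml; (clear - xs xs'; lra).
    have h2 : `|y' - y| <= q by rewrite ler_norml; (clear - yt yt'; lra).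
    by split; (clear - pqd yt' h1 pqd xs' h2 h1 h2; lra).
  have hU : `|Int t (t + q) (fun y' => U (s + p) y' - U s y' - a * p)| <=
      (t + q - t) * (e * (p + q)).
    apply: Int_abs_cst; first by rewrite lerDl ltW.
      by move=> z; exact: (contB (cU2 (s + p) s z) (@cst_continuous _ _ (a * p) _)).
    move=> y' yt'.
    have [|//|h1 h2 h3] := sm (s + p) y'; first by (clear - xs; lra).
    have [|//|h4 h5 h6] := sm s y'; first by (clear - xs; lra).
    have [u1 _] := dP _ _ h1 h2; have [u2 _] := dP _ _ h4 h5.
    have v1 : e / 2 * (`|s + p - x| + `|y' - y|) <= e / 2 * (p + q) by rewrite ler_pM2l.
    have v2 : e / 2 * (`|s - x| + `|y' - y|) <= e / 2 * (p + q) by rewrite ler_pM2l.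
    move: (le_trans u1 v1) (le_trans u2 v2); rewrite !ler_norml; (clear; lra).
  have hV : `|Int s (s + p) (fun x' => V x' t - V x' (t + q) - (- a * q))| <=
      (s + p - s) * (e * (p + q)).
    apply: Int_abs_cst; first by rewrite lerDl ltW.
      by move=> z; exact: (contB (cV2 t (t + q) z) (@cst_continuous _ _ (- a * q) _)).
    move=> x' xs'.
    have [//||h1 h2 h3] := sm x' t; first by (clear - yt; lra).
    have [//||h4 h5 h6] := sm x' (t + q); first by (clear - yt; lra).
    have [_ u1] := dP _ _ h1 h2; have [_ u2] := dP _ _ h4 h5.
    have v1 : e / 2 * (`|x' - x| + `|t - y|) <= e / 2 * (p + q) by rewrite ler_pM2l.
    have v2 : e / 2 * (`|x' - x| + `|t + q - y|) <= e / 2 * (p + q) by rewrite ler_pM2l.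
    move: (le_trans u1 v1) (le_trans u2 v2); rewrite !ler_norml; (clear; lra).
  move: hU hV; rewrite !IntB//; try exact: cst_continuous.
  have tq : t <= t + q by rewrite lerDl ltW.
  have sp : s <= s + p by rewrite lerDl ltW.
  rewrite !Int_cst//.
  rewrite /flux !IntB//.
  set i1 := Int t (t + q) (U (s + p)); set i2 := Int t (t + q) (U s).
  set i3 := Int s (s + p) (V^~ t); set i4 := Int s (s + p) (V^~ (t + q)).
  move=> hU hV.
  (* The linear part contributes [q (a p)] from the vertical sides and [- p (a q)] from the
     horizontal ones; only the two remainders are left. *)
  have -> : i1 - i2 + (i3 - i4) = (i1 - i2 - (t + q - t) * (a * p)) +
     (i3 - i4 - (s + p - s) * (- a * q)) by ring.
  apply: le_trans (ler_normD _ _) _; apply: le_trans (lerD hU hV) _.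
  by rewrite le_eqVlt; apply/orP; left; apply/eqP; ring.
Qed.

End Goursat.

(** * Complex differentiability and the mean value property *)

Section Holomorphic.
Variable R : realType.
Local Notation C := (CC R).
Implicit Types (F G : C -> C) (z w b : C) (r e : R).

(** Written without a quotient, so that [w = z] is no special case. *)
Definition cdiff F z := exists L : C, forall e : R, 0 < e -> exists2 d : R, 0 < d &
  forall w, cmod (w - z) < d -> cmod (F w - F z - L * (w - z)) <= e * cmod (w - z).

Lemma derivable_cdiff F z : derivable F z 1 <-> cdiff F z.
Proof.
have E (L h : C) : h != 0 ->
    h^-1 * (F (h + z) - F z) - L = h^-1 * (F (h + z) - F z - L * (h + z - z)).
  by move=> h0; field.
split.
  move=> /cvg_ex[/= L FL]; exists L => e e0.
  have : nbhs (L : C) (disk (L : C) e) by apply: (nbhs_cmodP (L : C) _).2; exists e.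
  move=> /FL /nbhs_cmodP[d d0 dP]; exists d => // w wz.
  have [->|wz0] := eqVneq w z; first by rewrite !subrr mulr0 subrr cmod0 mulr0.
  have h0 : w - z != 0 by rewrite subr_eq0.
  have := dP (w - z); rewrite subr0 => /(_ wz h0).
  rewrite /disk /= scaler1 /GRing.scale /= E// subrK cmodM cmodV => /ltW.
  by rewrite ler_pdivrMl ?cmod_gt0// [e * _]mulrC.
move=> [L FL]; apply/cvg_ex; exists L => /= P /nbhs_cmodP[e e0 eP].
have e20 : 0 < e / 2 by rewrite divr_gt0.
have [d d0 dP] := FL _ e20.
apply: (nbhs_cmodP (0 : C) _).2; exists d => // h; rewrite subr0 => hd h0; apply: eP.
rewrite scaler1 /GRing.scale /= E// cmodM cmodV.
have := dP (h + z); rewrite addrK => /(_ hd) H.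
rewrite mulrC ltr_pdivrMr ?cmod_gt0//; apply: le_lt_trans H _.
by rewrite ltr_pM2r ?cmod_gt0//; (clear - e20; lra).
Qed.

Lemma cdiff_cont F z : cdiff F z -> {for z, continuous F}.
Proof.
move=> [L FL]; apply/cont_cmodCP => e e0.
have [d d0 dP] := FL 1 ltr01.
have L0 : 0 < cmod L + 1 by rewrite ltr_wpDl// cmod_ge0.
exists (Num.min d (e / (cmod L + 1))); first by rewrite lt_min d0 divr_gt0.
move=> w; rewrite lt_min => /andP[wd]; rewrite ltr_pdivlMr// => we.
have := dP w wd; rewrite mul1r => h.
rewrite (_ : F w - F z = (F w - F z - L * (w - z)) + L * (w - z)); last by ring.
by apply: le_lt_trans (cmodD _ _) _; rewrite cmodM; (clear - we h; lra).
Qed.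

Lemma cdiff_affine F a b z : cdiff F (a + b * z) -> cdiff (fun w => F (a + b * w)) z.
Proof.
move=> [L FL]; exists (L * b) => e e0.
have b0 : 0 < cmod b + 1 by rewrite ltr_wpDl// cmod_ge0.
have [d d0 dP] := FL (e / (cmod b + 1)) (divr_gt0 e0 b0).
exists (d / (cmod b + 1)); first exact: divr_gt0.
move=> w; rewrite ltr_pdivlMr// => wd.
have E : a + b * w - (a + b * z) = b * (w - z) by ring.
have bw : cmod (b * (w - z)) <= cmod (w - z) * (cmod b + 1).
  by rewrite cmodM; have := cmod_ge0 (w - z); (clear; lra).
have := dP (a + b * w); rewrite E mulrA => /(_ (le_lt_trans bw wd)) h.
apply: le_trans h _; apply: le_trans (ler_wpM2l _ bw) _.
  by rewrite divr_ge0 ?ltW.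
by rewrite le_eqVlt; apply/orP; left; apply/eqP; field; rewrite gt_eqF.
Qed.

Lemma cdiff_id z : cdiff id z.
Proof. by apply/derivable_cdiff; exact: derivable_id. Qed.

Lemma cdiff_cst b z : cdiff (fun=> b) z.
Proof. by apply/derivable_cdiff; exact: derivable_cst. Qed.

Lemma cdiffB F G z : cdiff F z -> cdiff G z -> cdiff (fun w => F w - G w) z.
Proof. by rewrite -!derivable_cdiff; exact: derivableB. Qed.

Lemma cdiffM F G z : cdiff F z -> cdiff G z -> cdiff (fun w => F w * G w) z.
Proof. by rewrite -!derivable_cdiff; exact: derivableM. Qed.

Lemma cdiffV F z : F z != 0 -> cdiff F z -> cdiff (fun w => (F w)^-1) z.
Proof. by move=> F0; rewrite -!derivable_cdiff; exact: derivableV. Qed.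

Lemma cdiff_prod (I : eqType) (s : seq I) (P : I -> C -> C) z :
  (forall i, i \in s -> cdiff (P i) z) -> cdiff (fun w => \prod_(i <- s) P i w) z.
Proof.
elim: s => [|i s IHs] H.
  by under eq_fun do rewrite big_nil; exact: cdiff_cst.
under eq_fun do rewrite big_cons; apply: cdiffM; first by apply: H; rewrite mem_head.
by apply: IHs => j js; apply: H; rewrite inE js orbT.
Qed.

Lemma is_derive_bound (f : R -> R) (x l : R) : is_derive x 1 f l -> forall e, 0 < e ->
  exists2 d : R, 0 < d & forall h : R, `|h| < d -> `|f (x + h) - f x - l * h| <= e * `|h|.
Proof.
move=> [+ lE] e e0; rewrite /derivable => df.
have : (fun h : R => h^-1 *: (f (h *: 1 + x) - f x)) @ 0^' --> l by rewrite -lE.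
move=> /cvgrPdist_lt/(_ _ e0)/nbhs_ballP[d/= d0 dP]; exists d => // h hd.
have [->|h0] := eqVneq h 0; first by rewrite addr0 subrr mulr0 subrr normr0 mulr0.
have : `|l - h^-1 *: (f (h *: 1 + x) - f x)| < e.
  by apply: dP => //; rewrite /ball /= sub0r normrN.
rewrite scaler1 /GRing.scale /= => /ltW.
rewrite distrC (_ : _ - l = h^-1 * (f (x + h) - f x - l * h)).
  by rewrite normrM normfV ler_pdivrMl ?normr_gt0// [e * _]mulrC.
by rewrite [h + x]addrC; field.
Qed.

Lemma exp_cis_bound e : 0 < e -> exists2 d : R, 0 < d &
  forall h k : R, `|h| < d -> `|k| < d ->
  cmod (rc (expR h) * cis k - 1 - (Complex h k : C)) <= e * (`|h| + `|k|).
Proof.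
move=> e0; pose e1 := Num.min (e / 16) 1.
have e10 : 0 < e1 by rewrite lt_min divr_gt0//=.
have e1e : e1 <= e / 16 by rewrite ge_min lexx.
have e11 : e1 <= 1 by rewrite ge_min lexx orbT.
clearbody e1.
have [d1 d10 D1] := is_derive_bound (is_derive_expR (0 : R)) e10.
have [d2 d20 D2] := is_derive_bound (is_derive_cos (0 : R)) e10.
have [d3 d30 D3] := is_derive_bound (is_derive_sin (0 : R)) e10.
exists (Num.min (Num.min d1 d2) (Num.min d3 e1)); first by rewrite !lt_min d10 d20 d30.
move=> h k; rewrite !lt_min => /andP[/andP[hd1 hd2] /andP[hd3 he]].
move=> /andP[/andP[kd1 kd2] /andP[kd3 ke]].
have := D1 h hd1; rewrite expR0 add0r mul1r => E1.
have := D2 k kd2; rewrite cos0 sin0 add0r oppr0 mul0r subr0 => E2.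
have := D3 k kd3; rewrite cos0 sin0 add0r subr0 mul1r => E3.
have h0 := normr_ge0 h; have k0 := normr_ge0 k.
set X := expR h * cos k - 1 - h; set Y := expR h * sin k - k.
have -> : rc (expR h) * cis k - 1 - (Complex h k : C) = (Complex X Y : C).
  by apply: Ceq; rewrite !(reB, imB) ?re_rcM ?im_rcM /re /im /= ?subr0.
have hX : `|X| <= 8 * e1 * (`|h| + `|k|).
  rewrite (_ : X = (expR h - 1 - h) * cos k + (1 + h) * (cos k - 1)); last by rewrite /X; ring.
  apply: le_trans (ler_normD _ _) _; rewrite !normrM.
  have c1 : `|cos k| <= 1 by rewrite ler_norml cos_geN1 cos_le1.
  have h2 : `|1 + h| <= 2 by apply: le_trans (ler_normD _ _) _; rewrite normr1; (clear - e11 he; lra).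
  have := ler_pM (normr_ge0 _) (normr_ge0 _) E1 c1.
  have := ler_pM (normr_ge0 _) (normr_ge0 _) h2 E2.
  have : 0 <= e1 * `|h| by rewrite mulr_ge0// ltW.
  have : 0 <= e1 * `|k| by rewrite mulr_ge0// ltW.
  by rewrite mulrDr; (clear; lra).
have hY : `|Y| <= 8 * e1 * (`|h| + `|k|).
  rewrite (_ : Y = (expR h - 1) * sin k + (sin k - k)); last by rewrite /Y; ring.
  apply: le_trans (ler_normD _ _) _; rewrite !normrM.
  have s1 : `|sin k| <= 2 * `|k|.
    rewrite (_ : sin k = (sin k - k) + k); last by ring.
    apply: le_trans (ler_normD _ _) _.
    have : e1 * `|k| <= 1 * `|k| by rewrite ler_wpM2r.
    (clear - E3; lra).
  have h2 : `|expR h - 1| <= e1 + e1.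
    rewrite (_ : expR h - 1 = (expR h - 1 - h) + h); last by ring.
    apply: le_trans (ler_normD _ _) _.
    have : e1 * `|h| <= 1 * `|h| by rewrite ler_wpM2r.
    (clear - he E1; lra).
  have := ler_pM (normr_ge0 _) (normr_ge0 _) h2 s1.
  have : 0 <= e1 * `|h| by rewrite mulr_ge0// ltW.
  have : 0 <= e1 * `|k| by rewrite mulr_ge0// ltW.
  rewrite mulrDr; (clear - E3; lra).
have -> : (Complex X Y : C) = rc X + (Complex 0 1 : C) * rc Y.
  by rewrite /rc; congr Complex; ring.
apply: le_trans (cmodD _ _) _; rewrite cmodM !cmod_rc.
have -> : cmod (Complex 0 1 : C) = 1 by rewrite /= expr0n expr1n add0r sqrtr1.
have : e1 * (`|h| + `|k|) <= e / 16 * (`|h| + `|k|) by rewrite ler_wpM2r// addr_ge0.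
(clear - hX hY; lra).
Qed.

(** Composition with the exponential turns circles about [z0] into vertical segments. The truncation
    of [x] at [m] keeps the argument inside the disk for every real [x], since [goursat] asks for
    continuity along entire lines. *)
Lemma CR_polar F z0 (m x y : R) : x < m -> cdiff F (z0 + rc (expR x) * cis y) ->
  CR_at (fun x y => re (F (z0 + rc (expR (Num.min x m)) * cis y)))
        (fun x y => im (F (z0 + rc (expR (Num.min x m)) * cis y))) x y.
Proof.
move=> xm; set z := z0 + _; move=> [L FL].
pose M := L * (z - z0); pose ex := expR x.
have ex0 : 0 < ex by exact: expR_gt0.
have zE : z - z0 = rc ex * cis y by rewrite /z addrC addKr.
have cz : cmod (z - z0) = ex by rewrite zE cmodM cmod_cis mulr1 cmod_rc gtr0_norm.
exists (re M), (im M) => e e0.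
pose e1 := e / (4 * ex); pose e2 := e / (2 * (cmod L + 1) * ex).
have L0 : 0 < cmod L + 1 by rewrite ltr_wpDl// cmod_ge0.
have e10 : 0 < e1 by rewrite divr_gt0// mulr_gt0.
have e20 : 0 < e2 by rewrite divr_gt0// !mulr_gt0.
have [d1 d10 D1] := FL _ e10.
have [d2 d20 D2] := exp_cis_bound e20.
have [d4 d40 D4] := exp_cis_bound (ltr01 : 0 < 1 :> R).
pose d3 := d1 / (4 * ex).
have d30 : 0 < d3 by rewrite divr_gt0// mulr_gt0.
exists (Num.min (Num.min d2 d3) (Num.min (m - x) d4)).
  by rewrite !lt_min d20 d30 subr_gt0 xm.
move=> x' y'; rewrite !lt_min => /andP[/andP[xd2 xd3] /andP[xd4 xd5]].
move=> /andP[/andP[yd2 yd3] /andP[yd4 yd5]].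
have xm' : x' <= m by move: xd4; rewrite ltr_norml; (clear; lra).
rewrite (min_idPl xm') (min_idPl (ltW xm)) -/z.
set z' := z0 + _; set h := x' - x in xd2 xd3 xd4 xd5 *; set k := y' - y in yd2 yd3 yd4 yd5 *.
pose W := (Complex h k : C).
have wE : z' - z = (z - z0) * (rc (expR h) * cis k - 1).
  rewrite zE mulrBr mulr1 mulrACA -rcM -cisD -expRD.
  rewrite (_ : x + h = x') 1?(_ : y + k = y'); [|by rewrite /k; ring|by rewrite /h; ring].
  by rewrite /z /z'; ring.
have s0 : 0 <= `|h| + `|k| by rewrite addr_ge0.
have W1 : cmod W <= `|h| + `|k|.
  have -> : W = rc h + (Complex 0 1 : C) * rc k.
    by rewrite /W /rc; congr Complex; ring.
  apply: le_trans (cmodD _ _) _; rewrite cmodM !cmod_rc.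
  have -> : cmod (Complex 0 1 : C) = 1 by rewrite /= expr0n expr1n add0r sqrtr1.
  (clear; lra).
have w1 : cmod (z' - z) <= ex * (2 * (`|h| + `|k|)).
  rewrite wE cmodM cz ler_pM2l//.
  rewrite (_ : _ - 1 = (rc (expR h) * cis k - 1 - W) + W); last by rewrite subrK.
  by apply: le_trans (cmodD _ _) _; have := D4 h k xd5 yd5; rewrite -/W; (clear - W1; lra).
have wd : cmod (z' - z) < d1.
  apply: le_lt_trans w1 _; have : `|h| + `|k| < d3 + d3 by (clear - xd3 yd3; lra).
  rewrite -(ltr_pM2l (_ : 0 < ex * 2)) ?mulr_gt0// -mulrA => /lt_le_trans; apply.
  by rewrite /d3 le_eqVlt; apply/orP; left; apply/eqP; field; rewrite gt_eqF.
have main : cmod (F z' - F z - M * W) <= e * (`|h| + `|k|).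
  rewrite (_ : F z' - F z - M * W = (F z' - F z - L * (z' - z)) +
      M * (rc (expR h) * cis k - 1 - W)); last by rewrite wE /M; ring.
  apply: le_trans (cmodD _ _) _; rewrite cmodM.
  have t1 : cmod (F z' - F z - L * (z' - z)) <= e / 2 * (`|h| + `|k|).
    apply: le_trans (D1 _ wd) _; apply: le_trans (ler_wpM2l (ltW e10) w1) _.
    by rewrite /e1 le_eqVlt; apply/orP; left; apply/eqP; field; rewrite gt_eqF.
  have t2 : cmod M * cmod (rc (expR h) * cis k - 1 - W) <= e / 2 * (`|h| + `|k|).
    apply: le_trans (ler_wpM2l (cmod_ge0 _) (D2 _ _ xd2 yd2)) _.
    rewrite cmodM cz mulrA ler_wpM2r//.
    rewrite (_ : e / 2 = (cmod L + 1) * ex * e2); last by rewrite /e2; field; rewrite !gt_eqF.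
    apply: ler_wpM2r; first exact: ltW.
    by apply: ler_wpM2r; [exact: ltW|rewrite lerDl].
  (clear - t1 t2; lra).
have MW1 : re (M * W) = re M * h - im M * k by rewrite reM.
have MW2 : im (M * W) = im M * h + re M * k by rewrite imM addrC.
split.
  by rewrite -MW1 -!reB; apply: le_trans (abs_re _) main.
rewrite -MW2 -!imB; apply: le_trans main.
set u := _ - _; rewrite -(@ler_sqr R) ?nnegrE ?cmod_ge0//.
by rewrite cmod_sqr real_normK ?num_real// lerDr sqr_ge0.
Qed.

(** In logarithmic polar coordinates an annulus becomes a rectangle, and Goursat says that the mean
    does not depend on the radius; continuity at [z0] gives its value as the radius tends to
    zero. *)
Lemma mean_value_re F z0 r0 : 0 < r0 ->
  (forall z, cmod (z - z0) < r0 -> {for z, continuous F}) ->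
  (forall z, cmod (z - z0) < r0 -> z != z0 -> cdiff F z) ->
  forall r, 0 < r -> r < r0 -> avg (fun t => re (F (z0 + rc r * cis t))) = re (F z0).
Proof.
move=> r00 cF dF r rp rr0.
pose m := ln ((r + r0) / 2).
have rm0 : 0 < (r + r0) / 2 by rewrite divr_gt0// addr_gt0.
have em : expR m = (r + r0) / 2 by rewrite lnK.
have er x : expR (Num.min x m) < r0.
  apply: le_lt_trans (_ : expR m < r0); first by rewrite ler_expR ge_min lexx orbT.
  by rewrite em; (clear - rr0; lra).
have dist x y : cmod (z0 + rc (expR (Num.min x m)) * cis y - z0) = expR (Num.min x m).
  by rewrite cmod_circ cmod_rc gtr0_norm// expR_gt0.
pose U x y := re (F (z0 + rc (expR (Num.min x m)) * cis y)).
pose V x y := im (F (z0 + rc (expR (Num.min x m)) * cis y)).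
have cre (x : R) (f : C -> R) : continuous f ->
    continuous (fun y => f (F (z0 + rc (expR (Num.min x m)) * cis y))).
  move=> cf; apply: (@continuous_circ R (fun z => f (F z))) => t.
  by apply: continuous_comp; [apply: cF; rewrite dist|exact: cf].
have cU x : continuous (U x) by apply: cre; exact: continuous_re.
have cim : continuous (@im R).
  move=> z; apply/cont_cmodP => e e0; exists e => // w; apply: le_lt_trans.
  rewrite -imB -(@ler_sqr R) ?nnegrE ?cmod_ge0//.
  by rewrite cmod_sqr real_normK ?num_real// lerDr sqr_ge0.
have cV y : continuous (V^~ y).
  have -> : V^~ y = fun x => im (F (z0 + cis y * rc (expR (Num.min x m)))).
    by apply/funext => x; rewrite /V mulrC.
  move=> x; apply: (@continuous_comp _ _ _ (fun x : R => z0 + cis y * rc (expR (Num.min x m)))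
     (fun z => im (F z))).
    apply: (@continuous_comp _ _ _ (fun x : R => rc (expR (Num.min x m)) : C)
       (fun w => z0 + cis y * w)); last exact: continuous_affine.
    apply: continuous_pairC; last exact: cst_continuous.
    apply: (@continuous_comp _ _ _ (fun x : R => Num.min x m) (@expR R)); last exact: continuous_expR.
    by apply: continuous_min => //; exact: cst_continuous.
  rewrite [cis y * _]mulrC.
  by apply: continuous_comp; [apply: cF; rewrite dist|exact: cim].
pose s2 := ln r.
have s2m : s2 < m by rewrite ltr_ln ?posrE//; (clear - rr0; lra).
have es2 : expR (Num.min s2 m) = r by rewrite (min_idPl (ltW s2m)) lnK.
have p0 := @twopi_gt0 R.
have key s1 : s1 < s2 -> Int 0 (2 * pi) (U s2) = Int 0 (2 * pi) (U s1).
  move=> s12; have k0 : 0 < s2 - s1 by rewrite subr_gt0.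
  have := @goursat R U V s1 0 (s2 - s1) (2 * pi) k0 p0 cU cV.
  rewrite /flux add0r (_ : s1 + (s2 - s1) = s2); last by ring.
  (* The sides at the angles [0] and [2 pi] cancel by periodicity; the flux is then the difference
     of the two circle integrals. *)
  rewrite (_ : (fun x => V x 0 - V x (2 * pi)) = fun=> 0); last first.
    by apply/funext => x; rewrite /V -[2 * pi]add0r cis2pi subrr.
  rewrite (Int_cst 0 (ltW s12)) mulr0 addr0 (IntB _ _ (cU s2) (cU s1)) => H.
  apply/eqP; rewrite -subr_eq0; apply/eqP; apply: H => x y xs yt.
  apply: CR_polar; first by (clear - s2m xs; lra).
  have xE : Num.min x m = x by apply/min_idPl; (clear - s2m xs; lra).
  apply: dF; first by have := dist x y; rewrite xE => ->; rewrite -xE.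
  rewrite -subr_eq0 -cmod_eq0; have := dist x y; rewrite xE => ->.
  by rewrite gt_eqF// expR_gt0.
have avgE : avg (fun t => re (F (z0 + rc r * cis t))) = avg (U s2).
  by rewrite /U es2.
apply/eqP; rewrite -subr_eq0 -normr_le0; apply/ler_addgt0Pr => e e0; rewrite add0r.
have /cont_cmodP/(_ e e0)[d d0 dP] : {for z0, continuous (fun z => re (F z))}.
  by apply: continuous_comp; [apply: cF; rewrite subrr cmod0|exact: continuous_re].
(* A logarithmic radius so small that the circle lies where [F] is [e]-close to [F z0]. *)
pose s1 := Num.min (ln (d / 2)) (s2 - 1).
have s12 : s1 < s2 by rewrite gt_min ltrBlDr ltrDl ltr01 orbT.
have d20 : 0 < d / 2 by rewrite divr_gt0.
have s1d : expR s1 < d.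
  apply: le_lt_trans (_ : d / 2 < d); last by (clear - d20; lra).
  by rewrite -[leRHS](lnK (_ : d / 2 \is Num.pos)) ?posrE// ler_expR ge_min lexx.
rewrite avgE /avg (key _ s12) -/(avg (U s1)).
rewrite -(avg_cst (re (F z0))) -avgB//; last exact: cst_continuous.
have s1m : s1 < m by (clear - s2m s12; lra).
have bd t : `|U s1 t - re (F z0)| <= e.
  apply: ltW; apply: dP; rewrite dist.
  by rewrite (min_idPl (ltW s1m)).
rewrite ler_norml; apply/andP; split.
  apply: avg_ge_cst => [t|t]; first exact: (contB (cU s1 t) (@cst_continuous _ _ _ _)).
  by have := bd t; rewrite ler_norml => /andP[].
apply: avg_le_cst => [t|t]; first exact: (contB (cU s1 t) (@cst_continuous _ _ _ _)).
by have := bd t; rewrite ler_norml => /andP[].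
Qed.

End Holomorphic.

(** * Moduli and logarithms of holomorphic functions *)

Section HolomorphicSubmean.
Variable R : realType.
Local Notation C := (CC R).
Implicit Types (F G : C -> C) (z w b : C) (r e : R).

Definition hnear F z := \forall w \near z, cdiff F w.

Lemma hnear_cont F z : hnear F z -> \forall w \near z, {for w, continuous F}.
Proof. by apply: filterS => w; exact: cdiff_cont. Qed.

Lemma continuous_at_comp F (f : C -> R) w : {for w, continuous F} -> continuous f ->
  {for w, continuous (fun z => f (F z))}.
Proof. by move=> cF cf; apply: continuous_comp => //; exact: cf. Qed.

Lemma cdiffMl b F z : cdiff F z -> cdiff (fun w => b * F w) z.
Proof. by move=> dF; apply: cdiffM => //; exact: cdiff_cst. Qed.

(** The point [z] itself is exempt from differentiability; this accommodates a difference quotient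
    filled in by continuity, as in [removable_singularity]. *)
Lemma shl_re F z : (\forall w \near z, {for w, continuous F}) ->
  (\forall w \near z, w != z -> cdiff F w) -> shl (fun w => re (F w)) z.
Proof.
move=> cF dF; split.
  by apply: filterS cF => w cw; apply: continuous_at_comp => //; exact: continuous_re.
move/nbhs_cmodP : cF => [r1 r10 c1]; move/nbhs_cmodP : dF => [r2 r20 d2].
have r0 : 0 < Num.min r1 r2 by rewrite lt_min r10.
exists (Num.min r1 r2) => // r rp rr.
rewrite (mean_value_re r0)//.
- by move=> w; rewrite lt_min => /andP[/c1].
- by move=> w; rewrite lt_min => /andP[_ /d2].
Qed.

(** The real part of [F], rotated so that its value at [z] becomes positive, is a minorant of the
    modulus touching it at [z]. *)
Lemma shl_cmod F z : hnear F z -> shl (fun w => cmod (F w)) z.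
Proof.
move=> dF; have cF := hnear_cont dF.
have cmF : cnear (fun w => cmod (F w)) z.
  by apply: filterS cF => w cw; apply: continuous_at_comp => //; exact: continuous_cmod.
have [F0|F0] := eqVneq (F z) 0.
  apply: shl_min => //; apply: near_all => w; rewrite F0 cmod0; exact: cmod_ge0.
have f0 : 0 < cmod (F z) by rewrite cmod_gt0.
pose G w := (rc (cmod (F z)))^-1 * cjg (F z) * F w.
apply: (@shl_dom _ (fun w => re (G w))) => //.
- apply: shl_re; first by apply: hnear_cont; apply: filterS dF => w; exact: cdiffMl.
  by apply: filterS dF => w dw _; exact: cdiffMl.
- apply: near_all => w; apply: le_trans (re_le _) _.
  by rewrite !cmodM cmodV cmod_rc cmod_cjg ger0_norm ?cmod_ge0// mulVf ?gt_eqF// mul1r.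
- rewrite /G -mulrA [cjg _ * _]mulrC mul_cjg.
  have -> : (rc (cmod (F z)))^-1 * rc (cmod (F z) ^+ 2) = rc (cmod (F z)).
    rewrite expr2 rcM mulrA mulVf ?mul1r//.
    by rewrite -cmod_eq0 cmod_rc normr_eq0 gt_eqF.
  by [].
Qed.

Lemma ln_prod (I : eqType) (s : seq I) (f : I -> R) : (forall i, i \in s -> 0 < f i) ->
  0 < \prod_(i <- s) f i /\ ln (\prod_(i <- s) f i) = \sum_(i <- s) ln (f i).
Proof.
elim: s => [|i s IHs] H; first by rewrite !big_nil ln1.
have [j js|p0 pE] := IHs; first by apply: H; rewrite inE js orbT.
have fi0 : 0 < f i by apply: H; rewrite mem_head.
by rewrite !big_cons lnM ?posrE// mulr_gt0// pE.
Qed.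

Lemma continuous_ln_at (f : C -> R) z : {for z, continuous f} -> 0 < f z ->
  {for z, continuous (fun w => ln (f w))}.
Proof. by move=> cf f0; apply: continuous_comp => //; exact: continuous_ln. Qed.

Lemma near_neq0 F z : {for z, continuous F} -> F z != 0 -> \forall w \near z, F w != 0.
Proof.
move=> cF F0; have f0 : 0 < cmod (F z) by rewrite cmod_gt0.
have /cont_cmodCP/(_ _ f0)[r r0 rP] := cF.
apply: (nbhs_cmodP z _).2; exists r => // w /rP; apply: contraTneq => ->.
by rewrite sub0r cmodN ltxx.
Qed.

(** No branch of the logarithm is chosen. The product [P] of the [m] rotations of [F] about [z] is
    holomorphic with modulus [cmod (F z) ^+ m] at [z]. The maximum principle for the modulus of [P]
    gives a point of the circle where it is at least as large; taking logarithms yields the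
    equidistributed sums required by [le_avg_of_sums]. *)
Lemma shl_ln F z : hnear F z -> F z != 0 -> shl (fun w => ln (cmod (F w))) z.
Proof.
move=> dF F0; have cF := hnear_cont dF.
have nF := near_neq0 (nbhs_singleton cF) F0.
move: (dF) (nF) => /nbhs_cmodP[r1 r10 d1] /nbhs_cmodP[r2 r20 n2].
split.
  apply: filterS2 cF nF => w cw nw; apply: continuous_ln_at; last by rewrite cmod_gt0.
  by apply: continuous_at_comp => //; exact: continuous_cmod.
exists (Num.min r1 r2); first by rewrite lt_min r10.
move=> r rp; rewrite lt_min => /andP[rr1 rr2].
have cFa w : cmod (w - z) <= r -> {for w, continuous F}.
  by move=> wr; apply: cdiff_cont; apply: d1; (clear - rr1 wr; lra).
have Fa0 w : cmod (w - z) <= r -> 0 < cmod (F w).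
  by move=> wr; rewrite cmod_gt0; apply: n2; (clear - rr2 wr; lra).
have cr t : cmod (z + rc r * cis t - z) = r by rewrite cmod_circ cmod_rc gtr0_norm.
have ch : continuous (fun t => ln (cmod (F (z + rc r * cis t)))).
  apply: (@continuous_circ R (fun w => ln (cmod (F w)))) => t.
  apply: continuous_ln_at; last by apply: Fa0; rewrite cr.
  apply: continuous_at_comp; last exact: continuous_cmod.
  by apply: cFa; rewrite cr.
apply: le_avg_of_sums => // [t|m m0]; first by rewrite cis2pi.
have m0R : 0 < m%:R :> R by rewrite ltr0n.
pose s : R := 2 * pi / m%:R.
have s0 : 0 < s by rewrite divr_gt0// twopi_gt0.
have cmr (j : nat) w : cmod (z + cis (j%:R * s) * (w - z) - z) = cmod (w - z).
  by rewrite addrC addKr cmodM cmod_cis mul1r.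
pose P w := \prod_(j <- iota 0 m) F (z + cis (j%:R * s) * (w - z)).
have dP w : cmod (w - z) <= r -> hnear P w.
  move=> wr; apply: (nbhs_cmodP w _).2; exists (r1 - r); first by rewrite subr_gt0.
  move=> y yw; apply: cdiff_prod => j _.
  have -> : (fun w0 : C => F (z + cis (j%:R * s) * (w0 - z))) =
      (fun w0 => F (z - cis (j%:R * s) * z + cis (j%:R * s) * w0)).
    by apply/funext => v; congr F; ring.
  apply: cdiff_affine; apply: d1.
  rewrite (_ : _ - z = cis (j%:R * s) * (y - z)); last by ring.
  by rewrite cmodM cmod_cis mul1r; have := cmod_tri w y z; (clear - wr yw; lra).
pose H (t : R) := cmod (P (z + rc r * cis t)).
have cH : continuous H.
  apply: (@continuous_circ R (fun w => cmod (P w))) => t.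
  apply: continuous_at_comp; last exact: continuous_cmod.
  by apply: cdiff_cont; apply: nbhs_singleton; apply: dP; rewrite cr.
have [t0] := @EVT_max R H 0 (2 * pi) (ltW (twopi_gt0 R)) (continuous_subspaceT cH).
rewrite in_itv /= => /andP[t00 _] Ht0; exists t0 => //.
have PH : cmod (P z) <= H t0.
  apply: (@max_principle R (cball z r) [set w | cmod (w - z) = r] (fun w => cmod (P w))).
  - exact: compact_cball.
  - by move=> w wr; apply: shl_at; apply: shl_cmod; exact: dP.
  - move=> w wr /eqP wr'; split; last by apply: shl_cmod; exact: dP.
    have wlt : cmod (w - z) < r by rewrite lt_neqAle wr'.
    apply: (nbhs_cmodP w _).2; exists (r - cmod (w - z)); first by rewrite subr_gt0.
    by move=> y yw; rewrite /cball /=; have := cmod_tri w y z; (clear - yw; lra).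
  - move=> w _ /= wr.
    have [t tP tE] := polar_form (w - z).
    have -> : w = z + rc r * cis t by rewrite -wr -tE addrC subrK.
    by apply: Ht0; rewrite in_itv.
  - by rewrite /cball /= subrr cmod0 ltW.
have HE : H t0 = \prod_(j <- iota 0 m) cmod (F (z + rc r * cis (t0 + j%:R * s))).
  rewrite /H cmod_prod; apply: eq_bigr => j _.
  by rewrite cisD; congr (cmod (F (_ + _))); ring.
have H0 (j : nat) : j \in iota 0 m -> 0 < cmod (F (z + rc r * cis (t0 + j%:R * s))).
  by move=> _; apply: Fa0; rewrite cr.
have [Hp HlnE] := ln_prod H0.
have PE : cmod (P z) = cmod (F z) ^+ m.
  rewrite cmod_prod (eq_bigr (fun=> cmod (F z))); last first.
    by move=> j _; rewrite subrr mulr0 addr0.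
  by rewrite big_const_seq count_predT size_iota iter_mulr_1.
have f0 : 0 < cmod (F z) by rewrite cmod_gt0.
rewrite ler_pdivlMl//.
have -> : \sum_(j < m) ln (cmod (F (z + rc r * cis (t0 + j%:R * (2 * pi / m%:R))))) =
   \sum_(j <- iota 0 m) ln (cmod (F (z + rc r * cis (t0 + j%:R * s)))).
  by rewrite -[m in iota 0 m]subn0 -/(index_iota 0 m) big_mkord.
rewrite -HlnE -HE mulr_natl -lnXn// -PE ler_ln ?posrE//.
  by rewrite PE exprn_gt0.
by rewrite HE.
Qed.

Lemma hnear_sub (a : C) z : hnear (fun w => w - a) z.
Proof. by apply: near_all => w; apply: cdiffB; [exact: cdiff_id|exact: cdiff_cst]. Qed.

Lemma hnear_inv F z : hnear F z -> F z != 0 -> hnear (fun w => (F w)^-1) z.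
Proof.
move=> dF F0; have nF := near_neq0 (nbhs_singleton (hnear_cont dF)) F0.
by apply: filterS2 dF nF => w dw nw; exact: cdiffV.
Qed.

Lemma shl_ln_dist (a : C) z : z != a -> shl (fun w => ln (cmod (w - a))) z.
Proof.
by move=> za; apply: (@shl_ln (fun w => w - a)); [exact: hnear_sub|rewrite subr_eq0].
Qed.

(** Includes zero, where [ln] and the inverse both take the default value zero. *)
Lemma lnV_ge0 (x : R) : 0 <= x -> ln x^-1 = - ln x.
Proof.
rewrite le_eqVlt => /predU1P[<-|x0]; first by rewrite invr0 ln0// oppr0.
by rewrite lnV.
Qed.

Lemma shlN_ln_dist (a : C) z : z != a -> shl (fun w => - ln (cmod (w - a))) z.
Proof.
move=> za; have za0 : z - a != 0 by rewrite subr_eq0.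
have -> : (fun w : C => - ln (cmod (w - a))) = (fun w => ln (cmod ((w - a)^-1))).
  by apply/funext => w; rewrite cmodV lnV_ge0// cmod_ge0.
apply: shl_ln; first by apply: hnear_inv => //; exact: hnear_sub.
by rewrite invr_eq0.
Qed.

(* The truncation avoids the junk value [ln 0 = 0]. *)
Lemma shl_ln_max F z (c : R) : hnear F z -> 0 < c ->
  shl (fun w => ln (Num.max (cmod (F w)) c)) z.
Proof.
move=> dF c0; have cF := hnear_cont dF.
have cm : cnear (fun w => ln (Num.max (cmod (F w)) c)) z.
  apply: filterS cF => w cw; apply: continuous_ln_at; last by rewrite lt_max c0 orbT.
  apply: cont_max; last exact: cst_continuous.
  by apply: continuous_at_comp => //; exact: continuous_cmod.
case: (leP (cmod (F z)) c) => Fc.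
  apply: shl_min => //; apply: near_all => w; rewrite (max_idPr Fc) ler_ln ?posrE//.
    by rewrite le_max lexx orbT.
  by rewrite lt_max c0 orbT.
have F0 : F z != 0 by rewrite -cmod_gt0; apply: lt_trans Fc.
apply: (shl_dom (shl_ln dF F0)) => //; last by rewrite (max_idPl (ltW Fc)).
apply: filterS (near_neq0 (nbhs_singleton cF) F0) => w w0.
have h1 : 0 < cmod (F w) by rewrite cmod_gt0.
by rewrite ler_ln ?posrE ?le_max ?lexx// lt_max h1.
Qed.

End HolomorphicSubmean.

(** * Logarithmic potentials of masses spread over one scale *)

Section Barrier.
Variable R : realType.
Local Notation C := (CC R).
Implicit Types (x y r e : R) (z w b : C).

(** Bounds from below a discrete potential on a line. One of the two end nodes is at distance at
    least [m / 2] from [y]; it contributes the factor [m.+1 / 3] (the value [1] suffices while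
    [m <= 2]), and the induction hypothesis takes the others. *)
Lemma ge_prod_dist (m : nat) y :
  m`!%:R / 3 ^+ m <= \prod_(i < m) Num.max `|y - i%:R| 1.
Proof.
elim: m y => [|m IHm] y; first by rewrite big_ord0 fact0 expr0 divr1.
have key (u v : R) : 0 <= u -> m`!%:R / 3 ^+ m <= u -> m.+1%:R / 3 <= v ->
    m.+1`!%:R / 3 ^+ m.+1 <= v * u.
  move=> u0 hu hv.
  rewrite (_ : _ / _ = (m.+1%:R / 3) * (m`!%:R / 3 ^+ m)).
    by apply: ler_pM => //; rewrite ?divr_ge0 ?exprn_ge0.
  by rewrite factS natrM exprS invfM mulrACA.
have prod0 (x : R) : 0 <= \prod_(i < m) Num.max `|x - i%:R| 1.
  by apply: prodr_ge0 => i _; rewrite le_max ler01 orbT.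
have m1 : m.+1%:R = m%:R + 1 :> R by rewrite -natr1.
have m0 : 0 <= m%:R :> R by [].
have [ym|ym] := leP (m%:R / 2) y.
  rewrite big_ord_recl /=; apply: key.
  - by apply: prodr_ge0 => i _; rewrite le_max ler01 orbT.
  - apply: le_trans (IHm (y - 1)) _; rewrite le_eqVlt; apply/orP; left; apply/eqP.
    by apply: eq_bigr => i _; rewrite /bump /= natrD opprD addrA.
  - rewrite subr0 le_max; apply/orP; rewrite m1.
    have [mle|mgt] := leP (m%:R : R) 2; first by right; (clear - mle; lra).
    by left; apply: le_trans (ler_norm _); (clear - ym mgt; lra).
rewrite big_ord_recr /= [leRHS]mulrC; apply: key => //.
rewrite le_max; apply/orP; rewrite m1.
have [mle|mgt] := leP (m%:R : R) 2; first by right; (clear - mle; lra).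
by left; rewrite distrC; apply: le_trans (ler_norm _); (clear - ym mgt; lra).
Qed.

(** The induction step is [(1 + 1 / m) ^ m <= e]. *)
Lemma expn_le_fact (m : nat) : m%:R ^+ m <= expR 1 ^+ m * m`!%:R :> R.
Proof.
elim: m => [|m IHm]; first by rewrite !expr0 fact0 mul1r.
have [->|m0] := posnP m.
  by rewrite factS fact0 muln1 !expr1 mulr1; apply: le_trans (expR_ge1Dx _); rewrite lerDl ler01.
have mp : 0 < m%:R :> R by rewrite ltr0n.
have h : m.+1%:R ^+ m <= expR 1 * m%:R ^+ m :> R.
  have -> : m.+1%:R = m%:R * (1 + m%:R^-1) :> R.
    by rewrite mulrDr mulr1 divff ?gt_eqF// natr1.
  rewrite exprMn mulrC ler_wpM2r ?exprn_ge0//.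
  have -> : expR 1 = expR (m%:R^-1 : R) ^+ m.
    by rewrite -expRM_natl mulr_natl -mulr_natl divff ?gt_eqF.
  by rewrite lerXn2r ?nnegrE ?addr_ge0 ?expR_ge0 ?expR_ge1Dx.
rewrite exprS exprS factS natrM.
apply: le_trans (_ : m.+1%:R * (expR 1 * (expR 1 ^+ m * m`!%:R)) <= _).
  rewrite ler_wpM2l//; apply: le_trans h _.
  by rewrite ler_wpM2l ?expR_ge0.
by rewrite le_eqVlt; apply/orP; left; apply/eqP; ring.
Qed.

(** The loss of one scale. In the factor [6 e], the [3] comes from [ge_prod_dist], the [e] from
    [expn_le_fact], and the [2] from the masses being at distance at most [2 p] from [b]. *)
Let K : R := ln (6 * expR 1).

Lemma barrier_const_ge1 : 1 <= K.
Proof.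
rewrite /K -[leLHS](expRK (1 : R)) ler_ln ?posrE ?expR_gt0 ?mulr_gt0 ?expR_gt0//.
by rewrite ler_peMl ?expR_ge0//; (clear; lra).
Qed.

Lemma ln_ge_sub (x : R) : 0 <= x <= 2^-1 -> - (2 * x) <= ln (1 - x).
Proof.
move=> /andP[x0 x1]; have y0 : 0 < 1 - x by (clear - x1; lra).
rewrite lerNl -lnV ?posrE//; apply: le_trans (_ : (1 - x)^-1 - 1 <= _).
  by rewrite lerBrDl; apply: le_trans (expR_ge1Dx _) _; rewrite lnK// posrE invr_gt0.
rewrite lerBlDr -[leLHS]mul1r ler_pdivrMr//.
by nra.
Qed.

Section OneScale.
Variables (b : C) (p : R) (m : nat) (Z : nat -> C).
Hypotheses (p0 : 0 < p) (m0 : (0 < m)%N).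
Hypothesis ZE : forall i, (i < m)%N -> cmod (Z i - b) = p * (1 + i%:R / m%:R).

(** The potential of [m] equal masses of total mass one, normalized to vanish at [b]. *)
Let F z := \sum_(i <- iota 0 m)
   (m%:R)^-1 * (ln (cmod (z - Z i)) - ln (cmod (Z i - b))).

Let mR : 0 < m%:R :> R. Proof. by rewrite ltr0n. Qed.

Let Zr i : (i < m)%N -> p <= cmod (Z i - b) <= 2 * p.
Proof.
move=> im; rewrite ZE//.
have i0 : 0 <= i%:R / m%:R :> R by rewrite divr_ge0.
have i1 : i%:R / m%:R <= 1 :> R by rewrite ler_pdivrMr// mul1r ler_nat ltnW.
by rewrite -{1}[p]mulr1 [2 * p]mulrC !ler_pM2l// lerDl i0 -[2]/(1 + 1) lerD2l.
Qed.

Let sum_cst (c : R) : \sum_(i <- iota 0 m) (m%:R)^-1 * c = c.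
Proof.
rewrite -mulr_sumr big_const_seq count_predT size_iota iter_addr_0 -[c *+ m]mulr_natl.
by rewrite mulKf// gt_eqF.
Qed.

Let F_ge z (c : R) : (forall i, (i < m)%N -> c <= ln (cmod (z - Z i)) - ln (cmod (Z i - b))) ->
  c <= F z.
Proof.
move=> h; rewrite -(sum_cst c) /F big_seq [leRHS]big_seq; apply: ler_sum => i.
by rewrite mem_iota add0n => im; rewrite ler_pM2l ?invr_gt0// h.
Qed.

Lemma scale_small z : cmod (z - b) <= p / 2 -> - (2 * (cmod (z - b) / p)) <= F z.
Proof.
have pp : 0 < p := p0.
move=> zp; apply: F_ge => i im; have /andP[r1 r2] := Zr im.
set r := cmod (Z i - b) in r1 r2 *; set x := cmod (z - b) in zp *.
have r0 : 0 < r by lra.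
have x0 : 0 <= x := cmod_ge0 _.
have d1 : r - x <= cmod (z - Z i).
  by have := cmod_tri z (Z i) b; rewrite -/r -/x (cmodB (Z i) z); lra.
have d0 : 0 < r - x by lra.
have xr : x / r <= x / p by rewrite ler_wpM2l// lef_pV2.
have xr2 : 0 <= x / r <= 2^-1.
  by rewrite divr_ge0 ?(ltW r0)//= ler_pdivrMr//; lra.
apply: le_trans (_ : ln (1 - x / r) <= _).
  by apply: le_trans (ln_ge_sub xr2); lra.
rewrite lerBrDr -lnM ?posrE//; last by have /andP[] := xr2; lra.
rewrite (_ : (1 - x / r) * r = r - x); last by field; rewrite gt_eqF.
by rewrite ler_ln ?posrE//; exact: lt_le_trans d1.
Qed.

Lemma scale_large z : 4 * p <= cmod (z - b) -> ln (cmod (z - b) / (2 * p) - 1) <= F z.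
Proof.
have pp : 0 < p := p0.
move=> zp; apply: F_ge => i im; have /andP[r1 r2] := Zr im.
set r := cmod (Z i - b) in r1 r2 *; set x := cmod (z - b) in zp *.
have r0 : 0 < r by lra.
have d1 : x - r <= cmod (z - Z i).
  by have := cmod_tri (Z i) z b; rewrite -/r -/x; lra.
have q0 : 0 < x / (2 * p) - 1.
  by rewrite subr_gt0 ltr_pdivlMr ?mulr_gt0//; lra.
rewrite lerBrDr -lnM ?posrE//.
have q1 : (x / (2 * p) - 1) * r <= x - r.
  rewrite mulrBl mul1r lerD2r -mulrA -[leRHS]mulr1 ler_wpM2l//; first by lra.
  by rewrite mulrC ler_pdivrMr ?mulr_gt0// mul1r.
have q2 : 0 < (x / (2 * p) - 1) * r by rewrite mulr_gt0.
by rewrite ler_ln ?posrE//; lra.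
Qed.

Lemma scale_upper z : cmod (z - b) < p -> F z <= cmod (z - b) / p.
Proof.
have pp : 0 < p := p0.
move=> zp; rewrite -lerN2; have /le_trans -> // : - F z >= - (cmod (z - b) / p).
rewrite lerN2 -(sum_cst (cmod (z - b) / p)) /F big_seq [leRHS]big_seq; apply: ler_sum => i.
rewrite mem_iota add0n => im; rewrite ler_pM2l ?invr_gt0//.
have /andP[r1 r2] := Zr im.
set r := cmod (Z i - b) in r1 r2 *; set x := cmod (z - b) in zp *.
have r0 : 0 < r by lra.
have x0 : 0 <= x := cmod_ge0 _.
have d1 : cmod (z - Z i) <= x + r.
  by have := cmod_tri b z (Z i); rewrite (cmodB b) -/r -/x.
have d0 : 0 < cmod (z - Z i).
  by have := cmod_tri z (Z i) b; rewrite -/r -/x (cmodB (Z i) z); lra.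
rewrite -ln_div ?posrE//.
apply: le_trans (_ : cmod (z - Z i) / r - 1 <= _).
  rewrite lerBrDl; apply: le_trans (expR_ge1Dx _) _.
  by rewrite lnK// posrE divr_gt0.
rewrite lerBlDr; apply: le_trans (_ : (x + r) / r <= _).
  by rewrite ler_wpM2r// invr_ge0 ltW.
rewrite mulrDl divff ?gt_eqF// lerD2r.
by rewrite ler_wpM2l// lef_pV2.
Qed.

(** Circular projection: the distance from [z] to [Z i] is at least the difference of their
    distances to [b]. In units of [h = p / m] these are the distances from a number [y] to the
    integers [i < m], and the hypothesis keeps each at least [1], so [ge_prod_dist] applies. *)
Lemma scale_mid z : (forall i, (i < m)%N -> p / m%:R <= cmod (z - Z i)) -> - K <= F z.
Proof.
have pp : 0 < p := p0.
move=> far; set x := cmod (z - b); pose h := p / m%:R.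
have h0 : 0 < h by rewrite divr_gt0.
pose y := (x - p) / h.
have d i : (i < m)%N -> h * Num.max `|y - i%:R| 1 <= cmod (z - Z i).
  move=> im; rewrite maxr_pMr ?(ltW h0)// mulr1 ge_max far// andbT.
  rewrite -{1}(gtr0_norm h0) -normrM.
  have -> : h * (y - i%:R) = x - cmod (Z i - b).
    rewrite ZE// /y mulrBr mulrC divfK ?gt_eqF// /h.
    by field; rewrite gt_eqF.
  rewrite /x; apply: le_trans (cmod_dist _ _) _.
  by rewrite opprB addrA subrK.
pose M := 2 * m%:R : R.
have M0 : 0 < M by rewrite mulr_gt0.
have mx0 i : 0 < Num.max `|y - i%:R| 1 by rewrite lt_max ltr01 orbT.
have lb : \sum_(i <- iota 0 m) (m%:R)^-1 * ln (Num.max `|y - i%:R| 1 / M) <= F z.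
  rewrite /F big_seq [leRHS]big_seq; apply: ler_sum => i.
  rewrite mem_iota add0n => im; rewrite ler_pM2l ?invr_gt0//.
  have /andP[r1 r2] := Zr im.
  have r0 : 0 < cmod (Z i - b) by lra.
  have z0 : 0 < cmod (z - Z i) by apply: lt_le_trans (d i im); rewrite mulr_gt0.
  rewrite -ln_div ?posrE// ler_ln ?posrE ?divr_gt0//.
  rewrite ler_pdivrMr// mulrAC ler_pdivlMr//.
  apply: le_trans (_ : Num.max `|y - i%:R| 1 * (2 * p) <= _).
    by rewrite ler_wpM2l// ltW.
  apply: le_trans (_ : (h * Num.max `|y - i%:R| 1) * M <= _); last first.
    by rewrite ler_wpM2r ?(ltW M0)// d.
  rewrite le_eqVlt; apply/orP; left; apply/eqP.
  by rewrite /h /M; field; rewrite gt_eqF.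
apply: le_trans lb; rewrite -mulr_sumr.
have [|P0 <-] := @ln_prod R _ (iota 0 m) (fun i => Num.max `|y - i%:R| 1 / M).
  by move=> i _; rewrite divr_gt0.
rewrite ler_pdivlMl// mulrN mulr_natl -lnXn ?mulr_gt0 ?expR_gt0//.
have e6 : 0 < (6 * expR 1) ^+ m :> R by rewrite exprn_gt0// mulr_gt0 ?expR_gt0.
rewrite -lnV ?posrE// ler_ln ?posrE ?invr_gt0//.
have -> : \prod_(i <- iota 0 m) (Num.max `|y - i%:R| 1 / M) =
   (\prod_(i < m) Num.max `|y - i%:R| 1) / M ^+ m.
  rewrite big_split /= big_const_seq count_predT size_iota iter_mulr_1 exprVn.
  by rewrite -[m in iota 0 m]subn0 -/(index_iota 0 m) big_mkord.
rewrite ler_pdivlMr ?exprn_gt0//; apply: le_trans (ge_prod_dist m y).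
rewrite ler_pdivlMr ?exprn_gt0// -mulrA ler_pdivrMl// /M !exprMn.
have -> : 6 ^+ m = 2 ^+ m * 3 ^+ m :> R by rewrite -exprMn; congr (_ ^+ _); ring.
rewrite (_ : 2 ^+ m * m%:R ^+ m * 3 ^+ m = 2 ^+ m * 3 ^+ m * m%:R ^+ m :> R); last by ring.
by rewrite -[leRHS]mulrA ler_wpM2l ?expn_le_fact.
Qed.

(** A bound linear in the distance to [b], so that it can be summed over scales in geometric
    progression. *)
Lemma scale_bound z : (forall i, (i < m)%N -> p / m%:R <= cmod (z - Z i)) ->
  - (2 * K) * (cmod (z - b) / p) <= F z.
Proof.
have pp : 0 < p := p0.
move=> far; have K1 := barrier_const_ge1; set x := cmod (z - b).
have x0 : 0 <= x := cmod_ge0 _.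
have xp0 : 0 <= x / p by rewrite divr_ge0// ltW.
have [xp|xp] := leP x (p / 2).
  apply: le_trans (scale_small xp); rewrite mulNr lerN2 -/x; nra.
apply: le_trans (scale_mid far); rewrite mulNr lerN2.
have : 2^-1 <= x / p by rewrite ler_pdivlMr//; lra.
by nra.
Qed.

End OneScale.

End Barrier.

(** * The barrier of an open set that meets every circle about a point *)

Section CircleBarrier.
Variable R : realType.
Local Notation C := (CC R).
Implicit Types (x y r e u : R) (z w b : C) (O : set C).

(** The bound [16 / 3] is the one that is used; the bound by the next term carries the induction. *)
Lemma sum_geometric4_trunc u (J : nat) : 0 <= u ->
  \sum_(j <- iota 0 J) (if u * 4 ^+ j < 4 then u * 4 ^+ j else 0) <=
    Num.min (u * 4 ^+ J / 3) (16 / 3).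
Proof.
move=> u0; elim: J => [|J IHJ].
  by rewrite big_nil le_min divr_ge0 ?mulr_ge0 ?exprn_ge0.
rewrite -[J.+1]addn1 iotaD big_cat /= big_cons big_nil addr0 add0n addn1 exprSr.
move: IHJ; set T := \sum_(_ <- _) _; rewrite !le_min.
by move: (u * 4 ^+ J) (mulrA u (4 ^+ J) 4) => v -> /andP[h1 h2]; case: ifPn => hv;
  apply/andP; split; move: hv; rewrite -?leNgt; (clear - h1 h1 h2 h2; lra).
Qed.

(** A point of [O] on one circle is moved radially to the neighbouring circles, and compactness of
    [[s, r]] makes the size [k] of the free disk uniform. *)
Lemma circle_selection O b (s r : R) : 0 < s -> open O ->
  (forall t : R, s <= t <= r -> exists2 z, O z & cmod (z - b) = t) ->
  exists2 k : R, 0 < k & forall t : R, s <= t <= r ->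
    exists2 z, cmod (z - b) = t & forall w, cmod (w - z) < k -> O w.
Proof.
move=> s0 /open_cmodP oO Oc.
pose P (X : set R) := exists2 k : R, 0 < k & forall t : R, s <= t <= r -> X t ->
    exists2 z, cmod (z - b) = t & forall w, cmod (w - z) < k -> O w.
have [||X Y XY [k k0 kP]|X Y [k k0 kP] [k' k0' kP']|t|k k0 kP] := @compact_induction R `[s, r] P.
- exact: segment_compact.
- by exists 1.
- by exists k => // t st /XY; exact: kP.
- exists (Num.min k k'); first by rewrite lt_min k0.
  move=> t st [/(kP _ st)[z zt zO]|/(kP' _ st)[z zt zO]]; exists z => // w;
    rewrite lt_min => /andP[? ?]; exact: zO.
- rewrite /= in_itv /= => st; have [z Oz zt] := Oc t st.
  have [d d0 dP] := oO z Oz; have t0 : 0 < t by (clear - s0 st; lra).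
  exists (ball t (d / 2)); first by apply: nbhsx_ballx; rewrite divr_gt0.
  exists (d / 2); first by rewrite divr_gt0.
  move=> t' st' [_]; rewrite /ball /= => tt'.
  exists (b + rc (t' / t) * (z - b)).
    by rewrite addrC addKr cmodM cmod_rc zt ger0_norm ?divfK ?gt_eqF// divr_ge0; (clear - tt' s0 st' t0; lra).
  move=> w wd; apply: dP.
  have -> : w - z = (w - (b + rc (t' / t) * (z - b))) + rc (t' / t - 1) * (z - b).
    by rewrite (_ : rc (t' / t - 1) = rc (t' / t) - 1); [ring|rewrite rcD rcN].
  apply: le_lt_trans (cmodD _ _) _.
  have -> : cmod (rc (t' / t - 1) * (z - b)) = `|t - t'|.
    rewrite cmodM cmod_rc zt -{2}(gtr0_norm t0) -normrM mulrBl divfK ?gt_eqF// mul1r.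
    by rewrite distrC.
  (clear - tt' wd; lra).
by exists k => // t st; apply: kP => //; rewrite /= in_itv.
Qed.

(* The potential of a mass spread over all scales between [s] and [r], placed
   inside [O] on each circle: by circular projection it is at least the
   potential of the radial measure [dt / t], which is bounded below near [b]. *)
Lemma circle_barrier (r e : R) : 0 < r -> 0 < e ->
  exists s n : R, [/\ 0 < s, s < r, 0 < n & forall b O, open O ->
    (forall t : R, s <= t <= r -> exists2 z, O z & cmod (z - b) = t) ->
    exists N : C -> R, [/\ (forall z, ~ O z -> shl N z),
      (forall z, ~ O z -> N z <= 0),
      (forall z, ~ O z -> r <= cmod (z - b) -> N z <= -1) &
      (forall z, ~ O z -> cmod (z - b) <= n -> - e <= N z)]].
Proof.
move=> r0 e0; pose K : R := ln (6 * expR 1).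
have K1 : 1 <= K by exact: barrier_const_ge1.
(* A total loss valid at all scales together: [scale_bound] costs [2 K] times a sum that is at most
   [16 / 3]. *)
pose B : R := 11 * K.
have B0 : 0 < B by rewrite /B; (clear - K1; lra).
have l2 : 0 < ln 2 :> R by rewrite ln_gt0// ltr1n.
(* The number of scales. Each scale but the largest contributes at least [ln 2] at distance [r], and
   this gain has to outweigh the loss [B] by the factor [1 / e]. *)
pose J := (Num.truncn ((1 + B) / e / ln 2)).+1.
have Jl : (1 + B) / e < J%:R * ln 2.
  by rewrite -ltr_pdivrMr//; exact: truncnS_gt.
have J0 : 0 < J%:R :> R by rewrite ltr0n.
have BE : B = 11 * K by [].
clearbody B J.
pose p (j : nat) := r / 4 ^+ j.+1.
have p0 j : 0 < p j by rewrite divr_gt0// exprn_gt0.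
pose s := p J.
have s0 : 0 < s := p0 J.
have pS j : p j.+1 = p j / 4 by rewrite /p [4 ^+ j.+2]exprSr invfM mulrA.
have ps j : (j <= J)%N -> s <= p j.
  move=> jJ; rewrite /s /p ler_pM2l// lef_pV2 ?posrE ?exprn_gt0//.
  by rewrite ler_weXn2l// ler1n.
have pr j : p j <= r / 4.
  rewrite /p ler_pM2l// lef_pV2 ?posrE ?exprn_gt0// -[leLHS]expr1.
  by rewrite ler_weXn2l// ler1n.
have Jp : 0 < J%:R + 1 :> R by (clear - J0; lra).
(* So close to [b] each of the [J + 1] scales contributes at most [1 / (J + 1)], in total at most
   [1]. *)
pose n := s / ((J%:R + 1) * 2).
have n0 : 0 < n by rewrite divr_gt0// mulr_gt0.
exists s, n; split => //; first by have := pr J; rewrite -/s; (clear - s0; lra).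
move=> b O oO Oc.
have [k k0 kP] := circle_selection s0 oO Oc.
have /choice[Z ZP] : forall t : R, exists z : C, s <= t <= r ->
    cmod (z - b) = t /\ forall w, cmod (w - z) < k -> O w.
  move=> t; have [st|nst] := boolP (s <= t <= r); last by exists 0.
  by have [z z1 z2] := kP t st; exists z.
(* Masses have free disks of radius [k] in [O]; with [r / m < k], points off [O] are at distance at
   least [p j / m] from each of them, as [scale_bound] demands. *)
pose m := (Num.truncn (r / k)).+1.
have mR : 0 < m%:R :> R by rewrite ltr0n.
have mk : r / m%:R < k.
  by rewrite ltr_pdivrMr// mulrC -ltr_pdivrMr//; exact: truncnS_gt.
have m0 : (0 < m)%N by [].
clearbody m.
pose rr (j i : nat) : R := p j * (1 + i%:R / m%:R).
pose ZZ (j i : nat) := Z (rr j i).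
have rrP j i : (j <= J)%N -> (i < m)%N -> s <= rr j i <= r.
  move=> jJ im; have i0 : 0 <= i%:R / m%:R :> R by rewrite divr_ge0.
  have i1 : i%:R / m%:R <= 1 :> R by rewrite ler_pdivrMr// mul1r ler_nat ltnW.
  have := ps j jJ; have := pr j; have := p0 j; rewrite /rr.
  by move: (i%:R / m%:R) i0 i1 (p j) => u u0 u1 q q0 qr sq; apply/andP; split; nra.
have ZZr j i : (j <= J)%N -> (i < m)%N -> cmod (ZZ j i - b) = p j * (1 + i%:R / m%:R).
  by move=> jJ im; have [] := ZP _ (rrP j i jJ im).
have ZZf j i z : (j <= J)%N -> (i < m)%N -> ~ O z -> p j / m%:R <= cmod (z - ZZ j i).
  move=> jJ im nOz; have [_ h] := ZP _ (rrP j i jJ im).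
  apply: le_trans (_ : k <= _).
    apply: le_trans (ltW mk); rewrite ler_wpM2r ?invr_ge0 ?(ltW mR)//.
    by have := pr j; (clear - r0; lra).
  by rewrite leNgt; apply/negP => /h.
pose F j z := \sum_(i <- iota 0 m)
   (m%:R)^-1 * (ln (cmod (z - ZZ j i)) - ln (cmod (ZZ j i - b))).
pose S z := \sum_(j <- iota 0 J.+1) F j z.
have jin j : j \in iota 0 J.+1 -> (j <= J)%N by rewrite mem_iota add0n ltnS.
have iin i : i \in iota 0 m -> (i < m)%N by rewrite mem_iota add0n.
have S_ge z : ~ O z -> - B <= S z.
  move=> nOz; set x := cmod (z - b).
  have x0 : 0 <= x := cmod_ge0 _.
  pose u := x / r * 4.
  have u0 : 0 <= u by rewrite mulr_ge0// divr_ge0// ltW.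
  have uE j : x / p j = u * 4 ^+ j.
    by rewrite /u /p exprS; field; rewrite !gt_eqF// exprn_gt0.
  have h := sum_geometric4_trunc J.+1 u0; rewrite le_min in h.
  have {h}/andP[_ h] := h.
  apply: le_trans (_ : - (2 * K) * \sum_(j <- iota 0 J.+1)
      (if u * 4 ^+ j < 4 then u * 4 ^+ j else 0) <= _).
    by rewrite mulNr lerN2; apply: le_trans (ler_wpM2l _ h) _; rewrite ?BE; (clear - B0 BE B0 BE; lra).
  rewrite mulr_sumr /S big_seq [leRHS]big_seq; apply: ler_sum => j /jin jJ.
  rewrite -uE; case: ltP => xp.
    by apply: scale_bound => // i im; [exact: ZZr|exact: ZZf].
  rewrite mulr0; have xp' : 4 * p j <= x by rewrite -ler_pdivlMr.
  apply: le_trans (scale_large (p0 j) m0 (ZZr j ^~ jJ) xp').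
  have pj := p0 j; have h1 : 1 <= x / (2 * p j) - 1.
    by rewrite lerBrDr ler_pdivlMr ?mulr_gt0//; (clear - xp'; lra).
  exact: ln_ge0.
have S_far z : r <= cmod (z - b) -> J%:R * ln 2 <= S z.
  set x := cmod (z - b) => rx; rewrite /S /= big_cons.
  have Fj j : (j <= J)%N -> ln (x / (2 * p j) - 1) <= F j z.
    move=> jJ; apply: (scale_large (p0 j) m0 (ZZr j ^~ jJ)).
    by have := pr j; rewrite -/x; (clear - rx; lra).
  have F0 : 0 <= F 0%N z.
    apply: le_trans (Fj 0%N _) => //; apply: ln_ge0.
    by rewrite lerBrDr ler_pdivlMr ?mulr_gt0//; have := pr 0%N; (clear - rx; lra).
  rewrite -[leLHS]add0r; apply: lerD => //.
  have -> : J%:R * ln 2 = \sum_(j <- iota 1 J) ln 2 :> R.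
    by rewrite big_const_seq count_predT size_iota iter_addr_0 mulr_natl.
  rewrite big_seq [leRHS]big_seq; apply: ler_sum => j.
  rewrite mem_iota add1n ltnS => /andP[j0 jJ]; apply: le_trans (Fj j jJ).
  have pj : p j <= r / 16.
    case: j j0 {jJ} => // j _; rewrite pS; have := pr j; (clear; lra).
  have h3 : 2 <= x / (2 * p j) - 1.
    by rewrite lerBrDr ler_pdivlMr ?mulr_gt0//; have := p0 j; (clear - rx pj; lra).
  by rewrite ler_ln ?posrE//; (clear - h3; lra).
have S_near z : cmod (z - b) <= n -> S z <= 1.
  set x := cmod (z - b) => xn.
  have x0 : 0 <= x := cmod_ge0 _.
  apply: le_trans (_ : \sum_(j <- iota 0 J.+1) (J%:R + 1)^-1 <= _); last first.
    rewrite big_const_seq count_predT size_iota iter_addr_0 -[leLHS]mulr_natl.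
    by rewrite -natr1 divff ?gt_eqF.
  rewrite /S big_seq [leRHS]big_seq; apply: ler_sum => j /jin jJ.
  have xs : x * ((J%:R + 1) * 2) <= s.
    by rewrite -ler_pdivlMr ?mulr_gt0.
  have xJ : x * (J%:R + 1) <= p j.
    have := ps j jJ; have : 0 <= x * (J%:R + 1) by rewrite mulr_ge0// ltW.
    by rewrite mulrA in xs; (clear - xs; lra).
  have xp : x < p j.
    have := p0 j; have [->//|xn0] := eqVneq x 0.
    have xpos : 0 < x by rewrite lt_def xn0.
    by move=> _; apply: lt_le_trans xJ; rewrite ltr_pMr//; (clear - J0; lra).
  apply: le_trans (scale_upper (p0 j) m0 (ZZr j ^~ jJ) xp) _.
  by rewrite ler_pdivrMr// ler_pdivlMl// mulrC.
(* Off [O] one has [S >= - B], with [S >= J ln 2] at distance [r] and [S <= 1] near [b]; the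
   normalization [(- S - B) / D] turns these into [0], [-1] and [- (1 + B) / D]. *)
pose D := J%:R * ln 2 + B.
have D0 : 0 < D by rewrite addr_gt0// mulr_gt0.
exists (fun z => D^-1 * (- S z - B)); split.
- move=> z nOz.
  have -> : (fun z => D^-1 * (- S z - B)) = (fun z => D^-1 * (
      (\sum_(j <- iota 0 J.+1) \sum_(i <- iota 0 m)
        (m%:R)^-1 * (- ln (cmod (z - ZZ j i)) + ln (cmod (ZZ j i - b)))) + - B)).
    apply/funext => w; congr (_ * (_ + _)); rewrite /S -sumrN; apply: eq_bigr => j _.
    by rewrite /F -sumrN; apply: eq_bigr => i _; rewrite -mulrN opprB addrC.
  apply: shlZ; first by rewrite invr_ge0 ltW.
  apply: shlD; last exact: shl_cst.
  apply: shl_sum => j /jin jJ; apply: shl_sum => i /iin im.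
  apply: shlZ; first by rewrite invr_ge0.
  apply: shlD; last exact: shl_cst.
  apply: shlN_ln_dist; apply/eqP => zE; have := ZZf j i z jJ im nOz.
  by rewrite zE subrr cmod0 leNgt divr_gt0.
- move=> z nOz; rewrite pmulr_rle0 ?invr_gt0//.
  by have := S_ge z nOz; (clear; lra).
- move=> z _ /S_far Sz; rewrite mulrC ler_pdivrMr// /D; (clear - Sz; lra).
- move=> z _ /S_near Sz; rewrite mulrC ler_pdivlMr//.
  rewrite ltr_pdivrMr// in Jl.
  rewrite mulNr lerNl; apply: le_trans (_ : 1 + B <= _); first by (clear - Sz; lra).
  have : 0 <= e * B by rewrite mulr_ge0// ltW.
  by rewrite /D mulrDr; (clear - Jl; lra).
Qed.

End CircleBarrier.

(** * Maxima and circle means of upper semicontinuous functions *)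

Section SupConvolution.
Variable R : realType.
Local Notation C := (CC R).
Local Notation mu := (@lebesgue_measure R).
Implicit Types (x y z w a b : C) (r s T M : R) (u : C -> \bar R).

Lemma usc_attains_max (K : set C) (h : C -> R) : compact K -> K !=set0 ->
  (forall y (c : R), K y -> h y < c -> \forall w \near y, K w -> h w < c) ->
  exists2 y, K y & forall w, K w -> h w <= h y.
Proof.
move=> cK [k0 Kk0] usch; apply: contrapT => /forall2NP nmax.
pose P (X : set C) := exists2 w, K w & forall x, X x -> K x -> h x < h w.
have [||X Y XY [w Kw wP]|X Y [w Kw wP] [w' Kw' wP']|y Ky|w Kw wP] := @compact_induction _ K P.
- exact: cK.
- by exists k0.
- by exists w => // x /XY; exact: wP.
- have [ww|ww] := leP (h w) (h w').
    exists w' => // x [Xx|Yx] Kx; last exact: wP'.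
    exact: lt_le_trans (wP _ Xx Kx) ww.
  exists w => // x [Xx|Yx] Kx; first exact: wP.
  exact: lt_trans (wP' _ Yx Kx) ww.
- have [//|/existsNP[w /not_implyP[Kw /negP]]] := nmax y; rewrite -ltNge => yw.
  exists [set v | K v -> h v < h w]; first exact: usch.
  by exists w => // x [_ /=]; exact.
by have := wP w Kw Kw; rewrite ltxx.
Qed.

(** Measurability comes from semicontinuity. The mean of [u] may be [-oo], so positive and negative
    parts are compared separately. *)
Lemma le_circle_mean u z r (k : R -> R) :
  (forall t (c : R), (u (circ_pt z r t) < c%:E)%E ->
     \forall s \near t, (u (circ_pt z r s) < c%:E)%E) ->
  continuous k -> (forall t, (u (circ_pt z r t) <= (k t)%:E)%E) ->
  (circle_mean u z r <= (avg k)%:E)%E.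
Proof.
move=> uscu ck uk; rewrite /circle_mean /avg EFinM.
apply: lee_wpmul2l; first by rewrite lee_fin invr_ge0 ltW// twopi_gt0.
have ik := @Int_integrable R 0 (2 * pi) k ck.
have mk := measurable_int _ ik.
have lsc : lower_semicontinuous (fun t : R => - u (circ_pt z r t))%E.
  move=> t c; rewrite lteNr -EFinN => H.
  exists [set s | (u (circ_pt z r s) < (- c)%:E)%E]; first exact: uscu.
  by move=> s /=; rewrite lteNr -EFinN.
have mU0 := measurableT_comp (@oppe_measurable R setT) (lower_semicontinuous_measurable lsc).
have mU := measurable_funS measurableT (@subsetT _ `[0%R, (2 * pi)%R]%classic) mU0.
have uE : (fun t => u (circ_pt z r t)) = -%E \o (fun t => - u (circ_pt z r t))%E.
  by apply/funext => t /=; rewrite oppeK.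
rewrite -uE in mU.
have -> : (Int 0 (2 * pi) k)%:E = (\int[mu]_(t in `[0%R, (2 * pi)%R]) (k t)%:E)%E.
  by rewrite /Int /Rintegral fineK//; apply: integrable_fin_num.
rewrite integralE [leRHS]integralE leeB//.
- apply: ge0_le_integral => //.
  + exact: measurable_funepos.
  + exact: measurable_funepos.
  + by move=> t _; apply: funepos_le => //; rewrite inE.
- apply: ge0_le_integral => //.
  + exact: measurable_funeneg.
  + exact: measurable_funeneg.
  + by move=> t _; apply: funeneg_le => //; rewrite inE.
Qed.

End SupConvolution.

(** * Continuous subharmonic majorants of a subharmonic function *)

Section Regularization.
Variable R : realType.
Local Notation C := (CC R).
Implicit Types (x y z w a b : C) (r s T M : R) (u : C -> \bar R).

Lemma subharmonic_bounded a r0 r u : subharmonic (disk a r0) u -> r < r0 ->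
  exists2 M : R, 0 <= M & forall z, cball a r z -> (u z <= M%:E)%E.
Proof.
move=> [_ fu uscu _] rr0.
pose P (X : set C) := exists2 M : R, 0 <= M & forall z, X z -> (u z <= M%:E)%E.
have rP z : cball a r z -> disk a r0 z by move=> h; exact: le_lt_trans h rr0.
apply: (@compact_induction _ (cball a r) P).
- exact: compact_cball.
- by exists 0.
- by move=> X Y XY [M M0 MP]; exists M => // z /XY; exact: MP.
- move=> X Y [M M0 MP] [M' M'0 MP']; exists (Num.max M M'); first by rewrite le_max M0.
  move=> z [/MP|/MP'] /le_trans; apply; rewrite lee_fin le_max lexx ?orbT//.
- move=> z /rP Dz; have uz := fu z Dz.
  have [c uc] : exists c : R, (u z < c%:E)%E.
    case: (u z) uz => [v _|//|_]; last by exists 0; exact: ltNye.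
    by exists (v + 1); rewrite lte_fin ltrDl.
  exists [set w | (u w < c%:E)%E]; first exact: uscu.
  exists (Num.max c 0); first by rewrite le_max lexx orbT.
  move=> w [_ /= /ltW wc]; apply: le_trans wc _.
  by rewrite lee_fin le_max lexx.
Qed.

(* Continuous subharmonic majorants of [max u (- T)]: since [u] is upper
   semicontinuous the sup-convolution is attained, hence subharmonic. *)
Lemma sup_convolution a r0 r u : subharmonic (disk a r0) u -> 0 < r -> r < r0 ->
  exists M : R, [/\ 0 <= M, (forall z, disk a r z -> (u z <= M%:E)%E) &
  forall T : R, 0 <= T -> exists p : nat -> C -> R,
    (forall n z, disk a r z ->
       [/\ shl (p n) z, (u z <= (p n z)%:E)%E, - T <= p n z & p n z <= M]) /\
    (forall z, disk a r z -> (u z < (- T)%:E)%E -> exists2 d : R, 0 < d &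
       exists N : nat, forall n, (N <= n)%N -> forall w, cmod (w - z) < d -> p n w <= - T)].
Proof.
move=> su rp rr0; pose r1 := (r + r0) / 2.
have rr1 : r < r1 by rewrite /r1; (clear - rr0; lra).
have r1r0 : r1 < r0 by rewrite /r1; (clear - rr0; lra).
have [M M0 MP] := subharmonic_bounded su r1r0.
clearbody r1.
have [_ fu uscu smu] := su.
pose K := cball a r1.
have KD z : K z -> disk a r0 z by move=> h; exact: le_lt_trans h r1r0.
have diskK z : disk a r z -> K z by move=> h; apply: ltW; exact: lt_trans h rr1.
exists M; split => // [z /diskK /MP//|T T0].
have MT0 : 0 <= M + T by (clear - M0 T0; lra).
pose tr y : R := fine (maxe (u y) (- T)%:E).
have trE y : K y -> (tr y)%:E = maxe (u y) (- T)%:E.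
  move=> Ky; rewrite fineK// fin_numElt; apply/andP; split.
    by apply: (@lt_le_trans _ _ (- T)%:E); rewrite ?ltNyr// le_max lexx orbT.
  by rewrite gt_max ltry andbT (le_lt_trans (MP y Ky))// ltry.
have tr_u y : K y -> (u y <= (tr y)%:E)%E by move=> Ky; rewrite trE// le_max lexx.
have tr_T y : K y -> - T <= tr y.
  by move=> Ky; rewrite -lee_fin trE// le_max lexx orbT.
have tr_M y : K y -> tr y <= M.
  by move=> Ky; rewrite -lee_fin trE// ge_max MP//= lee_fin; (clear - MT0; lra).
have tr_eq y : K y -> - T < tr y -> u y = (tr y)%:E.
  move=> Ky; rewrite -lte_fin trE// lt_max ltxx orbF => h.
  by apply/esym/max_idPl; exact: ltW.
have tr_low y : K y -> (u y < (- T)%:E)%E -> tr y = - T.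
  by move=> Ky h; apply: EFin_inj; rewrite trE//; apply/max_idPr; exact: ltW.
(* The slope is at least [(M + T + 1) / (r1 - r)]: if the value exceeds [- T], the maximizer is
   within [r1 - r] of [z], hence interior to [K], where [u] has its submean inequality. *)
pose L (n : nat) : R := (M + T + 1) / (r1 - r) + n%:R.
have L0 n : 0 < L n by rewrite ltr_pwDl// divr_gt0//; (clear - MT0 rr1; lra).
pose phi n z y := tr y - L n * cmod (z - y).
have Ka : K !=set0 by exists a; rewrite /K /cball /= subrr cmod0; (clear - rp rr1; lra).
have att n z : exists y, K y /\ forall w, K w -> phi n z w <= phi n z y.
  have [|y Ky yP] := @usc_attains_max R K (phi n z) (@compact_cball R a r1) Ka.
    move=> y c Ky yc.
    pose e := (c - phi n z y) / 2.
    have e0 : 0 < e by rewrite divr_gt0// subr_gt0.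
    have ec : phi n z y + e + e = c by rewrite /e; field.
    have n1 : \forall w \near y, K w -> tr w < tr y + e.
      have [Tt|Tt] := ltP (- T) (tr y + e); last first.
        by have := tr_T y Ky; (clear - e0 Tt; lra).
      have uy : (u y < (tr y + e)%:E)%E.
        by apply: le_lt_trans (tr_u y Ky) _; rewrite lte_fin ltrDl.
      apply: filterS (uscu y (KD y Ky) _ uy) => w uw Kw.
      by rewrite -lte_fin trE// gt_max uw /= lte_fin.
    have n2 : \forall w \near y, cmod (w - y) < e / L n by apply: near_cmod; rewrite divr_gt0.
    apply: filterS2 n1 n2 => w h1 h2 Kw; have := h1 Kw.
    move: h2; rewrite ltr_pdivlMr// => h2.
    have : cmod (z - y) <= cmod (z - w) + cmod (w - y) by exact: cmod_tri.
    rewrite -(ler_pM2l (L0 n)) mulrDr; move: ec; rewrite /phi; (clear - h2; lra).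
  by exists y.
have /choice[Y YP] : forall q : nat * C, exists y, K y /\ forall w, K w ->
    phi q.1 q.2 w <= phi q.1 q.2 y by move=> q; exact: att.
pose p n z := phi n z (Y (n, z)).
have pK n z : K (Y (n, z)) by have [] := YP (n, z).
have p_ge n z w : K w -> phi n z w <= p n z by move=> Kw; have [_] := YP (n, z); exact.
have p_lip n z w : p n z - L n * cmod (z - w) <= p n w.
  apply: le_trans (p_ge n w _ (pK n z)); rewrite /p /phi.
  have : cmod (w - Y (n, z)) <= cmod (w - z) + cmod (z - Y (n, z)) by exact: cmod_tri.
  by rewrite -(ler_pM2l (L0 n)) mulrDr (cmodB w z); (clear; lra).
have cp n : continuous (p n).
  move=> z; apply/cont_cmodP => e e0; exists (e / L n); first by rewrite divr_gt0.
  move=> w; rewrite ltr_pdivlMr// => h.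
  by have := p_lip n z w; have := p_lip n w z; rewrite (cmodB z w) ltr_norml; (clear - h; lra).
have p_tr n z : K z -> tr z <= p n z.
  by move=> Kz; apply: le_trans (p_ge n z z Kz); rewrite /phi subrr cmod0 mulr0 subr0.
have p_T n z : K z -> - T <= p n z by move=> Kz; apply: le_trans (tr_T z Kz) (p_tr n z Kz).
have p_M n z : p n z <= M.
  have := tr_M _ (pK n z); have : 0 <= L n * cmod (z - Y (n, z)).
    by rewrite mulr_ge0 ?cmod_ge0// ltW.
  by rewrite /p /phi; (clear; lra).
have nearK z : disk a r z -> \forall w \near z, K w.
  move=> zr; apply: (nbhs_cmodP z _).2; exists (r - cmod (z - a)); first by rewrite subr_gt0.
  move=> w wz; apply: diskK; rewrite /disk /=.
  by have := cmod_tri z w a; (clear - wz; lra).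
exists p; split.
  move=> n z zr; have Kz := diskK z zr; split => //; last first.
  - exact: p_T.
  - by apply: le_trans (tr_u z Kz) _; rewrite lee_fin p_tr.
  have cnp : cnear (p n) z by apply: near_all => w; exact: cp.
  have [pT|pT] := leP (p n z) (- T).
    apply: shl_min => //; apply: filterS (nearK z zr) => w Kw.
    by apply: le_trans pT _; exact: p_T.
  split => //; pose y := Y (n, z); have Ky : K y := pK n z.
  have d0 : 0 <= L n * cmod (z - y) by rewrite mulr_ge0 ?cmod_ge0// ltW.
  have pE : p n z = tr y - L n * cmod (z - y) by [].
  have ty : - T < tr y by (clear - pT d0 pE; lra).
  have zy : cmod (z - y) < r1 - r.
    have hM := tr_M y Ky.
    have h1 : L n * cmod (z - y) < M + T by (clear - pT pE hM; lra).
    have h2 : (M + T + 1) / (r1 - r) * cmod (z - y) <= L n * cmod (z - y).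
      by rewrite ler_wpM2r ?cmod_ge0// lerDl.
    have h3 : (M + T + 1) / (r1 - r) * cmod (z - y) < M + T + 1 by (clear - h1 h2; lra).
    move: h3; rewrite mulrAC ltr_pdivrMr ?subr_gt0// ltr_pM2l//; (clear - ty hM; lra).
  have ya : cmod (y - a) < r1.
    have := cmod_tri z y a; rewrite (cmodB y z); move: zr; rewrite /disk /=; (clear - zy; lra).
  have [rho rho0 [_ rhoP]] := smu y (KD y Ky).
  exists (Num.min rho (r1 - cmod (y - a))); first by rewrite lt_min rho0 subr_gt0.
  move=> s s0; rewrite lt_min => /andP[srho sy].
  have cmr t : cmod (circ_pt y s t - y) = s.
    by rewrite circ_ptE cmod_circ cmod_rc gtr0_norm.
  have Kc t : K (circ_pt y s t).
    rewrite /K /cball /=; have := cmod_tri y (circ_pt y s t) a; rewrite cmr; (clear - sy; lra).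
  (* The circle about [z] is translated to the maximizer [y]: the competitor [y + h] for [z + h]
     pays the same penalty as [y] for [z], so the submean inequality of [u] at [y] passes to [p n]
     at [z]. *)
  pose k t := p n (z + rc s * cis t) + L n * cmod (z - y).
  have cpc : continuous (fun t => p n (z + rc s * cis t)).
    by apply: continuous_circ => t; exact: cp.
  have cc : continuous (fun _ : R => L n * cmod (z - y)) by exact: cst_continuous.
  have ck : continuous k by move=> t; exact: (contD (cpc t) (cc t)).
  have uk t : (u (circ_pt y s t) <= (k t)%:E)%E.
    apply: le_trans (tr_u _ (Kc t)) _; rewrite lee_fin /k.
    have := p_ge n (z + rc s * cis t) _ (Kc t); rewrite /phi circ_ptE.
    rewrite (_ : z + rc s * cis t - (y + rc s * cis t) = z - y); last by ring.
    (clear; lra).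
  have uscc t (c : R) : (u (circ_pt y s t) < c%:E)%E ->
      \forall v \near t, (u (circ_pt y s v) < c%:E)%E.
    move=> h; have := uscu _ (KD _ (Kc t)) _ h.
    have : continuous (fun t => circ_pt y s t).
      move=> v; apply: (@continuous_comp _ _ _ (@cis R) (fun w => y + rc s * w) v).
        exact: continuous_cis.
      exact: continuous_affine.
    by move=> /(_ t) ct /ct.
  have := le_trans (rhoP s s0 srho) (le_circle_mean uscc ck uk).
  rewrite (tr_eq y Ky ty) lee_fin avgD// avg_cst pE; (clear; lra).
move=> z zr uz; have Kz := diskK z zr.
have := uscu z (KD z Kz) _ uz; have nK := nearK z zr.
move=> nu; have /nbhs_cmodP[d d0 dP] : \forall w \near z, K w /\ (u w < (- T)%:E)%E.
  by apply: filterS2 nK nu.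
exists (d / 2); first by rewrite divr_gt0.
(* For such [n] a maximizer outside the disk where [u < - T] pays a penalty of at least [M + T]. *)
exists (Num.truncn ((M + T) / (d / 2))).+1 => n nN w wz.
rewrite /p /phi; set y := Y (n, w).
have Ky : K y := pK n w.
have d00 : 0 <= L n * cmod (w - y) by rewrite mulr_ge0 ?cmod_ge0// ltW.
have [yz|yz] := ltP (cmod (y - z)) d.
  by have [_ uy] := dP y yz; rewrite (tr_low y Ky uy); (clear - d00; lra).
have wy : d / 2 <= cmod (w - y).
  by have := cmod_tri w y z; rewrite (cmodB y w); (clear - wz yz; lra).
have Ln : (M + T) / (d / 2) <= L n.
  apply: le_trans (_ : n%:R <= _); last first.
    by rewrite /L lerDr divr_ge0//; (clear - MT0 rr1; lra).
  apply: ltW; apply: lt_le_trans (truncnS_gt _) _; rewrite ler_nat; exact: nN.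
have d20 : 0 < d / 2 by rewrite divr_gt0.
rewrite ler_pdivrMr// in Ln.
have : L n * (d / 2) <= L n * cmod (w - y) by rewrite ler_pM2l.
by have := tr_M y Ky; (clear - Ln; lra).
Qed.

(** One index serves the whole compact set. The bound [M] is fixed before [T] and [K], which is
    essential for the later choice of constants. *)
Lemma sup_convolution_compact a r0 r u : subharmonic (disk a r0) u -> 0 < r -> r < r0 ->
  exists M : R, [/\ 0 <= M, (forall z, disk a r z -> (u z <= M%:E)%E) &
  forall (T : R) (K : set C), 0 <= T -> compact K -> K `<=` disk a r ->
    (forall z, K z -> u z = -oo%E) -> exists p : C -> R,
    (forall z, disk a r z ->
       [/\ shl p z, (u z <= (p z)%:E)%E, - T <= p z & p z <= M]) /\
    (forall z, K z -> \forall w \near z, p w <= - T)].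
Proof.
move=> su rp rr0; have [M [M0 MP conv]] := sup_convolution su rp rr0.
exists M; split => // T K T0 cK Kr uK; have [p [pP pT]] := conv T T0.
pose P (X : set C) := exists N : nat, forall n, (N <= n)%N -> forall z, X z -> K z ->
  \forall w \near z, p n w <= - T.
have [||X Y XY [N NP]|X Y [N NP] [N' NP']|z Kz|N NP] := @compact_induction _ K P.
- exact: cK.
- by exists 0%N.
- by exists N => n /NP nP z /XY; exact: nP.
- exists (maxn N N') => n; rewrite geq_max => /andP[/NP h1 /NP' h2] z.
  by move=> [/h1|/h2].
- have [|e e0 [N NP]] := pT z (Kr z Kz); first by rewrite uK// ltNyr.
  exists [set w | cmod (w - z) < e]; first exact: near_cmod.
  exists N => n /NP nP w [_ /= wz] _.
  apply: (nbhs_cmodP w _).2; exists (e - cmod (w - z)); first by rewrite subr_gt0.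
  by move=> y yw; apply: nP; have := cmod_tri w y z; (clear - yw; lra).
by exists (p N); split => [z /pP//|z Kz]; apply: (NP N).
Qed.

End Regularization.

(** * Circles on which a subharmonic function is bounded below *)

Section PolarGeometry.
Variable R : realType.
Local Notation C := (CC R).
Implicit Types (x y z w a b c : C) (r s T M : R) (u : C -> \bar R).

(** Compares the two moduli in a Blaschke factor of the disk of radius [r] with zero [c]: they agree
    on its boundary circle. *)
Lemma blaschke_identity (r : R) c z :
  cmod (rc (r ^+ 2) - cjg c * z) ^+ 2 - (r * cmod (z - c)) ^+ 2 =
  (r ^+ 2 - cmod z ^+ 2) * (r ^+ 2 - cmod c ^+ 2).
Proof.
rewrite exprMn !cmod_sqr; case: z => x y; case: c => p q.
by rewrite /rc /cjg /re /im /=; ring.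
Qed.

Lemma nbhs_interior_cball a r z : cmod (z - a) < r -> nbhs z (cball a r).
Proof.
move=> zr; apply: (nbhs_cmodP z _).2; exists (r - cmod (z - a)); first by rewrite subr_gt0.
by move=> w wz; rewrite /cball /=; have := cmod_tri z w a; (clear - wz; lra).
Qed.

(** A two-constants argument. With the Green function of a disk with pole [c] as comparison, depth
    [- T] near [c] forces a fixed positive proportion of that depth at [z1]; [T] is arbitrary. *)
Lemma sub_infinite_all a r0 u c s z1 : subharmonic (disk a r0) u ->
  0 < s -> (forall w, cmod (w - c) <= s -> disk a r0 w /\ u w = -oo%E) ->
  disk a r0 z1 -> u z1 = -oo%E.
Proof.
move=> su s0 sU z1r.
have [z1s|z1s] := leP (cmod (z1 - c)) s; first by have [] := sU z1 z1s.
have cc : cmod (c - c) <= s by rewrite subrr cmod0 ltW.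
have cr0 : cmod (c - a) < r0 by have [] := sU c cc.
have r00 : 0 < r0 by apply: le_lt_trans cr0; exact: cmod_ge0.
have [m [mr0 m1 m2 m0]] : exists m : R, [/\ m < r0, cmod (z1 - a) < m, cmod (c - a) < m & 0 < m].
  pose m' := Num.max (cmod (z1 - a)) (cmod (c - a)).
  have m'r : m' < r0 by rewrite gt_max z1r.
  have h1 : cmod (z1 - a) <= m' by rewrite le_max lexx.
  have h2 : cmod (c - a) <= m' by rewrite le_max lexx orbT.
  have h3 := cmod_ge0 (c - a).
  by exists ((m' + r0) / 2); split; (clear - m'r m'r h1 m'r h2 m'r h2 h3; lra).
pose s' := Num.min s ((m - cmod (c - a)) / 2).
have s'0 : 0 < s' by rewrite lt_min s0 divr_gt0// subr_gt0.
have s's : s' <= s by rewrite ge_min lexx.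
have s'm : s' <= (m - cmod (c - a)) / 2 by rewrite ge_min lexx orbT.
clearbody s'.
have cbm w : cmod (w - c) <= s' -> cmod (w - a) < m.
  by move=> h; have := cmod_tri c w a; (clear - s'0 s'm h; lra).
pose r := (m + r0) / 2.
have mr : m < r by rewrite /r; (clear - mr0; lra).
have rr0 : r < r0 by rewrite /r; (clear - mr0; lra).
have rp : 0 < r by (clear - m0 mr; lra).
clearbody r.
have [M [M0 MP conv]] := sup_convolution su rp rr0.
(* The inverse of a Blaschke factor; [ln (cmod (h w))] is the Green function of the disk of radius
   [m] about [a] with pole [c]. *)
pose h w := (rc (m ^+ 2) - cjg (c - a) * (w - a)) / (rc m * (w - c)).
have sub_ca w : w - a - (c - a) = w - c by ring.
have bl w : cmod (rc (m ^+ 2) - cjg (c - a) * (w - a)) ^+ 2 - (m * cmod (w - c)) ^+ 2 =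
  (m ^+ 2 - cmod (w - a) ^+ 2) * (m ^+ 2 - cmod (c - a) ^+ 2).
  by rewrite -blaschke_identity sub_ca.
have rcm : rc m != 0 :> C by rewrite -cmod_eq0 cmod_rc normr_eq0 gt_eqF.
have cmh w : cmod (h w) = cmod (rc (m ^+ 2) - cjg (c - a) * (w - a)) / (m * cmod (w - c)).
  by rewrite /h cmodM cmodV cmodM cmod_rc (gtr0_norm m0).
have cma2 : 0 < m ^+ 2 - cmod (c - a) ^+ 2.
  by rewrite subr_gt0 ltrXn2r ?nnegrE ?cmod_ge0// ltW.
have num0 w : cmod (w - a) <= m -> 0 < cmod (rc (m ^+ 2) - cjg (c - a) * (w - a)).
  move=> wm; rewrite cmod_gt0 subr_eq0; apply/eqP => E.
  have : cmod (rc (m ^+ 2)) = cmod (cjg (c - a) * (w - a)) by rewrite E.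
  rewrite cmodM cmod_cjg cmod_rc ger0_norm ?sqr_ge0// expr2 => E2.
  have := cmod_ge0 (c - a); have := cmod_ge0 (w - a); nra.
have h_in w : cmod (w - a) < m -> w != c -> 1 < cmod (h w).
  move=> wm wc; have d0 : 0 < m * cmod (w - c) by rewrite mulr_gt0// cmod_gt0 subr_eq0.
  rewrite cmh ltr_pdivlMr// mul1r -(@ltr_pXn2r _ 2)// ?nnegrE ?cmod_ge0 ?(ltW d0)//.
  by rewrite -subr_gt0 bl mulr_gt0// subr_gt0 ltrXn2r ?nnegrE ?cmod_ge0// ltW.
have h_bd w : cmod (w - a) = m -> cmod (h w) = 1.
  move=> wm; have wc : 0 < cmod (w - c).
    by rewrite cmod_gt0 subr_eq0; apply/eqP => E; move: wm; rewrite E; (clear - s'0 s'm; lra).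
  have d0 : 0 < m * cmod (w - c) by rewrite mulr_gt0.
  rewrite cmh; have := bl w; rewrite wm subrr mul0r => /eqP; rewrite subr_eq0.
  rewrite eqrXn2 ?cmod_ge0 ?(ltW d0)// => /eqP ->.
  by rewrite divff// gt_eqF.
pose H := 2 * m / s'.
have mH : 1 < H by rewrite /H ltr_pdivlMr//; have := cmod_ge0 (c - a); (clear - s'0 s'm; lra).
have h_s w : cmod (w - c) = s' -> cmod (h w) <= H.
  move=> ws; have wm : cmod (w - a) < m by apply: cbm; rewrite ws.
  rewrite cmh ws /H ler_pdivrMr ?mulr_gt0// (_ : _ * (m * s') = 2 * m ^+ 2); last first.
    by field; rewrite gt_eqF.
  apply: le_trans (cmodD _ _) _; rewrite cmodN cmodM cmod_cjg cmod_rc ger0_norm ?sqr_ge0//.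
  have := cmod_ge0 (c - a); have := cmod_ge0 (w - a); rewrite expr2; nra.
have lH : 0 < ln H by rewrite ln_gt0.
have z1c : z1 != c by rewrite -subr_eq0 -cmod_gt0 (lt_trans s0 z1s).
have lz1 : 0 < ln (cmod (h z1)) by rewrite ln_gt0// h_in.
have key (T : R) : 0 <= T -> (u z1 <= (M - (T + M) * (ln (cmod (h z1)) / ln H))%:E)%E.
  move=> T0; have [p [pP pT]] := conv T T0.
  have [N NP] : exists N : nat, forall n, (N <= n)%N -> forall w, cball c s' w -> p n w <= - T.
    apply: (@compact_induction _ (cball c s') (fun X => exists N : nat, forall n, (N <= n)%N ->
      forall w, X w -> p n w <= - T)).
    - exact: compact_cball.
    - by exists 0%N.
    - by move=> X Y XY [N NP]; exists N => n /NP nP w /XY; exact: nP.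
    - move=> X Y [N NP] [N' NP']; exists (maxn N N') => n.
      by rewrite geq_max => /andP[/NP h1 /NP' h2] w [/h1|/h2].
    - move=> w cw; have ws : cmod (w - c) <= s by apply: le_trans cw s's.
      have [_ uw] := sU w ws.
      have wr : disk a r w by apply: lt_trans mr; exact: cbm.
      have [|d d0 [N NP]] := pT w wr; first by rewrite uw ltNyr.
      exists [set v | cmod (v - w) < d]; first exact: near_cmod.
      by exists N => n /NP nP v [_ /nP].
  (* At most [T + M] is added on the inner circle, where the majorant is below [- T], and nothing on
     the outer one: the sum is at most [M] on both. *)
  pose k := (T + M) / ln H.
  have k0 : 0 <= k by rewrite divr_ge0 ?(ltW lH)//; (clear - M0 T0; lra).
  pose g w := p N w + k * ln (cmod (h w)).
  pose X := cball a m `&` [set w | s' <= cmod (w - c)].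
  have cX : compact X.
    apply: subclosed_compact (@compact_cball _ a m) _ => //; last by move=> w [].
    apply: closedI; first exact: closed_cball.
    have -> : [set w | s' <= cmod (w - c)] = ~` disk c s'.
      by apply/seteqP; split => w /=; rewrite /disk /= leNgt => /negP.
    by apply: open_closedC; exact: open_disk.
  have Xdisk w : X w -> disk a r w by move=> [wm _]; exact: le_lt_trans wm mr.
  have sg w : X w -> shl g w.
    move=> Xw; have [sp _ _ _] := pP N w (Xdisk w Xw).
    have [wm ws] := Xw.
    have wc : w != c by rewrite -subr_eq0 -cmod_gt0; exact: lt_le_trans ws.
    apply: shlD => //; apply: shlZ => //; apply: shl_ln.
      have d0 : rc m * (w - c) != 0 by rewrite mulf_neq0 ?subr_eq0.
      have n1 : hnear (fun v => rc (m ^+ 2) - cjg (c - a) * (v - a)) w.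
        apply: near_all => v; apply: cdiffB; first exact: cdiff_cst.
        by apply: cdiffMl; apply: cdiffB; [exact: cdiff_id|exact: cdiff_cst].
      have n2 : hnear (fun v => rc m * (v - c)) w.
        apply: near_all => v; apply: cdiffMl.
        by apply: cdiffB; [exact: cdiff_id|exact: cdiff_cst].
      by apply: filterS2 n1 (hnear_inv n2 d0) => v; exact: cdiffM.
    have d1 : 0 < m * cmod (w - c) by rewrite mulr_gt0// cmod_gt0 subr_eq0.
    by rewrite -cmod_gt0 cmh divr_gt0// num0.
  have gz1 : g z1 <= M.
    apply: (@max_principle R X [set w | cmod (w - a) = m \/ cmod (w - c) = s'] g).
    - exact: cX.
    - by move=> w /sg /shl_at.
    - move=> w Xw /not_orP[wa wc]; split; last exact: sg.
      have [wm ws] := Xw.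
      have nm := @nbhs_interior_cball a m w; rewrite lt_neqAle (introN eqP wa) in nm.
      have {}nm := nm wm.
      have ns : nbhs w (~` cball c s').
        apply: open_nbhs_nbhs; split; last first.
          by move=> /= cw; apply: wc; apply: le_anti; rewrite cw.
        by apply: closed_openC; exact: closed_cball.
      apply: filterS2 nm ns => v hv nv; split => //=.
      by rewrite ltW// ltNge; apply/negP.
    - move=> w Xw [wa|wc].
        have [_ _ _ pM] := pP N w (Xdisk w Xw).
        by rewrite /g h_bd// ln1 mulr0 addr0.
      have hp : p N w <= - T by apply: NP => //; rewrite /cball /= wc.
      have wm : cmod (w - a) < m by apply: cbm; rewrite wc.
      have wc0 : w != c by rewrite -subr_eq0 -cmod_gt0 wc.
      have hl : ln (cmod (h w)) <= ln H.
        rewrite ler_ln ?posrE ?h_s//; first by have := h_in w wm wc0; (clear; lra).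
        by (clear - mH; lra).
      have : k * ln (cmod (h w)) <= T + M.
        by rewrite /k mulrAC ler_pdivrMr// ler_wpM2l//; (clear - M0 T0; lra).
      by rewrite /g; (clear - hp; lra).
    - split; first exact: ltW.
      by apply: ltW; apply: le_lt_trans z1s.
  have [_ up _ _] := pP N z1 (lt_trans m1 mr).
  apply: le_trans up _; rewrite lee_fin.
  rewrite (_ : (T + M) * _ = k * ln (cmod (h z1))); last by rewrite /k mulrAC mulrA.
  by move: gz1; rewrite /g; (clear; lra).
case E : (u z1) => [v||] //.
  exfalso; pose q := ln (cmod (h z1)) / ln H.
  have q0 : 0 < q by rewrite divr_gt0.
  pose T := Num.max 0 ((M - v + 1) / q).
  have := key T; rewrite le_max lexx => /(_ isT); rewrite E lee_fin -/q.
  have : (M - v + 1) <= T * q by rewrite -ler_pdivrMr// le_max lexx orbT.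
  have : 0 <= M * q by rewrite mulr_ge0// ltW.
  by rewrite mulrDl; (clear; lra).
by have := key 0 (lexx _); rewrite E.
Qed.

(** Otherwise [u] takes very negative values on every circle about [b] with radius in [[s, q]]; the
    barrier of the set where a majorant is very negative then forces [u = -oo] on a disk about [b].
    The bound [s] depends on [q] alone, so the centre [b] may be chosen after [s]. *)
Lemma circle_lower_bound (q : R) : 0 < q -> exists2 s : R, 0 < s & s < q /\
  forall a r0 u b, subharmonic (disk a r0) u ->
  (exists2 z, disk a r0 z & u z <> -oo%E) -> cmod (b - a) + q < r0 ->
  exists r n : R, [/\ s <= r, r <= q & forall z, cmod (z - b) = r -> ((- n)%:E <= u z)%E].
Proof.
move=> q0; have half : 0 < 2^-1 :> R by rewrite invr_gt0.
have [s [n [s0 sq n0 bar]]] := circle_barrier q0 half.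
exists s => //; split=> // a r0 u b su [z1 z1r uz1] br0.
pose r := (cmod (b - a) + q + r0) / 2.
have rr0 : r < r0 by rewrite /r; (clear - br0; lra).
have rp : 0 < r by rewrite /r; have := cmod_ge0 (b - a); (clear - s0 sq br0; lra).
have qr z : cmod (z - b) <= q -> disk a r z.
  by move=> zq; rewrite /disk /= /r; have := cmod_tri b z a; (clear - br0 zq; lra).
apply: contrapT => nex.
have low t (k : R) : s <= t <= q -> exists2 z, cmod (z - b) = t & (u z < (- k)%:E)%E.
  move=> /andP[st tq]; apply: contrapT => nz; apply: nex; exists t, k; split => //.
  by move=> z zt; rewrite leNgt; apply/negP => uz; apply: nz; exists z.
have [M [M0 MP conv]] := sup_convolution su rp rr0.
apply: uz1; apply: (@sub_infinite_all a r0 u b (Num.min n q)) => //.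
  by rewrite lt_min n0.
move=> w; rewrite le_min => /andP[wn wq].
have wr := qr w wq.
split; first by move: wr; rewrite /disk /=; (clear - rr0; lra).
have key (T : R) : 0 <= T -> (u w <= (2 + M - T / 2)%:E)%E.
  move=> T0; have [p [pP pT]] := conv T T0.
  pose P (X : set R) := exists N : nat, forall k, (N <= k)%N -> forall t : R, s <= t <= q ->
      X t -> exists2 z, cmod (z - b) = t & p k z <= - T.
  have [||X Y XY [N NP]|X Y [N NP] [N' NP']|t|N NP] := @compact_induction R `[s, q] P.
  - exact: segment_compact.
  - by exists 0%N.
  - by exists N => k /NP kP t st /XY; exact: kP.
  - exists (maxn N N') => k; rewrite geq_max => /andP[/NP h1 /NP' h2] t st.
    by move=> [/(h1 t st)|/(h2 t st)].
  - rewrite /= in_itv /= => st; have [z zt uz] := low t T st.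
    have zr : disk a r z by apply: qr; rewrite zt; (clear - st; lra).
    have [d d0 [N NP]] := pT z zr uz.
    have t0 : 0 < t by (clear - s0 st; lra).
    exists (ball t d); first exact: nbhsx_ballx.
    exists N => k /NP kP t' st' [_]; rewrite /ball /= => tt'.
    exists (b + rc (t' / t) * (z - b)).
      by rewrite addrC addKr cmodM cmod_rc zt ger0_norm ?divfK ?gt_eqF// divr_ge0; lra.
    apply: kP.
    have -> : b + rc (t' / t) * (z - b) - z = rc (t' / t - 1) * (z - b).
      by rewrite rcD rcN rc1; ring.
    rewrite cmodM cmod_rc zt -{2}(gtr0_norm t0) -normrM mulrBl divfK ?gt_eqF// mul1r.
    by rewrite distrC.
  have {}NP (t : R) : s <= t <= q -> exists2 z, cmod (z - b) = t & p N z <= - T.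
    by move=> st; apply: (NP N (leqnn N) t st); rewrite /= in_itv.
  (* The margin [1] above [- T] makes this set open while containing the points where the majorant
     is at most [- T]. *)
  pose O : set C := disk a r `&` [set z | p N z < - T + 1].
  have oO : open O.
    apply/open_cmodP => z [zr pz].
    have [sp _ _ _] := pP N z zr.
    have /open_cmodP/(_ z zr)[d1 d10 D1] := @open_disk R a r.
    have e0 : 0 < - T + 1 - p N z by rewrite subr_gt0.
    have /cont_cmodP/(_ _ e0)[d2 d20 D2] := shl_at sp.
    exists (Num.min d1 d2); first by rewrite lt_min d10.
    move=> v; rewrite lt_min => /andP[v1 v2]; split; first exact: D1.
    by have := D2 v v2; rewrite ltr_norml /=; lra.
  have [|B [B1 B2 B3 B4]] := bar b O oO.
    move=> t st; have [z zt pz] := NP t st; exists z => //.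
    by split; [apply: qr; rewrite zt; lra|rewrite /=; lra].
  have [_ up _ _] := pP N w wr.
  apply: le_trans up _; rewrite lee_fin.
  have [wO|/negP] := boolP (p N w < - T + 1); first by lra.
  move=> nwO; have nO : ~ O w by move=> [_ /=].
  pose X := cball b q `&` [set z | - T + 1 <= p N z].
  (* At distance [q] the barrier is at most [-1] and [g <= M]; on the edge of [O] it is at most [0]
     and [g <= 1 + M]. Near [b] it is at least [-1/2], so half of [T + M] is gained. *)
  pose g z := p N z + (T + M) * (1 + B z).
  have XD z : X z -> disk a r z by move=> [zq _]; exact: qr.
  have XO z : X z -> ~ O z by move=> [_ /= h] [_ /=]; rewrite ltNge h.
  have sg z : X z -> shl g z.
    move=> Xz; have [sp _ _ _] := pP N z (XD z Xz).
    apply: shlD => //; apply: shlZ; first by lra.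
    by apply: shlD; [exact: shl_cst|apply: B1; exact: XO].
  have cX : compact X.
    have -> : X = cball b q `&` ~` O.
      apply/seteqP; split => z [zq].
        by move=> /= h; split => // -[_ /=]; rewrite ltNge h.
      move=> nOz; split => //=; rewrite leNgt; apply/negP => h; apply: nOz.
      by split => //; exact: qr.
    apply: (subclosed_compact _ (@compact_cball _ b q)); last exact: subIsetl.
    by apply: closedI; [exact: closed_cball|exact: open_closedC].
  have gw : g w <= 1 + M.
    apply: (@max_principle R X [set z | cmod (z - b) = q \/ p N z = - T + 1] g).
    - exact: cX.
    - by move=> z /sg /shl_at.
    - move=> z Xz /not_orP[zb zp]; split; last exact: sg.
      have [zq pz] := Xz.
      have nq : nbhs z (cball b q).
        by apply: nbhs_interior_cball; rewrite lt_neqAle zq andbT; exact/eqP.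
      have [sp _ _ _] := pP N z (XD z Xz).
      have e0 : 0 < p N z - (- T + 1).
        by rewrite subr_gt0 lt_neqAle pz andbT; apply/eqP => E; apply: zp.
      have /cont_cmodP/(_ _ e0)[d2 d20 D2] := shl_at sp.
      apply: filterS2 nq (near_cmod z d20) => v hv v2; split => //=.
      by have := D2 v v2; rewrite ltr_norml; lra.
    - move=> z Xz [zb|zp].
        have [_ _ _ pM] := pP N z (XD z Xz).
        have Bz : B z <= -1 by apply: B3; [exact: XO|rewrite zb].
        have : (T + M) * (1 + B z) <= 0 by apply: mulr_ge0_le0; lra.
        by rewrite /g; lra.
      have Bz := B2 z (XO z Xz).
      have : (T + M) * (1 + B z) <= T + M by apply: ler_piMr; lra.
      by rewrite /g; lra.
    - by split => //=; rewrite leNgt; apply/negP.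
  have Bw := B4 w nO wn.
  have : (T + M) * 2^-1 <= (T + M) * (1 + B w) by rewrite ler_wpM2l//; lra.
  by move: gw; rewrite /g; lra.
case E : (u w) => [v||] //.
  exfalso; have := key (Num.max 0 (2 * (3 + M - v))).
  rewrite le_max lexx => /(_ isT); rewrite E lee_fin.
  have : 2 * (3 + M - v) <= Num.max 0 (2 * (3 + M - v)) by rewrite le_max lexx orbT.
  by lra.
by have := key 0 (lexx _); rewrite E.
Qed.

End PolarGeometry.

(** * Means of complex-valued functions *)

Section ComplexAverage.
Variable R : realType.
Local Notation C := (CC R).
Implicit Types (h k : R -> C).

Definition cavg h : C := Complex (avg (fun t => re (h t))) (avg (fun t => im (h t))).

Lemma re_cavg h : re (cavg h) = avg (fun t => re (h t)). Proof. by []. Qed.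
Lemma im_cavg h : im (cavg h) = avg (fun t => im (h t)). Proof. by []. Qed.

Lemma abs_im (z : C) : `|im z| <= cmod z.
Proof.
rewrite -(@ler_sqr R) ?nnegrE ?cmod_ge0//.
by rewrite cmod_sqr real_normK ?num_real// lerDr sqr_ge0.
Qed.

Lemma continuous_im : continuous (@im R).
Proof.
move=> z; apply/cont_cmodP => e e0; exists e => // w; apply: le_lt_trans.
by rewrite -imB; exact: abs_im.
Qed.

Lemma continuous_reh h : continuous h -> continuous (fun t => re (h t)).
Proof. by move=> ch t; apply: continuous_comp; [exact: ch|exact: continuous_re]. Qed.

Lemma continuous_imh h : continuous h -> continuous (fun t => im (h t)).
Proof. by move=> ch t; apply: continuous_comp; [exact: ch|exact: continuous_im]. Qed.

Lemma cavgB h k : continuous h -> continuous k ->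
  cavg (fun t => h t - k t) = cavg h - cavg k.
Proof.
move=> ch ck; apply: Ceq.
  rewrite reB !re_cavg -avgB; first by congr avg; apply/funext => t; rewrite reB.
    exact: continuous_reh.
  exact: continuous_reh.
rewrite imB !im_cavg -avgB; first by congr avg; apply/funext => t; rewrite imB.
  exact: continuous_imh.
exact: continuous_imh.
Qed.

Lemma cavgZ (c : C) h : continuous h -> cavg (fun t => c * h t) = c * cavg h.
Proof.
move=> ch; have cr := continuous_reh ch; have ci := continuous_imh ch.
have cZ (x : R) (f : R -> R) : continuous f -> continuous (fun t => x * f t).
  by move=> cf t; exact: (contZ (cf t)).
apply: Ceq.
  rewrite reM !re_cavg im_cavg -!avgZ// -avgB; try exact: cZ.
  by congr avg; apply/funext => t; rewrite reM.
rewrite imM !im_cavg re_cavg -!avgZ// -avgD; try exact: cZ.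
by congr avg; apply/funext => t; rewrite imM.
Qed.

Lemma cavg_cst (c : C) : cavg (fun=> c) = c.
Proof. by apply: Ceq; rewrite /cavg /re /im /= avg_cst. Qed.

Lemma continuous_mull (T : topologicalType) (F : T -> C) (e : C) w :
  {for w, continuous F} -> {for w, continuous (fun z => e * F z)}.
Proof.
move=> cF; have -> : (fun z => e * F z) = (fun v => 0 + e * v) \o F.
  by apply/funext => z /=; rewrite add0r.
exact: (@continuous_comp _ _ _ F (fun v : C => 0 + e * v) w cF (@continuous_affine R 0 e (F w))).
Qed.

(** The factor [2] comes from treating real and imaginary parts separately; it is harmless in the
    differentiability estimate. *)
Lemma cavg_bound h (B : R) : continuous h -> (forall t, cmod (h t) <= B) ->
  cmod (cavg h) <= 2 * B.
Proof.
move=> ch hB; have cr := continuous_reh ch; have ci := continuous_imh ch.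
have E : cavg h = rc (avg (fun t => re (h t))) + (Complex 0 1 : C) * rc (avg (fun t => im (h t))).
  by rewrite /cavg /rc; congr Complex; ring.
rewrite E; apply: le_trans (cmodD _ _) _; rewrite cmodM !cmod_rc.
have -> : cmod (Complex 0 1 : C) = 1 by rewrite /= expr0n expr1n add0r sqrtr1.
have b1 : `|avg (fun t => re (h t))| <= B.
  rewrite ler_norml; apply/andP; split.
    apply: avg_ge_cst => // t; have := le_trans (abs_re (h t)) (hB t).
    by rewrite ler_norml => /andP[].
  apply: avg_le_cst => // t; have := le_trans (abs_re (h t)) (hB t).
  by rewrite ler_norml => /andP[].
have b2 : `|avg (fun t => im (h t))| <= B.
  rewrite ler_norml; apply/andP; split.
    apply: avg_ge_cst => // t; have := le_trans (abs_im (h t)) (hB t).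
    by rewrite ler_norml => /andP[].
  apply: avg_le_cst => // t; have := le_trans (abs_im (h t)) (hB t).
  by rewrite ler_norml => /andP[].
(clear - b1 b2; lra).
Qed.

Lemma continuous_circC (F : C -> C) (z b : C) :
  (forall t, {for z + b * cis t, continuous F}) ->
  continuous (fun t => F (z + b * cis t)).
Proof.
move=> cF t; apply: (@continuous_comp _ _ _ (fun t => z + b * cis t) F t); last exact: cF.
apply: (@continuous_comp _ _ _ (@cis R) (fun w => z + b * w) t).
  exact: continuous_cis.
exact: continuous_affine.
Qed.

End ComplexAverage.

(** * Maximum principle and mean values across a polar set *)

Section Removable.
Variable R : realType.
Local Notation C := (CC R).
Variables (a : C) (r0 : R) (u : C -> \bar R) (A : set C).
Hypotheses (su : subharmonic (disk a r0) u)
  (uA : forall z, disk a r0 z -> A z -> u z = -oo%E)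
  (Acl : forall z, disk a r0 z -> ~ A z -> \forall w \near z, ~ A w).

Variables (c : C) (rho : R).
Hypotheses (rho0 : 0 < rho) (crho : cmod (c - a) + rho < r0)
  (cA : forall z, cmod (z - c) = rho -> ~ A z).

Let crD z : cmod (z - c) <= rho -> disk a r0 z.
Proof.
by move=> zc; have := cmod_tri c z a; rewrite /disk /=; have := crho; lra.
Qed.

Lemma compact_polar_cball : compact (cball c rho `&` A).
Proof.
apply: (subclosed_compact _ (@compact_cball _ c rho)); last exact: subIsetl.
rewrite -[X in closed X]setCK; apply: open_closedC; apply/open_cmodP => z /= nz.
have [zc|zc] := pselect (cball c rho z); last first.
  have : nbhs z (~` cball c rho).
    by apply: open_nbhs_nbhs; split => //; apply: closed_openC; exact: closed_cball.
  by move=> /nbhs_cmodP[d d0 dP]; exists d => // w /dP h [].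
have nAz : ~ A z by move=> Az; apply: nz.
have /nbhs_cmodP[d d0 dP] := Acl (crD zc) nAz.
by exists d => // w /dP h [].
Qed.

(* Adding a small multiple of the subharmonic function that is [-oo] on [A]
   pushes [h] below the constant [b] near [A], where it is then replaced by [b]. *)
Lemma polar_patch : exists2 M : R, (forall z, cmod (z - c) <= rho -> (u z <= M%:E)%E) &
  forall (h : C -> R) (B b d : R), 0 < d ->
  (forall z, cmod (z - c) <= rho -> ~ A z -> shl h z) ->
  (forall z, cmod (z - c) <= rho -> ~ A z -> h z <= B) ->
  exists G : C -> R, [/\ (forall z, cmod (z - c) < rho -> shl G z),
    (forall z, cmod (z - c) = rho -> {for z, continuous G}),
    (forall z, cmod (z - c) <= rho -> ~ A z -> G z <= Num.max (h z) b) &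
    (forall z (v : R), cmod (z - c) <= rho -> ~ A z -> u z = v%:E -> h z + d * (v - M) <= G z)].
Proof.
pose r := (cmod (c - a) + rho + r0) / 2.
have rhp := rho0; have crh := crho.
have rr0 : r < r0 by rewrite /r; lra.
have rp : 0 < r by rewrite /r; have := cmod_ge0 (c - a); lra.
have cr z : cmod (z - c) <= rho -> disk a r z.
  by move=> zc; have := cmod_tri c z a; rewrite /disk /= /r; lra.
have [M [M0 MP conv]] := sup_convolution_compact su rp rr0.
exists M => [z /cr /MP //|h B b d d0 sh hB].
(* Depth sufficient for [h + d (p - M)] to fall below [b] near [A], given [h <= B]. *)
pose T := Num.max 0 ((B - b) / d).
have T0 : 0 <= T by rewrite le_max lexx.
have dT : B - d * T <= b.
  by rewrite lerBlDr -lerBlDl -ler_pdivrMl// mulrC le_max lexx orbT.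
have [|z [zc Az]|p [pP pT]] := conv T (cball c rho `&` A) T0 compact_polar_cball.
- by move=> z [/cr].
- exact: uA (crD zc) Az.
pose q z := h z + d * (p z - M).
pose G z := if `[< A z >] then b else Num.max (q z) b.
have sq z : cmod (z - c) <= rho -> ~ A z -> shl q z.
  move=> zc nAz; have [sp _ _ _] := pP z (cr z zc).
  apply: shlD; first exact: sh.
  by apply: shlZ; [exact: ltW|apply: shlD => //; exact: shl_cst].
have sGn z : cmod (z - c) <= rho -> ~ A z -> shl G z.
  move=> zc nAz; apply: (@shl_near _ _ (fun w => Num.max (q w) b)).
    by apply: shl_max; [exact: sq|exact: shl_cst].
  apply: filterS (Acl (crD zc) nAz) => w nAw.
  by rewrite /G; case: asboolP.
exists G; split.
- move=> z zc; have zc' := ltW zc.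
  have nc : \forall w \near z, cmod (w - c) <= rho by exact: nbhs_interior_cball.
  have [Az|nAz] := pselect (A z); last exact: sGn.
  apply: (@shl_near _ _ (fun=> b)); first exact: shl_cst.
  apply: filterS2 nc (pT z (conj zc' Az)) => w wc pw.
  rewrite /G; case: asboolP => // nAw; apply/esym/max_idPr.
  have := hB w wc nAw; rewrite /q.
  have : d * (p w - M) <= d * (- T) by rewrite ler_pM2l//; lra.
  by rewrite mulrN; lra.
- by move=> z zc; apply: shl_at; apply: sGn; [rewrite zc|exact: cA].
- move=> z zc nAz; rewrite /G; case: asboolP => // _.
  have [_ _ _ pM] := pP z (cr z zc).
  rewrite ge_max !le_max lexx orbT andbT; apply/orP; left.
  by rewrite /q gerDl; apply: mulr_ge0_le0; [exact: ltW|lra].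
- move=> z v zc nAz uz; rewrite /G; case: asboolP => // _; rewrite le_max; apply/orP; left.
  rewrite /q lerD2l ler_pM2l// lerD2r -lee_fin -uz.
  by have [] := pP z (cr z zc).
Qed.

(** Since [u z] is finite, the penalty [d (M - v)] tends to zero with [d]. *)
Lemma le_eps_polar (z : C) (M x y : R) : cmod (z - c) <= rho -> ~ A z ->
  (u z <= M%:E)%E -> u z <> -oo%E ->
  (forall d v : R, 0 < d -> u z = v%:E -> x + d * (v - M) <= y) -> x <= y.
Proof.
move=> zc nAz; case: (u z) => [v||] // vM _ key; rewrite lee_fin in vM.
apply/ler_addgt0Pr => e e0.
have Mv : 0 < M - v + 1 by lra.
have := key (e / (M - v + 1)) v (divr_gt0 e0 Mv) erefl.
have : e / (M - v + 1) * (M - v) <= e.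
  by rewrite mulrAC ler_pdivrMr// ler_pM2l//; lra.
by rewrite -(opprB M v) mulrN; lra.
Qed.

(** The patch at level [0] is subharmonic across [A] and at most [0] on the circle, so the ordinary
    maximum principle applies to it. *)
Lemma max_off_polar (h : C -> R) (B : R) :
  (forall z, cmod (z - c) <= rho -> ~ A z -> shl h z) ->
  (forall z, cmod (z - c) <= rho -> ~ A z -> h z <= B) ->
  (forall z, cmod (z - c) = rho -> h z <= 0) ->
  forall z, cmod (z - c) <= rho -> ~ A z -> u z <> -oo%E -> h z <= 0.
Proof.
move=> sh hB hc z zc nAz uz; have [M MP patch] := polar_patch.
apply: (le_eps_polar zc nAz (MP z zc) uz) => d v d0 uv.
have [G [sG cG Gu Gl]] := patch h B 0 d d0 sh hB.
apply: le_trans (Gl z v zc nAz uv) _.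
apply: (@max_principle R (cball c rho) [set w | cmod (w - c) = rho] G) => //.
- exact: compact_cball.
- move=> w wc; have [wl|we] := ltP (cmod (w - c)) rho; first exact: shl_at (sG w wl).
  by apply: cG; apply/le_anti; rewrite we andbT.
- move=> w wc /eqP wne; have wl : cmod (w - c) < rho by rewrite lt_neqAle wne.
  by split; [exact: nbhs_interior_cball|exact: sG].
- move=> w wc /= we; apply: le_trans (Gu w wc (cA we)) _.
  by rewrite ge_max hc // lexx.
Qed.

(** The patch at level [- B] stays below [h] on the circle, because [h >= - B] there. *)
Lemma le_avg_off_polar (h : C -> R) (B : R) : u c <> -oo%E ->
  (forall z, cmod (z - c) <= rho -> ~ A z -> shl h z) ->
  (forall z, cmod (z - c) <= rho -> ~ A z -> `|h z| <= B) ->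
  h c <= avg (fun t => h (c + rc rho * cis t)).
Proof.
move=> uc sh hB.
have cc : cmod (c - c) <= rho by rewrite subrr cmod0; exact: ltW rho0.
have nAc : ~ A c by move=> Ac; apply: uc; exact: uA (crD cc) Ac.
have hB1 z : cmod (z - c) <= rho -> ~ A z -> - B <= h z <= B.
  by move=> zc nAz; rewrite -ler_norml hB.
have [M MP patch] := polar_patch.
apply: (le_eps_polar cc nAc (MP c cc) uc) => d v d0 uv.
have [|G [sG cG Gu Gl]] := patch h B (- B) d d0 sh.
  by move=> z zc nAz; have /andP[] := hB1 z zc nAz.
apply: le_trans (Gl c v cc nAc uv) _.
have cmr : cmod (rc rho : C) = rho by rewrite cmod_rc gtr0_norm//; exact: rho0.
have cmc t : cmod (c + rc rho * cis t - c) = rho by rewrite cmod_circ.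
apply: le_trans (_ : avg (fun t => G (c + rc rho * cis t)) <= _).
  apply: submean_disk; rewrite cmr => z zc; last exact: sG.
  have [zl|ze] := ltP (cmod (z - c)) rho; first exact: shl_at (sG z zl).
  by apply: cG; apply/le_anti; rewrite zc.
have lec t : cmod (c + rc rho * cis t - c) <= rho by rewrite cmc.
apply: avg_le.
- by apply: continuous_circ => t; exact: cG.
- by apply: continuous_circ => t; apply: shl_at; apply: sh => //; exact: cA.
move=> t; have nA := cA (cmc t).
apply: le_trans (Gu _ (lec t) nA) _; rewrite ge_max lexx /=.
by have /andP[] := hB1 _ (lec t) nA.
Qed.

(** The submean inequality for the real parts of [e F] with [e] among [1], [-1], [i], [-i] gives
    both inequalities for both coordinates. *)
Lemma cavg_off_polar (F : C -> C) (B : R) : u c <> -oo%E ->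
  (forall z, cmod (z - c) <= rho -> ~ A z -> \forall w \near z, {for w, continuous F}) ->
  (forall z, cmod (z - c) <= rho -> ~ A z -> \forall w \near z, w != z -> cdiff F w) ->
  (forall z, cmod (z - c) <= rho -> ~ A z -> cmod (F z) <= B) ->
  cavg (fun t => F (c + rc rho * cis t)) = F c.
Proof.
move=> uc cF dF FB.
have key (e : C) : cmod e = 1 -> re (e * F c) <= avg (fun t => re (e * F (c + rc rho * cis t))).
  move=> e1; apply: (@le_avg_off_polar (fun z => re (e * F z)) B) => //.
  - move=> z zc nAz; apply: shl_re.
      by apply: filterS (cF z zc nAz) => w cw; exact: continuous_mull.
    by apply: filterS (dF z zc nAz) => w dw /dw; exact: cdiffMl.
  - move=> z zc nAz; apply: le_trans (abs_re _) _; rewrite cmodM e1 mul1r.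
    exact: FB.
have cmc t : cmod (c + rc rho * cis t - c) = rho by rewrite cmod_circ cmod_rc gtr0_norm.
have cc : continuous (fun t => F (c + rc rho * cis t)).
  apply: continuous_circC => t.
  by apply: nbhs_singleton (cF _ _ (cA (cmc t))); rewrite cmc.
have crr := continuous_reh cc; have cii := continuous_imh cc.
have avgN (h : R -> R) : continuous h -> avg (fun t => - h t) = - avg h.
  by move=> ch; rewrite -[RHS]mulN1r -avgZ//; congr avg; apply/funext => t; rewrite mulN1r.
apply: Ceq; rewrite /cavg {1}/re {1}/im /=; apply/le_anti/andP; split.
- have := key (- 1) ltac:(by rewrite cmodN cmod1).
  under [X in _ <= avg X]eq_fun do rewrite mulN1r reN.
  by rewrite mulN1r reN avgN// lerN2.
- by have := key 1 (cmod1 R); under [X in _ <= avg X]eq_fun do rewrite mul1r; rewrite mul1r.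
- have i1 : cmod (Complex 0 1 : C) = 1 by rewrite /= expr0n expr1n add0r sqrtr1.
  have reI z : re ((Complex 0 1 : C) * z) = - im z by rewrite reM /re /im /= mul0r mul1r add0r.
  have := key _ i1; under [X in _ <= avg X]eq_fun do rewrite reI.
  by rewrite reI avgN// lerN2.
- have i1 : cmod (Complex 0 (-1) : C) = 1 by rewrite /= expr0n sqrrN expr1n add0r sqrtr1.
  have reI z : re ((Complex 0 (-1) : C) * z) = im z.
    by rewrite reM /re /im /= mul0r mulN1r opprK add0r.
  by have := key _ i1; under [X in _ <= avg X]eq_fun do rewrite reI; rewrite reI.
Qed.

End Removable.

(** * Bounded holomorphic functions extend across polar sets *)

Section RemovableSingularity.
Variable R : realType.
Local Notation C := (CC R).
Implicit Types (z w a b c : C) (F G f : C -> C) (A : set C).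

Lemma cdiff_near F G z : cdiff F z -> (\forall w \near z, F w = G w) -> cdiff G z.
Proof.
move=> [L FL] FG; exists L => e e0; have [d d0 dP] := FL e e0.
have Fz := nbhs_singleton FG.
move/nbhs_cmodP : FG => [r r0 rP]; exists (Num.min d r); first by rewrite lt_min d0.
by move=> w; rewrite lt_min => /andP[/dP wd /rP wr]; rewrite -wr -Fz.
Qed.

Lemma near_neq z a : z != a -> \forall w \near z, w != a.
Proof.
move=> za; apply: (nbhs_cmodP z _).2; exists (cmod (z - a)).
  by rewrite cmod_gt0 subr_eq0.
by move=> w; apply: contraTneq => ->; rewrite cmodB ltxx.
Qed.

Lemma cavg_cjg (h : R -> C) : continuous h -> cavg (fun t => cjg (h t)) = cjg (cavg h).
Proof.
move=> ch; have ci := continuous_imh ch.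
have recj z : re (cjg z) = re z by case: z.
have imcj z : im (cjg z) = - im z by case: z.
apply: Ceq.
  by rewrite recj !re_cavg; congr avg; apply/funext => t; rewrite recj.
rewrite imcj !im_cavg -[RHS]mulN1r -avgZ//; congr avg; apply/funext => t.
by rewrite imcj mulN1r.
Qed.

Variables (a : C) (r0 : R) (u : C -> \bar R) (A : set C).
Hypotheses (su : subharmonic (disk a r0) u)
  (uA : forall z, disk a r0 z -> A z -> u z = -oo%E)
  (Acl : forall z, disk a r0 z -> ~ A z -> \forall w \near z, ~ A w).

Variables (c : C) (rho : R).
Hypotheses (rho0 : 0 < rho) (crho : cmod (c - a) + rho < r0)
  (cA : forall z, cmod (z - c) = rho -> ~ A z) (uc : u c <> -oo%E).

Let zeta (t : R) : C := c + rc rho * cis t.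

Let czeta t : cmod (zeta t - c) = rho.
Proof. by rewrite cmod_circ cmod_rc gtr0_norm. Qed.

Let crD z : cmod (z - c) <= rho -> disk a r0 z.
Proof.
by move=> zc; have := cmod_tri c z a; rewrite /disk /=; have := crho; lra.
Qed.

Let zeta_neq al t : cmod (al - c) < rho -> zeta t != al.
Proof.
by move=> alr; apply/eqP => E; move: alr; rewrite -E czeta ltxx.
Qed.

(** On the circle [(zeta - al)^-1] is the conjugate of the values of a function [H] holomorphic on
    the closed disk with a zero at [c]. The kernel is [1] plus a multiple of that conjugate, whose
    mean vanishes. *)
Lemma cavg_cauchy_kernel al : cmod (al - c) < rho ->
  cavg (fun t => (zeta t - al)^-1 * (zeta t - c)) = 1.
Proof.
move=> alr; pose H z := (z - c) / (rc (rho ^+ 2) - cjg (al - c) * (z - c)).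
have den z : cmod (z - c) <= rho -> rc (rho ^+ 2) - cjg (al - c) * (z - c) != 0.
  move=> zc; rewrite subr_eq0; apply/eqP => E.
  have : cmod (rc (rho ^+ 2)) = cmod (cjg (al - c) * (z - c)) by rewrite E.
  rewrite cmodM cmod_cjg cmod_rc ger0_norm ?sqr_ge0// expr2 => E2.
  have := cmod_ge0 (al - c); have := cmod_ge0 (z - c); have := rho0; nra.
have dH z : cmod (z - c) <= rho -> hnear H z.
  move=> zc; have n1 : hnear (fun v => rc (rho ^+ 2) - cjg (al - c) * (v - c)) z.
    apply: near_all => v; apply: cdiffB; first exact: cdiff_cst.
    by apply: cdiffMl; apply: cdiffB; [exact: cdiff_id|exact: cdiff_cst].
  by apply: filterS2 (hnear_sub c z) (hnear_inv n1 (den z zc)) => v; exact: cdiffM.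
have [B HB] : exists B : R, forall z, cmod (z - c) <= rho -> ~ (set0 : set C) z -> cmod (H z) <= B.
  have : cball c rho !=set0 by exists c; rewrite /cball /= subrr cmod0 ltW.
  move=> /(@compact_EVT_max _ _ (fun z => cmod (H z)))/(_ (@compact_cball _ c rho))[|z0 _ zP].
    apply: continuous_in_subspaceT => z /set_mem zc.
    have cHz : {for z, continuous H} := cdiff_cont (nbhs_singleton (dH z zc)).
    exact: (continuous_at_comp cHz (@continuous_cmod R)).
  by exists (cmod (H z0)) => z zc _; apply: zP; rewrite inE.
have cH0 : cavg (fun t => H (zeta t)) = 0.
  have n0 z : ~ (set0 : set C) z by case.
  rewrite (cavg_off_polar su (A := set0) (fun z _ h => False_ind _ (n0 z h))
    (fun z _ _ => near_all z n0) rho0 crho (fun z _ => n0 z) uc _ _ HB).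
  - by rewrite /H subrr mul0r.
  - by move=> z zc _; exact: hnear_cont (dH z zc).
  - by move=> z zc _; apply: filterS (dH z zc) => w dw _.
have cHc : continuous (fun t => H (zeta t)).
  apply: continuous_circC => t; apply: cdiff_cont; apply: nbhs_singleton; apply: dH.
  by rewrite czeta.
have E t : (zeta t - al)^-1 * (zeta t - c) = 1 - (c - al) * cjg (H (zeta t)).
  have z0 : zeta t - al != 0 by rewrite subr_eq0 zeta_neq.
  have den0 := den (zeta t) ltac:(by rewrite czeta).
  have rz : rc (rho ^+ 2) = (zeta t - c) * cjg (zeta t - c) by rewrite mul_cjg czeta.
  have HE : cjg (H (zeta t)) = (zeta t - al)^-1.
    have zc0 : zeta t - c != 0 by rewrite -cmod_eq0 czeta gt_eqF.
    have cjV z : cjg z^-1 = (cjg z)^-1 by exact: conjc_inv.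
    have -> : H (zeta t) = (cjg (zeta t - al))^-1.
      rewrite /H rz; move: den0; rewrite rz.
      have -> : (zeta t - c) * cjg (zeta t - c) - cjg (al - c) * (zeta t - c) =
        (zeta t - c) * cjg (zeta t - al).
        have -> : zeta t - al = (zeta t - c) - (al - c) by ring.
        have cjB z w : cjg (z - w) = cjg z - cjg w.
          by rewrite -[in LHS](mulN1r w) cjgD cjgM; congr (_ + _);
             rewrite -[RHS]mulN1r; congr (_ * _); rewrite /cjg /= oppr0.
        by rewrite cjB; ring.
      rewrite mulf_eq0 negb_or => /andP[_ h].
      by rewrite invfM mulrA divff// mul1r.
    by rewrite cjV cjgK.
  by rewrite HE; field.
under eq_fun do rewrite E.
have cc1 : continuous (fun _ : R => 1 : C) by exact: cst_continuous.
have ccj : continuous (fun t => cjg (H (zeta t))).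
  move=> t; apply: (@continuous_comp _ _ _ (fun t => H (zeta t)) (@cjg R) t).
    exact: cHc.
  exact: continuous_cjg.
have ccz : continuous (fun t => (c - al) * cjg (H (zeta t))).
  by move=> t; exact: (continuous_mull (ccj t)).
rewrite (cavgB cc1 ccz) cavg_cst (cavgZ (c - al) ccj) (cavg_cjg cHc) cH0.
have -> : cjg 0 = 0 :> C by rewrite /cjg /= oppr0.
by rewrite mulr0 subr0.
Qed.

(** The extension is the Cauchy integral of [f] over the circle, which misses [A]. The hypothesis
    that [u c] is finite lets mean values be taken at the centre although [A] meets the disk. *)
Lemma removable_singularity f (M : R) :
  (forall z, disk a r0 z -> ~ A z -> cdiff f z) ->
  (forall z, cmod (z - c) <= rho -> ~ A z -> cmod (f z) <= M) ->
  exists g, forall z, cmod (z - c) < rho -> cdiff g z /\ (~ A z -> g z = f z).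
Proof.
move=> df fM.
have rp := rho0; have crh := crho.
have open0 z : disk a r0 z -> \forall w \near z, disk a r0 w.
  by move=> zD; apply: open_nbhs_nbhs; split => //; exact: open_disk.
have nf z : disk a r0 z -> ~ A z -> hnear f z.
  move=> zD nAz; apply: filterS2 (open0 z zD) (Acl zD nAz) => w; exact: df.
have nAzeta t : ~ A (zeta t) by apply: cA; exact: czeta.
have zD t : disk a r0 (zeta t) by apply: crD; rewrite czeta.
have cfz : continuous (fun t => f (zeta t)).
  by apply: continuous_circC => t; apply: cdiff_cont; apply: df; [exact: zD|exact: nAzeta].
have cmulr (h k : R -> C) : continuous h -> continuous k -> continuous (fun t => h t * k t).
  move=> ch ck t; exact: (@continuousM C R h k t (ch t) (ck t)).
have czc : continuous (fun t => zeta t - c).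
  apply: (@continuous_circC R (fun z => z - c)) => t.
  by apply: cdiff_cont; exact: nbhs_singleton (hnear_sub c _).
have czi al : cmod (al - c) < rho -> continuous (fun t => (zeta t - al)^-1).
  move=> alr; apply: (@continuous_circC R (fun z => (z - al)^-1)) => t.
  apply: cdiff_cont; apply: nbhs_singleton (hnear_inv (hnear_sub al _) _).
  by rewrite subr_eq0; exact: zeta_neq.
pose k al t := (zeta t - al)^-1 * (zeta t - c).
have ck al : cmod (al - c) < rho -> continuous (k al).
  by move=> alr; exact: (cmulr _ _ (czi al alr) czc).
have cfk al : cmod (al - c) < rho -> continuous (fun t => f (zeta t) * k al t).
  by move=> alr; exact: (cmulr _ _ cfz (ck al alr)).
have cC (z : C) : continuous (fun _ : R => z) by exact: cst_continuous.
exists (fun al => cavg (fun t => f (zeta t) * k al t)) => al alr.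
have M0 : 0 <= M.
  by apply: le_trans (fM (zeta 0) _ (nAzeta 0)); rewrite ?czeta ?cmod_ge0.
split.
  pose d := rho - cmod (al - c).
  have d0 : 0 < d by rewrite subr_gt0.
  have far be t : cmod (be - al) <= d / 2 -> d / 2 <= cmod (zeta t - be).
    move=> h; have := cmod_tri be (zeta t) c; rewrite czeta => h2.
    by have := cmod_tri al be c; rewrite /d in h d0 *; lra.
  pose k2 t := f (zeta t) * (k al t * (zeta t - al)^-1).
  have ck2 : continuous k2.
    exact: (cmulr _ _ cfz (cmulr _ _ (ck al alr) (czi al alr))).
  pose Q := M * (rho / (d / 2) ^+ 3).
  have Q0 : 0 <= Q by rewrite mulr_ge0// divr_ge0 ?exprn_ge0// ?ltW// divr_gt0.
  exists (cavg k2) => e e0.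
  exists (Num.min (d / 2) (e / (2 * Q + 1))).
    by rewrite lt_min !divr_gt0//; lra.
  move=> w; rewrite lt_min => /andP[wd]; rewrite ltr_pdivlMr; last by lra.
  move=> we.
  have wr : cmod (w - c) < rho by have := cmod_tri al w c; rewrite /d in wd d0; lra.
  have cB : continuous (fun t => f (zeta t) * k w t - f (zeta t) * k al t).
    move=> t; exact: (@continuousB C C R _ _ t (cfk w wr t) (cfk al alr t)).
  have cw : continuous (fun t => (w - al) * k2 t) by move=> t; exact: (continuous_mull (ck2 t)).
  rewrite [cavg k2 * _]mulrC -(cavgZ _ ck2) -(cavgB (cfk w wr) (cfk al alr)) -(cavgB cB cw).
  set h := fun t => _.
  have ch : continuous h by move=> t; exact: (@continuousB C C R _ _ t (cB t) (cw t)).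
  (* The remainder of the Cauchy kernel after its first-order term, exactly: it carries the factor
     [(w - al)^2]. *)
  have hE t : h t = f (zeta t) * ((w - al) * (w - al) * ((zeta t - c) *
      ((zeta t - w)^-1 * ((zeta t - al)^-1 * (zeta t - al)^-1)))).
    have z1 : zeta t - al != 0 by rewrite subr_eq0 zeta_neq.
    have z2 : zeta t - w != 0 by rewrite subr_eq0 zeta_neq.
    by rewrite /h /k2 /k; field; rewrite z1 z2.
  have hB t : cmod (h t) <= Q * cmod (w - al) ^+ 2.
    have inv x : d / 2 <= x -> x^-1 <= (d / 2)^-1.
      by move=> hx; rewrite lef_pV2 ?posrE//; lra.
    have f1 := far w t (ltW wd).
    have f2 := far al t ltac:(by rewrite subrr cmod0 ltW// divr_gt0).
    have d20 : 0 <= (d / 2)^-1 by rewrite invr_ge0 ltW// divr_gt0.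
    have i1 := inv _ f1; have i2 := inv _ f2.
    have p1 : 0 <= (cmod (zeta t - w))^-1 by rewrite invr_ge0 cmod_ge0.
    have p2 : 0 <= (cmod (zeta t - al))^-1 by rewrite invr_ge0 cmod_ge0.
    rewrite hE !cmodM !cmodV czeta.
    have fz : cmod (f (zeta t)) <= M by apply: fM; rewrite ?czeta//.
    have h3 : (cmod (zeta t - w))^-1 * ((cmod (zeta t - al))^-1 * (cmod (zeta t - al))^-1) <=
      (d / 2)^-1 * ((d / 2)^-1 * (d / 2)^-1) by rewrite !ler_pM ?mulr_ge0.
    rewrite /Q; have -> : M * (rho / (d / 2) ^+ 3) * cmod (w - al) ^+ 2 =
       M * (cmod (w - al) * cmod (w - al) * (rho * ((d / 2)^-1 * ((d / 2)^-1 * (d / 2)^-1)))).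
      by field; rewrite gt_eqF.
    apply: ler_pM => //; rewrite ?cmod_ge0//.
      by rewrite !mulr_ge0 ?cmod_ge0 ?(ltW rp).
    apply: ler_wpM2l; first by rewrite mulr_ge0 ?cmod_ge0.
    by apply: ler_wpM2l => //; exact: ltW.
  apply: le_trans (cavg_bound ch hB) _.
  have wal := cmod_ge0 (w - al).
  move: we wal hB Q0 {cB cw ch hE}; move: (cmod (w - al)) Q => X q we wal _ Q0.
  by rewrite expr2 mulrA mulrA; apply: ler_wpM2r => //; lra.
move=> nA; have alD : disk a r0 al by apply: crD; exact: ltW.
have [L fL] := df al alD nA.
(* The difference quotient times [z - c]: bounded off [A], continuous at [al], holomorphic elsewhere
   off [A], and zero at [c]. Its vanishing mean says that the Cauchy integral of [f] equals that of
   the constant [f al]. *)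
pose F z := if z == al then L * (al - c) else (f z - f al) / (z - al) * (z - c).
have Fal : F al = L * (al - c) by rewrite /F eqxx.
have FE z : z != al -> F z = (f z - f al) / (z - al) * (z - c).
  by move=> h; rewrite /F (negPf h).
have dF z : disk a r0 z -> ~ A z -> z != al -> cdiff F z.
  move=> zDd nAz zal; apply: (@cdiff_near (fun z => (f z - f al) / (z - al) * (z - c))).
    apply: cdiffM; last exact: nbhs_singleton (hnear_sub c z).
    apply: cdiffM; first by apply: cdiffB; [exact: df|exact: cdiff_cst].
    by apply: nbhs_singleton (hnear_inv (hnear_sub al z) _); rewrite subr_eq0.
  by apply: filterS (near_neq zal) => w wal; rewrite FE.
have quot (e : R) : 0 < e -> exists2 d : R, 0 < d & forall w, cmod (w - al) < d -> w != al ->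
    cmod ((f w - f al) / (w - al) - L) <= e.
  move=> e0; have [d d0 dP] := fL e e0; exists d => // w wd wal.
  have w0 : w - al != 0 by rewrite subr_eq0.
  have -> : (f w - f al) / (w - al) - L = (f w - f al - L * (w - al)) / (w - al) by field.
  by rewrite cmodM cmodV ler_pdivrMr ?cmod_gt0//; exact: dP.
have cFal : {for al, continuous F}.
  apply/cont_cmodCP => e e0.
  have K0 : 0 < cmod (al - c) + 1 by rewrite ltr_wpDl ?cmod_ge0.
  pose e1 := Num.min 1 (e / (4 * (cmod (al - c) + 1))).
  have e10 : 0 < e1 by rewrite lt_min ltr01 divr_gt0// mulr_gt0.
  have [d d0 dP] := quot e1 e10.
  pose e2 := e / (4 * (cmod L + 1)).
  have L0 : 0 < cmod L + 1 by rewrite ltr_wpDl ?cmod_ge0.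
  have e20 : 0 < e2 by rewrite divr_gt0// mulr_gt0.
  exists (Num.min d (Num.min 1 e2)); first by rewrite !lt_min d0 ltr01.
  move=> w; rewrite !lt_min => /andP[wd /andP[w1 we2]].
  have [->|wal] := eqVneq w al; first by rewrite subrr cmod0.
  rewrite FE// Fal; set q := (f w - f al) / (w - al).
  have hq : cmod (q - L) <= e1 by exact: dP.
  have -> : q * (w - c) - L * (al - c) = (q - L) * (w - c) + L * (w - al) by ring.
  apply: le_lt_trans (cmodD _ _) _; rewrite !cmodM.
  have wc : cmod (w - c) <= cmod (al - c) + 1 by have := cmod_tri al w c; lra.
  have h1 : cmod (q - L) * cmod (w - c) <= e / 4.
    apply: le_trans (ler_pM (cmod_ge0 _) (cmod_ge0 _) hq wc) _.
    have : e1 <= e / (4 * (cmod (al - c) + 1)) by rewrite ge_min lexx orbT.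
    by rewrite ler_pdivlMr ?mulr_gt0//; lra.
  have h2 : cmod L * cmod (w - al) <= e / 4.
    move: we2; rewrite ltr_pdivlMr ?mulr_gt0//; have := cmod_ge0 (w - al); lra.
  lra.
have nF z : cmod (z - c) <= rho -> ~ A z -> \forall w \near z, disk a r0 w /\ ~ A w.
  by move=> zc nAz; apply: filterS2 (open0 z (crD zc)) (Acl (crD zc) nAz).
have [d d0 dP] := quot 1 ltr01.
have FB z : cmod (z - c) <= rho -> ~ A z -> cmod (F z) <= (cmod L + 1 + 2 * M / d) * rho.
  move=> zc nAz; have Md : 0 <= 2 * M / d by rewrite divr_ge0 ?mulr_ge0// ltW.
  have L1 := cmod_ge0 L.
  have [->|zal] := eqVneq z al.
    rewrite Fal cmodM; apply: ler_pM; rewrite ?cmod_ge0//; [lra|exact: ltW].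
  rewrite FE// cmodM; apply: ler_pM; rewrite ?cmod_ge0//.
  have [zd|zd] := ltP (cmod (z - al)) d.
    set q := (f z - f al) / (z - al); have hq : cmod (q - L) <= 1 by exact: dP.
    by have := cmodD (q - L) L; rewrite subrK; lra.
  rewrite cmodM cmodV; apply: le_trans (_ : 2 * M / d <= _); last by lra.
  apply: ler_pM; rewrite ?cmod_ge0 ?invr_ge0 ?cmod_ge0//.
    apply: le_trans (cmodD _ _) _; rewrite cmodN.
    have := fM z zc nAz; have := fM al (ltW alr) nA; lra.
  by rewrite lef_pV2 ?posrE//; exact: lt_le_trans zd.
have main : cavg (fun t => F (zeta t)) = F c.
  apply: (cavg_off_polar su uA Acl rho0 crho cA uc _ _ FB) => z zc nAz.
    apply: filterS (nF z zc nAz) => w [wD nAw].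
    have [->|wal] := eqVneq w al; first exact: cFal.
    by apply: cdiff_cont; exact: dF.
  have [->|zal] := eqVneq z al.
    apply: filterS (nF al (ltW alr) nA) => w [wD nAw] wal; exact: dF.
  by apply: filterS2 (nF z zc nAz) (near_neq zal) => w [wD nAw] wal _; exact: dF.
have Fc : F c = 0.
  rewrite /F; case: eqP => [->|_]; by rewrite subrr mulr0.
have FzE t : F (zeta t) = f (zeta t) * k al t - f al * k al t.
  by rewrite FE ?zeta_neq// /k; ring.
move: main; rewrite Fc; under [X in cavg X]eq_fun do rewrite FzE.
have ckf : continuous (fun t => f al * k al t) by move=> t; exact: (continuous_mull (ck al alr t)).
rewrite (cavgB (cfk al alr) ckf) (cavgZ (f al) (ck al alr)).
by rewrite (cavg_cauchy_kernel alr) mulr1 => /eqP; rewrite subr_eq0 => /eqP.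
Qed.

End RemovableSingularity.

(** * Potentials that are very negative on parts of the polar set *)

Section PolarPotentials.
Variable R : realType.
Local Notation C := (CC R).
Implicit Types (z w a b c : C) (A D : set C) (u : C -> \bar R).

(** The point at stake is that [u] does not become identically [-oo] on the smaller disk, which
    [sub_infinite_all] excludes. *)
Lemma polar_local D A a (q : R) : polar A -> A a -> open D -> D a -> 0 < q ->
  exists (r : R) u, [/\ 0 < r <= q, disk a r `<=` D, subharmonic (disk a r) u,
    (exists2 z, disk a r z & u z <> -oo%E) & forall z, disk a r z -> A z -> u z = -oo%E].
Proof.
move=> pA Aa /open_cmodP/(_ a) oD Da q0.
have [r1 r10 [u [su [z1 z1r uz1] uA]]] := pA a Aa.
have [r2 r20 r2P] := oD Da.
pose r := Num.min (Num.min r1 r2) q.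
have r0 : 0 < r by rewrite !lt_min r10 r20.
have rr1 : r <= r1 by rewrite !ge_min lexx.
have rr2 : r <= r2 by rewrite !ge_min lexx orbT.
have rq : r <= q by rewrite !ge_min lexx orbT.
have sub z : disk a r z -> disk a r1 z by move=> h; exact: lt_le_trans h rr1.
exists r, u; split.
- by rewrite r0.
- by move=> z zr; apply: r2P; exact: lt_le_trans zr rr2.
- have [_ s1 s2 s3] := su; split.
  + exact: open_disk.
  + by move=> z /sub; exact: s1.
  + by move=> z /sub; exact: s2.
  + move=> z zr; have [rho rho0 [_ rhoP]] := s3 z (sub z zr).
    exists (Num.min rho (r - cmod (z - a))); first by rewrite lt_min rho0 subr_gt0.
    split; last by move=> s s0; rewrite lt_min => /andP[+ _]; exact: rhoP.
    move=> w; rewrite /disk /= lt_min => /andP[_].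
    by have := cmod_tri z w a; (clear; lra).
- apply: contrapT => none; apply: uz1.
  apply: (@sub_infinite_all R a r1 u a (r / 2)) => //; first by rewrite divr_gt0.
  move=> w wr; have wr' : disk a r w by rewrite /disk /=; (clear - r0 wr; lra).
  split; first exact: sub.
  by apply: contrapT => uw; apply: none; exists w.
- by move=> z /sub; exact: uA.
Qed.

Section LocalPotential.
Variables (a : C) (r0 : R) (u : C -> \bar R) (A : set C).
Hypotheses (su : subharmonic (disk a r0) u)
  (uA : forall z, disk a r0 z -> A z -> u z = -oo%E)
  (Acl : forall z, disk a r0 z -> ~ A z -> \forall w \near z, ~ A w).

(* Inside the circle, where [u >= - n], the potential is a regularization of
   [u]; outside it is continued by a multiple of [ln |z - a|]. *)
Lemma local_potential (t n : R) : 0 < t -> 3 * t < r0 ->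
  (forall z, cmod (z - a) = t -> ((- n)%:E <= u z)%E) ->
  exists K : R, [/\ 0 <= K, (forall z, cmod (z - a) <= t -> (u z <= K%:E)%E) &
  forall T : R, 0 <= T -> exists P : C -> R,
   [/\ (forall z, shl P z),
       (forall z, cmod (z - a) <= t -> A z -> \forall w \near z, P w <= - T),
       (forall z, P z <= K * (1 + cmod z)),
       (forall z, 2 * t <= cmod (z - a) -> 0 <= P z) &
       (forall z, cmod (z - a) <= t -> (u z <= (P z + K)%:E)%E)]].
Proof.
move=> t0 tr un.
pose r := 3 * t; have rp : 0 < r by rewrite /r mulr_gt0.
have [M [M0 MP conv]] := sup_convolution_compact su rp tr.
pose n' := Num.max n 0.
have nn : n <= n' by rewrite le_max lexx.
have n0 : 0 <= n' by rewrite le_max lexx orbT.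
clearbody n'.
have l2 : 0 < ln 2 :> R by rewrite ln_gt0// ltr1n.
(* Makes [Psi] rise from below [- n' - M] on the circle of radius [t] to [1] on that of radius
   [2 t], so that it crosses [p'], which lies between [- n' - M] and [0] where it matters. *)
pose c := (n' + M + 2) / ln 2.
have c0 : 0 < c by rewrite divr_gt0//; lra.
pose t2 := 2 * t; have t20 : 0 < t2 by rewrite /t2 mulr_gt0.
pose Psi z := c * ln (cmod (z - a) / t2) + 1.
have PsiE z : z != a -> Psi z = c * (ln (cmod (z - a)) - ln t2) + 1.
  by move=> za; rewrite /Psi ln_div// posrE// cmod_gt0 subr_eq0.
have sPsi z : z != a -> shl Psi z.
  move=> za; apply: (@shl_near _ _ (fun w => c * (ln (cmod (w - a)) + - ln t2) + 1)).
    apply: shlD; last exact: shl_cst.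
    apply: shlZ; first exact: ltW.
    by apply: shlD; [exact: shl_ln_dist|exact: shl_cst].
  by apply: filterS (near_neq za) => w wa; rewrite PsiE.
have Psi_t z : cmod (z - a) = t -> Psi z < - n' - M.
  move=> zt; rewrite /Psi zt.
  have -> : t / t2 = 2^-1 by rewrite /t2; field; rewrite gt_eqF.
  by rewrite lnV ?posrE// mulrN /c divfK ?gt_eqF//; lra.
have Psi_t2 z : t2 <= cmod (z - a) -> 1 <= Psi z.
  move=> zt; rewrite /Psi lerDr mulr_ge0 ?(ltW c0)// ln_ge0//.
  by rewrite ler_pdivlMr// mul1r.
have Psi_up z : Psi z <= c * (cmod (z - a) / t2) + 1.
  have x0 : 0 <= cmod (z - a) / t2 by rewrite divr_ge0 ?cmod_ge0// ltW.
  rewrite /Psi lerD2r ler_pM2l//.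
  move: x0; rewrite le_eqVlt => /predU1P[<-|x0]; first by rewrite ln0.
  have := expR_ge1Dx (ln (cmod (z - a) / t2)); rewrite lnK ?posrE//; lra.
have ca := cmod_ge0 a.
pose K := Num.max M (1 + c * ((1 + cmod a) / t2)).
have KM : M <= K by rewrite le_max lexx.
have K0 : 0 <= K by exact: le_trans KM.
have Kc : 1 + c * ((1 + cmod a) / t2) <= K by rewrite le_max lexx orbT.
have tdisk z : cmod (z - a) <= t2 -> disk a r z.
  by rewrite /disk /= /r /t2; lra.
have tt2 z : cmod (z - a) <= t -> cmod (z - a) <= t2 by rewrite /t2; lra.
exists K; split => //.
  move=> z /tt2 /tdisk /MP /le_trans; apply; by rewrite lee_fin.
move=> T T0.
have D0 z : cmod (z - a) <= t -> disk a r0 z by rewrite /disk /=; lra.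
have cK : compact (cball a t `&` A).
  by apply: (@compact_polar_cball R a r0 A Acl a t); rewrite subrr cmod0; lra.
have [|z [zt Az]|p [pP pT]] := conv T (cball a t `&` A) T0 cK.
- by move=> z [/tt2 /tdisk].
- exact: uA (D0 z zt) Az.
pose p' z := p z - M.
have sp z : cmod (z - a) <= t2 -> shl p' z.
  by move=> /tdisk zr; have [h _ _ _] := pP z zr; apply: shlD => //; exact: shl_cst.
have p'0 z : cmod (z - a) <= t2 -> p' z <= 0.
  by move=> /tdisk zr; have [_ _ _ h] := pP z zr; rewrite /p'; lra.
have p't z : cmod (z - a) = t -> - n' - M <= p' z.
  move=> zt; have [|_ h _ _] := pP z; first by apply: tdisk; rewrite zt /t2; lra.
  have := le_trans (un z zt) h; rewrite lee_fin /p'; lra.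
(* On the circle of radius [t] the maximum is [p'], on that of radius [2 t] it is [Psi]; hence the
   three branches fit together. *)
pose P z := if cmod (z - a) <= t then p' z else
  if cmod (z - a) < t2 then Num.max (p' z) (Psi z) else Psi z.
have nlt z (s : R) : cmod (z - a) < s -> \forall w \near z, cmod (w - a) < s.
  by move=> h; apply: open_nbhs_nbhs; split; [exact: (@open_disk R a s)|].
have ngt z (s : R) : s < cmod (z - a) -> \forall w \near z, s < cmod (w - a).
  move=> h; have : nbhs z (~` cball a s).
    apply: open_nbhs_nbhs; split; first by apply: closed_openC; exact: closed_cball.
    by move=> /=; rewrite /cball /=; lra.
  by apply: filterS => w /= /negP; rewrite -ltNge.
have away z : t <= cmod (z - a) -> z != a.
  by move=> h; rewrite -subr_eq0 -cmod_gt0; lra.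
have P_in z : cmod (z - a) <= t -> \forall w \near z, p' w = P w.
  move=> zt; have zt2 : cmod (z - a) < t2 by rewrite /t2; lra.
  have [zl|ze] := ltP (cmod (z - a)) t.
    by apply: filterS (nlt z t zl) => w wt; rewrite /P ltW.
  have {ze}zE : cmod (z - a) = t by apply/le_anti; rewrite zt.
  have za := away z ltac:(by rewrite zE).
  have lt : Psi z < p' z by exact: lt_le_trans (Psi_t z zE) (p't z zE).
  have e0 : 0 < p' z - Psi z by rewrite subr_gt0.
  have /cont_cmodP/(_ _ e0)[d d0 dP] : {for z, continuous (fun w => p' w - Psi w)}.
    by apply: contB; [exact: shl_at (sp z (ltW zt2))|exact: shl_at (sPsi z za)].
  apply: filterS2 (nlt z t2 zt2) (near_cmod z d0) => w w2 /dP; rewrite ltr_norml => h.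
  by rewrite /P w2; case: ifP => // _; apply/esym/max_idPl; lra.
have p'low z : cmod (z - a) <= t -> A z -> \forall w \near z, p' w <= - T.
  by move=> zt Az; apply: filterS (pT z (conj zt Az)) => w; rewrite /p'; lra.
exists P; split.
- move=> z; have [zt|zt] := leP (cmod (z - a)) t.
    by apply: shl_near (P_in z zt); apply: sp; exact: tt2.
  have za := away z (ltW zt).
  have [z2|z2] := ltP (cmod (z - a)) t2.
    apply: (@shl_near _ _ (fun w => Num.max (p' w) (Psi w))).
      by apply: shl_max; [apply: sp; exact: ltW|exact: sPsi].
    apply: filterS2 (nlt z t2 z2) (ngt z t zt) => w w2 wt.
    by rewrite /P w2 leNgt wt.
  apply: (shl_near (sPsi z za)).
  have /cont_cmodP/(_ _ ltr01)[d d0 dP] := shl_at (sPsi z za).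
  apply: filterS2 (ngt z t zt) (near_cmod z d0) => w wt /dP; rewrite ltr_norml => h.
  rewrite /P leNgt wt /=; case: ifP => // w2.
  apply/esym/max_idPr; have := p'0 w (ltW w2); have := Psi_t2 z z2; lra.
- move=> z zt Az; apply: filterS2 (P_in z zt) (p'low z zt Az) => w <-; exact.
- move=> z; have cz := cmod_ge0 z.
  have P0 : 0 <= K * (1 + cmod z) by rewrite mulr_ge0//; lra.
  have PsiK : Psi z <= K * (1 + cmod z).
    apply: le_trans (Psi_up z) _; apply: le_trans (_ : (1 + c * ((1 + cmod a) / t2)) * (1 + cmod z) <= _); last first.
      by rewrite ler_wpM2r//; lra.
    have h1 : cmod (z - a) <= (1 + cmod a) * (1 + cmod z).
      apply: le_trans (cmodD _ _) _; rewrite cmodN; nra.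
    have h2 : c * (cmod (z - a) / t2) <= c * ((1 + cmod a) / t2) * (1 + cmod z).
      rewrite -mulrA ler_pM2l// mulrAC ler_wpM2r// invr_ge0 ltW//.
    by lra.
  rewrite /P; case: ifP => [/tt2 /p'0 h|_]; first exact: le_trans h P0.
  case: ifP => // w2; rewrite ge_max PsiK andbT.
  exact: le_trans (p'0 z (ltW w2)) P0.
- move=> z z2; have z2' : t2 <= cmod (z - a) by [].
  have tz : t < cmod (z - a) by rewrite /t2 in z2'; lra.
  rewrite /P; case: ifP => [h|_]; first by lra.
  case: ifP => [h|_]; first by lra.
  by have := Psi_t2 z z2'; lra.
- move=> z zt; rewrite /P zt; have [_ h _ _] := pP z (tdisk z (tt2 z zt)).
  by apply: le_trans h _; rewrite lee_fin /p'; lra.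
Qed.

End LocalPotential.

(** A finite sum of local potentials centred at points of [X], each nonnegative near [b] because its
    disk has radius at most [d]. The growth constant [K] does not depend on the depth [T]. *)
Lemma away_potential D A (X : set C) b (d rho : R) : open D -> A `<=` D ->
  (forall z, D z -> ~ A z -> \forall w \near z, ~ A w) -> polar A ->
  compact X -> X `<=` A -> 0 < d -> (forall z, X z -> 2 * d <= cmod (z - b)) ->
  exists2 K : R, 0 <= K & forall T : R, 0 <= T -> exists P : C -> R,
   [/\ (forall z, shl P z),
       (forall z, X z -> cmod z <= rho -> \forall w \near z, P w <= - T),
       (forall z, P z <= K * (1 + cmod z)) &
       (forall z, cmod (z - b) <= d -> 0 <= P z)].
Proof.
move=> oD AD Acl pA cX XA d0 Xb.
pose Pot (Y : set C) := exists2 K : R, 0 <= K & forall T : R, 0 <= T -> exists P : C -> R,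
   [/\ (forall z, shl P z),
       (forall z, Y z -> cmod z <= rho -> \forall w \near z, P w <= - T),
       (forall z, P z <= K * (1 + cmod z)) &
       (forall z, cmod (z - b) <= d -> 0 <= P z)].
apply: (@compact_induction _ X Pot) => //.
- exists 0 => // T T0; exists (fun=> 0); split => //.
    by move=> z; exact: shl_cst.
  by move=> z; rewrite mul0r.
- move=> Y Z YZ [K K0 KP]; exists K => // T /KP[P [P1 P2 P3 P4]].
  by exists P; split => // z /YZ; exact: P2.
- move=> Y Z [K K0 KP] [L L0 LP]; exists (K + L); first exact: addr_ge0.
  move=> T T0; pose rr := Num.max rho 0.
  have rr0 : 0 <= rr by rewrite le_max lexx orbT.
  have rrr : rho <= rr by rewrite le_max lexx.
  (* The additional depth absorbs the growth of the other summand, which is controlled for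
     [cmod z <= rho] up to a unit neighbourhood. *)
  have [|P [P1 P2 P3 P4]] := KP (T + L * (2 + rr)).
    by rewrite addr_ge0// mulr_ge0//; (clear - rr0; lra).
  have [|Q [Q1 Q2 Q3 Q4]] := LP (T + K * (2 + rr)).
    by rewrite addr_ge0// mulr_ge0//; (clear - rr0; lra).
  have nr z : cmod z <= rho -> \forall w \near z, cmod w <= 1 + rr.
    move=> zr; apply: filterS (near_cmod z ltr01) => w wz.
    by have := cmod_tri z w 0; rewrite !subr0; (clear - rrr zr wz; lra).
  exists (fun z => P z + Q z); split.
  + by move=> z; exact: shlD.
  + move=> z [Yz|Zz] zr.
      apply: filterS2 (P2 z Yz zr) (nr z zr) => w hw wr.
      have := Q3 w; have : L * (1 + cmod w) <= L * (2 + rr) by rewrite ler_wpM2l//; (clear - wr; lra).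
      by (clear - hw; lra).
    apply: filterS2 (Q2 z Zz zr) (nr z zr) => w hw wr.
    have := P3 w; have : K * (1 + cmod w) <= K * (2 + rr) by rewrite ler_wpM2l//; (clear - wr; lra).
    by (clear - hw; lra).
  + by move=> z; rewrite mulrDl lerD.
  + by move=> z zd; rewrite addr_ge0// ?P4 ?Q4.
- move=> x Xx; have Ax := XA x Xx.
  have [r [u [/andP[r0 rd] rD su nu uA]]] := polar_local pA Ax oD (AD x Ax) d0.
  have q0 : 0 < r / 4 by rewrite divr_gt0.
  have [s s0 [sq /(_ x r u x su nu)]] := circle_lower_bound q0.
  rewrite subrr cmod0 add0r => /(_ ltac:(lra))[t [n [st tq un]]].
  have t0 : 0 < t by (clear - s0 st; lra).
  have Acl' z : disk x r z -> ~ A z -> \forall w \near z, ~ A w by move=> /rD; exact: Acl.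
  have t3 : 3 * t < r by (clear - tq t0; lra).
  have [K [K0 _ KP]] := local_potential su uA Acl' t0 t3 un.
  exists [set z | cmod (z - x) < t]; first exact: near_cmod.
  exists K => // T /KP[P [P1 P2 P3 P4 _]]; exists P; split => //.
    by move=> z [Xz /= /ltW zt] _; apply: P2 => //; exact: XA.
  move=> z zd; apply: P4; have := Xb x Xx; have := cmod_tri z x b.
  by rewrite (cmodB x z); (clear - rd t0 t3 zd; lra).
Qed.

End PolarPotentials.

(** * Components of the superlevel sets of the modulus *)

Section Components.
Variable R : realType.
Local Notation C := (CC R).
Implicit Types (z w a b c : C) (A D N : set C) (u : C -> \bar R) (f : C -> C).

Lemma disk_connected c (d : R) : connected (disk c d).
Proof.
have -> : disk c d = \bigcup_(z in disk c d) ((fun s : R => c + rc s * (z - c)) @` `[0, 1]).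
  apply/seteqP; split => [z zd|w [z zd [s]]].
    exists z => //; exists 1; first by rewrite /= in_itv /= ler01 lexx.
    by rewrite rc1 mul1r addrC subrK.
  rewrite /= in_itv /= => /andP[s0 s1] <-.
  rewrite /disk /= addrC addKr cmodM cmod_rc ger0_norm//.
  by apply: le_lt_trans zd; rewrite ler_piMl// cmod_ge0.
apply: bigcup_connected => [|z zd].
  by exists c => z zd; exists 0; rewrite ?rc0 ?mul0r ?addr0//= in_itv /= lexx ler01.
apply: connected_continuous_connected; first exact: segment_connected.
apply: continuous_subspaceT => s.
have -> : (fun s : R => c + rc s * (z - c)) = (fun s => c + (z - c) * rc s).
  by apply/funext => v; rewrite mulrC.
apply: (@continuous_comp _ _ _ (fun s : R => rc s : C) (fun w => c + (z - c) * w) s).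
  by apply: continuous_pairC; [|exact: cst_continuous].
exact: continuous_affine.
Qed.

Lemma component_open N x z : open N -> connected_component N x z ->
  \forall w \near z, connected_component N x w.
Proof.
move=> /open_cmodP oN xz; have Nz := connected_component_sub xz.
have [d d0 dP] := oN z Nz.
apply: filterS (near_cmod z d0) => w wd.
apply: connected_component_trans xz _.
exists (disk z d); last exact: wd.
by split; [rewrite /disk /= subrr cmod0|exact: dP|exact: disk_connected].
Qed.

Lemma component_closed_in N x z : open N -> N z -> ~ connected_component N x z ->
  \forall w \near z, ~ connected_component N x w.
Proof.
move=> oN Nz nxz; have zz := connected_component_refl Nz.
apply: filterS (component_open oN zz) => w zw xw; apply: nxz.
by apply: connected_component_trans xw _; exact: connected_component_sym.
Qed.

Lemma continuous_near_eq (g h : C -> R) z : {for z, continuous h} ->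
  (\forall w \near z, h w = g w) -> {for z, continuous g}.
Proof.
move=> /cont_cmodP ch hg; have hz := nbhs_singleton hg.
apply/cont_cmodP => e e0; have [d d0 dP] := ch e e0.
move/nbhs_cmodP : hg => [r r0 rP]; exists (Num.min d r); first by rewrite lt_min d0.
by move=> w; rewrite lt_min => /andP[/dP wd /rP <-]; rewrite -hz.
Qed.

Section Unbounded.
Variables (a : C) (r0 : R) (u : C -> \bar R) (A : set C) (f : C -> C) (t M0 : R).
Hypotheses (su : subharmonic (disk a r0) u)
  (nu : exists2 z, disk a r0 z & u z <> -oo%E)
  (uA : forall z, disk a r0 z -> A z -> u z = -oo%E)
  (Acl : forall z, disk a r0 z -> ~ A z -> \forall w \near z, ~ A w)
  (df : forall z, disk a r0 z -> ~ A z -> cdiff f z)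
  (t0 : 0 < t) (tr : t < r0) (tA : forall z, cmod (z - a) = t -> ~ A z)
  (fM : forall z, cmod (z - a) = t -> cmod (f z) <= M0).

Let N (k : R) := [set z | [/\ cmod (z - a) < t, ~ A z & k < cmod (f z)]].

Let tD z : cmod (z - a) <= t -> disk a r0 z.
Proof. by move=> h; exact: le_lt_trans h tr. Qed.

Let cf z : cmod (z - a) <= t -> ~ A z -> {for z, continuous (fun w => cmod (f w))}.
Proof.
move=> zt nAz; have cfz := cdiff_cont (df (tD zt) nAz).
exact: (continuous_at_comp cfz (@continuous_cmod R)).
Qed.

Let nt z : cmod (z - a) < t -> \forall w \near z, cmod (w - a) < t.
Proof. by move=> h; apply: open_nbhs_nbhs; split; [exact: (@open_disk R a t)|]. Qed.

Lemma superlevel_open k : open (N k).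
Proof.
rewrite openE => z [zt nAz kz]; rewrite /interior.
have /cont_cmodP := cf (ltW zt) nAz; move: kz; rewrite -subr_gt0 => kz.
move=> /(_ _ kz)[d d0 dP].
have near2 : \forall w \near z, cmod (w - a) < t /\ ~ A w.
  by apply: filterS2 (nt zt) (Acl (tD (ltW zt)) nAz).
apply: filterS2 near2 (near_cmod z d0) => w [wt nAw] /dP.
by rewrite ltr_norml => h; split => //; lra.
Qed.

(** The excess of [ln (cmod (f z))] over [ln k] on the component, extended by [0], is subharmonic
    off [A] and vanishes on the circle, where [cmod (f z) <= M0 < k]. If it were bounded,
    [max_off_polar] would make it nonpositive where [u] is finite, and the open component contains
    such a point. *)
Lemma unbounded_on_component (k B : R) z0 : 0 < k -> M0 < k -> N k z0 ->
  exists2 z, connected_component (N k) z0 z & B < cmod (f z).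
Proof.
move=> k0 Mk Nz0; apply: contrapT => nB.
pose cc := connected_component (N k) z0.
have oN : open (N k) by exact: superlevel_open.
have ccN z : cc z -> N k z by exact: connected_component_sub.
have fB z : cc z -> cmod (f z) <= B.
  by move=> cz; rewrite leNgt; apply/negP => h; apply: nB; exists z.
pose h z := if `[< cc z >] then ln (cmod (f z)) - ln k else 0.
have h0 z : ~ cc z -> h z = 0 by rewrite /h; case: asboolP.
have h1 z : cc z -> h z = ln (cmod (f z)) - ln k by rewrite /h; case: asboolP.
have hpos z : cc z -> 0 < h z.
  by move=> cz; have [_ _ kz] := ccN z cz; rewrite h1// subr_gt0 ltr_ln ?posrE//; lra.
have hge0 z : 0 <= h z.
  by have [/hpos/ltW //|/h0 ->] := pselect (cc z).
have s1 z : cc z -> shl h z.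
  move=> cz; have [zt nAz kz] := ccN z cz.
  have hf : hnear f z.
    have near2 : \forall w \near z, cmod (w - a) < t /\ ~ A w.
      by apply: filterS2 (nt zt) (Acl (tD (ltW zt)) nAz).
    by apply: filterS near2 => w [wt nAw]; apply: df => //; apply: tD; exact: ltW.
  have fz0 : f z != 0 by rewrite -cmod_gt0; lra.
  apply: (@shl_near _ _ (fun w => ln (cmod (f w)) + - ln k)).
    by apply: shlD; [exact: shl_ln|exact: shl_cst].
  by apply: filterS (component_open oN cz) => w cw; rewrite h1.
have ch z : cmod (z - a) < t -> ~ A z -> {for z, continuous h}.
  move=> zt nAz; have [cz|ncz] := pselect (cc z); first exact: shl_at (s1 z cz).
  have [fk|fk] := ltP k (cmod (f z)).
    apply: (@continuous_near_eq _ (fun=> 0)); first exact: cst_continuous.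
    have Nz : N k z by split.
    by apply: filterS (component_closed_in oN Nz ncz) => w /h0.
  apply/cont_cmodP => e e0.
  (* Near a point with [cmod (f z) <= k] the modulus stays below [k e^e], so [h] stays below [e]. *)
  have ek : 0 < k * expR e - cmod (f z).
    rewrite subr_gt0; apply: le_lt_trans fk _.
    by rewrite ltr_pMr// -expR0 ltr_expR.
  have /cont_cmodP/(_ _ ek)[d d0 dP] := cf (ltW zt) nAz.
  exists d => // w /dP; rewrite ltr_norml => /andP[_ hw].
  rewrite (h0 _ ncz) subr0 ger0_norm//.
  have [cw|/h0 -> //] := pselect (cc w).
  have [_ _ kw] := ccN w cw.
  rewrite h1// ltrBlDl -[X in _ < _ + X]expRK -lnM ?posrE ?expR_gt0//.
  by rewrite ltr_ln ?posrE ?mulr_gt0 ?expR_gt0//; lra.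
have sh z : cmod (z - a) <= t -> ~ A z -> shl h z.
  move=> zt nAz; have [zl|ze] := ltP (cmod (z - a)) t.
    have [cz|ncz] := pselect (cc z); first exact: s1.
    apply: shl_min; last by apply: near_all => w; rewrite h0.
    by apply: filterS2 (nt zl) (Acl (tD zt) nAz) => w; exact: ch.
  have zE : cmod (z - a) = t by apply/le_anti; rewrite zt.
  apply: (@shl_near _ _ (fun=> 0)); first exact: shl_cst.
  have ek : 0 < k - cmod (f z) by have := fM zE; lra.
  have /cont_cmodP/(_ _ ek)[d d0 dP] := cf zt nAz.
  apply: filterS (near_cmod z d0) => w /dP; rewrite ltr_norml => hw.
  by rewrite h0// => /ccN[_ _]; lra.
have [z1 cz1 uz1] : exists2 z, cc z & u z <> -oo%E.
  have cz0 : cc z0 by exact: connected_component_refl.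
  apply: contrapT => none; have [z uz] := nu; apply.
  have /nbhs_cmodP[d d0 dP] := component_open oN cz0.
  apply: (@sub_infinite_all R a r0 u z0 (d / 2)) => //; first by rewrite divr_gt0.
  move=> w wd; have cw : cc w by apply: dP; lra.
  have [wt _ _] := ccN w cw; split; first by apply: tD; exact: ltW.
  by apply: contrapT => uw; apply: none; exists w.
have aa : cmod (a - a) + t < r0 by rewrite subrr cmod0 add0r.
have [wt nAw _] := ccN z1 cz1.
have := hpos z1 cz1; rewrite ltNge => /negP; apply.
apply: (max_off_polar su uA Acl t0 aa tA (B := `|ln B - ln k|) sh) => //; last exact: ltW.
  move=> z zt nAz; have [cz|/h0 -> //] := pselect (cc z).
  have [_ _ kz] := ccN z cz; have fz := fB z cz.
  rewrite h1//; apply: le_trans (ler_norm _); rewrite lerD2r ler_ln ?posrE//; lra.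
move=> z zt; rewrite h0// => /ccN[]; lra.
Qed.

End Unbounded.

End Components.

(** * Points of the polar set that are surrounded by large values *)

Section Center.
Variable R : realType.
Local Notation C := (CC R).
Implicit Types (z w a b c : C) (A D N : set C) (u : C -> \bar R) (f : C -> C).

Lemma connected_component_mono (T : topologicalType) (M N : set T) x y :
  M `<=` N -> connected_component M x y -> connected_component N x y.
Proof.
move=> MN [Y [Yx YM cY] Yy]; exists Y => //.
by split => //; exact: subset_trans YM MN.
Qed.

Lemma bounded_on_circle f a (t : R) :
  (forall z, cmod (z - a) = t -> {for z, continuous f}) ->
  exists M, forall z, cmod (z - a) = t -> cmod (f z) <= M.
Proof.
move=> cf.
pose P (Y : set C) := exists M, forall z, Y z -> cmod (z - a) = t -> cmod (f z) <= M.
suff [M MP] : P (cball a t).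
  by exists M => z zt; apply: MP => //; rewrite /cball /= zt.
apply: (compact_induction (@compact_cball R a t)).
- by exists 0.
- by move=> X Y XY [M MP]; exists M => z /XY; exact: MP.
- move=> X Y [M MP] [M' MP']; exists (Num.max M M') => z [Xz|Yz] zt.
    by rewrite le_max MP.
  by rewrite le_max MP' ?orbT.
move=> x _; have [xt|nxt] := pselect (cmod (x - a) = t).
  have /cont_cmodP/(_ 1 ltr01)[d d0 dP] := continuous_at_comp (cf x xt) (@continuous_cmod R).
  exists (disk x d); first exact: (near_cmod x d0).
  exists (cmod (f x) + 1) => z [_ /dP]; rewrite ltr_norml => h _; (clear - h; lra).
exists [set z | cmod (z - a) <> t]; last by exists 0 => z [].
have /cont_cmodP := continuous_at_comp (@continuous_affine R (- a) 1 x) (@continuous_cmod R).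
have d0 : 0 < `|cmod (x - a) - t| by rewrite normr_gt0 subr_eq0; apply/eqP.
move=> /(_ _ d0)[d dd dP].
apply: filterS (near_cmod x dd) => w /dP; rewrite !mul1r ![- a + _]addrC => h E.
by move: h; rewrite E distrC ltxx.
Qed.

Lemma continuous_dist b : continuous (fun z => cmod (z - b)).
Proof.
move=> z; apply/cont_cmodP => e e0; exists e => // w wz.
rewrite ltr_norml; have := cmod_tri z w b; have := cmod_tri w z b.
by rewrite (cmodB z w); move: wz; (clear; lra).
Qed.

Lemma connected_meets_sphere (Y : set C) b z w (s : R) : connected Y -> Y z -> Y w ->
  cmod (z - b) <= s <= cmod (w - b) -> exists2 v, Y v & cmod (v - b) = s.
Proof.
move=> cY Yz Yw zsw.
have /connected_intervalP cI :=
  connected_continuous_connected cY (continuous_subspaceT (@continuous_dist b)).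
have [||v Yv <-] := cI (cmod (z - b)) (cmod (w - b)) _ _ s zsw; last by exists v.
  by exists z.
by exists w.
Qed.

(** The last clause is what [circle_barrier] requires of the sets where [f] is large; the others
    provide a potential [u] for [A] near [b] and a circle about [a] that encloses [b] and on which
    [u] is bounded below. *)
Definition singular_center D A f a b u (r0 t n : R) :=
  [/\ disk a r0 `<=` D, subharmonic (disk a r0) u,
      (exists2 z, disk a r0 z & u z <> -oo%E) &
      (forall z, disk a r0 z -> A z -> u z = -oo%E)] /\
  [/\ 0 < t, 3 * t < r0 & forall z, cmod (z - a) = t -> ((- n)%:E <= u z)%E] /\
  [/\ A b, cmod (b - a) < t & forall k : R, exists2 rho : R, 0 < rho &
      forall s : R, 0 < s -> s <= rho ->
      exists2 z, [/\ D z, ~ A z & k < cmod (f z)] & cmod (z - b) = s].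

(** The points [zs i] run through nested components with increasing levels. A cluster point [b] lies
    in [A] because [f] is unbounded along them, and the connected components reaching from [zs i] to
    points near [b] cross all small circles about [b]. *)
Lemma exists_center D A f a (q : R) : open D -> A `<=` D ->
  (forall z, D z -> ~ A z -> \forall w \near z, ~ A w) -> polar A ->
  (forall z, D z -> ~ A z -> cdiff f z) -> no_holo_ext D A f -> A a -> 0 < q ->
  exists b u (r0 t n : R), r0 <= q /\ singular_center D A f a b u r0 t n.
Proof.
move=> oD AD Acl pA df nf Aa q0.
have [r0 [u [/andP[r00 r0q] dD su nu uA]]] := polar_local pA Aa oD (AD a Aa) q0.
have r04 : 0 < r0 / 4 by rewrite divr_gt0.
have [s1 s10 [_ lb1]] := circle_lower_bound r04.
have [|t [n [st tr4 lbt]]] := lb1 a r0 u a su nu.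
  by rewrite subrr cmod0; (clear - r04; lra).
have t0 : 0 < t by (clear - s10 st; lra).
have t3 : 3 * t < r0 by (clear - tr4 t0; lra).
have tr : t < r0 by (clear - t0 t3; lra).
suff [b bP] : exists b, [/\ A b, cmod (b - a) < t & forall k : R, exists2 rho : R, 0 < rho &
        forall s : R, 0 < s -> s <= rho ->
        exists2 z, [/\ D z, ~ A z & k < cmod (f z)] & cmod (z - b) = s].
  by exists b, u, r0, t, n.
have tA z : cmod (z - a) = t -> ~ A z.
  move=> zt Az; have := lbt z zt; rewrite uA//.
  by rewrite /disk /= zt.
have Ad z : disk a r0 z -> ~ A z -> \forall w \near z, ~ A w by move=> /dD; exact: Acl.
have dfd z : disk a r0 z -> ~ A z -> cdiff f z by move=> /dD; exact: df.
have [M1 fM1] : exists M, forall z, cmod (z - a) = t -> cmod (f z) <= M.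
  apply: bounded_on_circle => z zt; apply: cdiff_cont; apply: dfd; last exact: tA.
  by rewrite /disk /= zt.
pose M0 := Num.max M1 0.
have M00 : 0 <= M0 by rewrite le_max lexx orbT.
have fM0 z : cmod (z - a) = t -> cmod (f z) <= M0 by move=> /fM1; rewrite le_max => ->.
clearbody M0.
(* A bound for [f] inside the circle would let [f] extend across [a]. *)
have unb B : exists z, [/\ cmod (z - a) < t, ~ A z & B < cmod (f z)].
  apply: contrapT => nB.
  have fB z : cmod (z - a) <= t -> ~ A z -> cmod (f z) <= Num.max B M0.
    move=> zt nAz; rewrite le_max; have [zl|zl] := ltP (cmod (z - a)) t.
      rewrite leNgt; apply/orP; left; apply/negP => h; apply: nB; exists z; split => //.
    by apply/orP; right; apply: fM0; apply/le_anti; rewrite zt.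
  have t2 : 0 < t / 2 by (clear - t0; lra).
  have [s2 s20 [s2t lb2]] := circle_lower_bound t2.
  (* As [u a = -oo], the mean values are taken about a nearby [c]. The lower bound [s2] for the
     radius was fixed before [c], so the circle about [c] still encloses [a]. *)
  have [c cs uc] : exists2 c, cmod (c - a) <= s2 / 2 & u c <> -oo%E.
    apply: contrapT => nc; have [z zd uz] := nu; apply: uz.
    apply: (sub_infinite_all su (c := a) (s := s2 / 2)) => //; first by (clear - s20; lra).
    move=> w ws; split; first by rewrite /disk /=; (clear - tr s20 s2t ws; lra).
    by apply: contrapT => uw; apply: nc; exists w.
  have [|r [m [sr rt lbr]]] := lb2 a r0 u c su nu; first by (clear - tr s20 s2t cs; lra).
  have rA z : cmod (z - c) = r -> ~ A z.
    move=> zr Az; have := lbr z zr; rewrite uA//.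
    by rewrite /disk /=; have := cmod_tri c z a; (clear - tr s20 cs sr rt zr; lra).
  have rp : 0 < r by (clear - s20 sr; lra).
  have cr : cmod (c - a) + r < r0 by (clear - tr cs sr rt rp; lra).
  have [|g gP] := removable_singularity su uA Ad rp cr rA uc (M := Num.max B M0) dfd.
    by move=> z zr; apply: fB; have := cmod_tri c z a; (clear - cs sr rt rp zr; lra).
  apply: (nf a Aa); exists (disk c r), g; split => //.
  - exact: open_disk.
  - by rewrite /disk /= cmodB; (clear - cs sr rp; lra).
  - by move=> z zr; apply: dD; move: zr; rewrite /disk /= => zr; have := cmod_tri c z a; (clear - cr zr; lra).
  - by move=> z /gP[dg _]; exact/derivable_cdiff.
  by move=> z /gP[_ ]; apply.
pose N (k : R) := [set z | [/\ cmod (z - a) < t, ~ A z & k < cmod (f z)]].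
(* Levels above the maximum on the circle, so that [unbounded_on_component] applies at each of
   them. *)
pose K (i : nat) : R := M0 + 1 + i%:R.
have Kpos i : 0 < K i by rewrite ltr_wpDr// ltr_wpDl.
have MK i : M0 < K i by rewrite /K -addrA ltrDl ltr_wpDr.
have /choice[nx nxP] : forall iz : nat * C, exists w, N (K iz.1) iz.2 ->
    connected_component (N (K iz.1)) iz.2 w /\ N (K iz.1.+1) w.
  move=> [i z] /=; have [Nz|] := pselect (N (K i) z); last by exists z.
  have [w cw fw] := unbounded_on_component su nu uA Ad dfd t0 tr tA fM0 (K i.+1) (Kpos i) (MK i) Nz.
  by exists w => _; split => //; have [] := connected_component_sub cw.
have [z0 Nz0] : exists z0, N (K 0%N) z0 by exact: unb.
pose zs := fix zs i := if i is j.+1 then nx (j, zs j) else z0.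
have Nzs i : N (K i) (zs i).
  by elim: i => [//|i IH] /=; have [] := nxP (i, zs i) IH.
have NS i j : (i <= j)%N -> N (K j) `<=` N (K i).
  move=> ij z [h1 h2 h3]; split => //; apply: le_lt_trans h3.
  by rewrite lerD2l ler_nat.
have czs i j : (i <= j)%N -> connected_component (N (K i)) (zs i) (zs j).
  elim: j => [|j IH]; first by rewrite leqn0 => /eqP ->; exact: connected_component_refl.
  rewrite leq_eqVlt => /orP[/eqP ->|]; first exact: connected_component_refl.
  rewrite ltnS => ij; apply: connected_component_trans (IH ij) _.
  apply: connected_component_mono (NS i j ij) _.
  by have [] := nxP (j, zs j) (Nzs j).
have [b [bt bcl]] : exists b, cmod (b - a) <= t /\ cluster (zs @ \oo) b.
  have Fz : (zs @ \oo) (cball a t) by exists 0%N => // i _ /=; have [/ltW] := Nzs i.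
  by have [b [bt bcl]] := @compact_cball R a t (zs @ \oo) _ Fz; exists b.
have bP (i : nat) (d : R) : 0 < d -> exists2 j, (i <= j)%N & cmod (zs j - b) < d.
  move=> d0; have [_ [[j ij <-] jd]] : (zs @` [set j | (i <= j)%N]) `&` disk b d !=set0.
    apply: bcl; last exact: (near_cmod b d0).
    by exists i => // j /= ij; exists j.
  by exists j.
have Ab : A b.
  apply: contrapT => nAb.
  have bD : disk a r0 b by rewrite /disk /=; (clear - tr bt; lra).
  have := continuous_at_comp (cdiff_cont (dfd b bD nAb)) (@continuous_cmod R).
  move=> /cont_cmodP/(_ 1 ltr01)[d d0 dP].
  pose i := (Num.truncn (cmod (f b))).+1.
  have ib : cmod (f b) < i%:R by exact: truncnS_gt.
  have [j ij /dP] := bP i d d0; rewrite ltr_norml => hj.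
  have [_ _] := NS i j ij _ (Nzs j).
  by rewrite /K => hi; (clear - M00 ib hj hi; lra).
exists b; split => //.
  by rewrite lt_neqAle bt andbT; apply/eqP => /tA.
move=> k; pose i := Num.truncn `|k|.
have ki : k < K i.
  apply: le_lt_trans (ler_norm k) _; apply: lt_le_trans (truncnS_gt _) _.
  by rewrite -natr1 /K -/i; (clear - M00; lra).
(* Every [zs j] with [j >= i] is joined to [zs i] at the level [K i > k]; hence the distance from
   [zs i] to [b] serves as the radius bound for [k]. *)
have zb : zs i <> b by move=> E; have [_] := Nzs i; rewrite E.
exists (cmod (zs i - b)).
  by rewrite cmod_gt0 subr_eq0; apply/eqP.
move=> s s0 si; have [j ij js] := bP i s s0.
have [Y [Yi YN cY] Yj] := czs i j ij.
have [|v Yv vs] := connected_meets_sphere cY Yj Yi (b := b) (s := s).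
  by rewrite si (ltW js).
exists v => //; have [vt nAv kv] := YN v Yv; split => //.
  by apply: dD; rewrite /disk /=; (clear - tr vt; lra).
exact: lt_trans kv.
Qed.

End Center.

(** * Continuous plurisubharmonic functions of two variables *)

Section Plurisub.
Variable R : realType.
Local Notation C := (CC R).
Implicit Types (z w a c : C) (p q : C * C) (V W : C * C -> R) (g h : C -> R) (f : C -> C).

Lemma near_continuous_eq (T : topologicalType) (g h : T -> R) (x : T) :
  (\forall y \near x, {for y, continuous h}) -> (\forall y \near x, h y = g y) ->
  \forall y \near x, {for y, continuous g}.
Proof.
move=> ch /near_join hg; apply: filterS2 ch hg => y cy hy.
suff : g @ y --> h y by rewrite (nbhs_singleton hy).
by apply: cvg_trans cy; apply: near_eq_cvg; apply: filterS hy => t ->.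
Qed.

Lemma continuous_at_compT (T S U : topologicalType) (F : T -> S) (G : S -> U) (x : T) :
  {for x, continuous F} -> {for F x, continuous G} -> {for x, continuous (fun t => G (F t))}.
Proof. exact: continuous_comp. Qed.

(** The radius in the submean inequality may depend on the direction. The point [l] of a line is
    treated by moving the base point there, so parameter [0] suffices. *)
Definition plh V p := (\forall q \near p, {for q, continuous V}) /\
  forall b : C * C, smv (fun l => V (line2 p b l)) 0.

Lemma continuous_line2 p b : continuous (line2 p b).
Proof.
have caff (x y : C) l : {for l, continuous (fun l : C => x + l * y)}.
  have -> : (fun l => x + l * y) = (fun l => x + y * l) by apply/funext => v; rewrite mulrC.
  exact: continuous_affine.
by move=> l; exact: (cvg_pair (caff p.1 b.1 l) (caff p.2 b.2 l)).
Qed.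

Lemma line2_0 p b : line2 p b 0 = p.
Proof. by case: p => x y; rewrite /line2 !mul0r !addr0. Qed.

Lemma line2_line2 p b l m : line2 (line2 p b l) b m = line2 p b (l + m).
Proof. by rewrite /line2 /= !mulrDl !addrA. Qed.

Lemma near_line2 (P : C * C -> Prop) p b l : (\forall q \near line2 p b l, P q) ->
  \forall m \near l, P (line2 p b m).
Proof. exact: continuous_line2. Qed.

Lemma continuous_restrict_line V p b l : {for line2 p b l, continuous V} ->
  {for l, continuous (fun l => V (line2 p b l))}.
Proof. by move=> cV; have cl := @continuous_line2 p b l; have := continuous_at_compT cl cV. Qed.

Lemma plh_line V p b : plh V p -> shl (fun l => V (line2 p b l)) 0.
Proof.
move=> [cV mV]; split => //.
rewrite -(line2_0 p b) in cV; apply: filterS (near_line2 cV) => l cl.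
exact: continuous_restrict_line.
Qed.

Lemma plh_lineP V p : (\forall q \near p, {for q, continuous V}) ->
  (forall b, shl (fun l => V (line2 p b l)) 0) -> plh V p.
Proof. by move=> cV lV; split => // b; have [] := lV b. Qed.

Lemma plh_shl_line V p b l : plh V (line2 p b l) -> shl (fun m => V (line2 p b m)) l.
Proof.
move=> hV; split.
  apply: filterS (near_line2 hV.1) => m cm.
  exact: continuous_restrict_line.
have [rho rho0 rP] := hV.2 b; exists rho => // r r0 rr.
have := rP r r0 rr; rewrite line2_0; congr (_ <= avg _).
by apply/funext => t; rewrite add0r line2_line2.
Qed.

Lemma plh_at V p : plh V p -> {for p, continuous V}.
Proof. by case=> /nbhs_singleton. Qed.

Lemma plh_dom V W p : plh W p -> (\forall q \near p, {for q, continuous V}) ->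
  (\forall q \near p, W q <= V q) -> V p <= W p -> plh V p.
Proof.
move=> hW cV WV VW; apply: plh_lineP => // b.
have cVl : cnear (fun l => V (line2 p b l)) 0.
  rewrite -(line2_0 p b) in cV; apply: filterS (near_line2 cV) => l cl.
  exact: continuous_restrict_line.
apply: shl_dom (plh_line b hW) cVl _ _; last by rewrite line2_0.
by rewrite -(line2_0 p b) in WV; exact: near_line2 WV.
Qed.

Lemma plh_near V W p : plh W p -> (\forall q \near p, W q = V q) -> plh V p.
Proof.
move=> hW WV; apply: (plh_dom hW).
- exact: near_continuous_eq hW.1 WV.
- by apply: filterS WV => q ->.
by rewrite (nbhs_singleton WV).
Qed.

Lemma plhD V W p : plh V p -> plh W p -> plh (fun q => V q + W q) p.
Proof.
move=> hV hW; apply: plh_lineP.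
  by apply: filterS2 hV.1 hW.1 => q; exact: contD.
by move=> b; exact: (shlD (plh_line b hV) (plh_line b hW)).
Qed.

Lemma plhZ (k : R) V p : 0 <= k -> plh V p -> plh (fun q => k * V q) p.
Proof.
move=> k0 hV; apply: plh_lineP.
  by apply: filterS hV.1 => q; exact: contZ.
by move=> b; exact: (shlZ k0 (plh_line b hV)).
Qed.

Lemma plh_max V W p : plh V p -> plh W p -> plh (fun q => Num.max (V q) (W q)) p.
Proof.
move=> hV hW; apply: plh_lineP.
  by apply: filterS2 hV.1 hW.1 => q; exact: continuous_max.
by move=> b; exact: (shl_max (plh_line b hV) (plh_line b hW)).
Qed.

Lemma plh_cst (k : R) p : plh (fun=> k) p.
Proof.
apply: plh_lineP => [|b]; last exact: shl_cst.
by apply: filterS (@filterT _ (nbhs p) _) => q _; exact: cst_continuous.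
Qed.

(** A complex factor [b] scales the radius by its modulus and rotates the circle, which the mean
    does not see. *)
Lemma shl_affine g z (b : C) : shl g z -> shl (fun l => g (z + l * b)) 0.
Proof.
move=> [cg [rho rho0 rP]].
have E : (fun l => g (z + l * b)) = (fun l => g (z + b * l)).
  by apply/funext => l; rewrite mulrC.
rewrite E; split.
  have cg' : \forall w \near z + b * 0, {for w, continuous g} by rewrite mulr0 addr0.
  have H : \forall l \near 0, {for z + b * l, continuous g} := @continuous_affine R z b 0 _ cg'.
  apply: filterS H => l cl.
  by have := continuous_at_compT (@continuous_affine R z b l) cl.
have [->|b0] := eqVneq b 0.
  exists 1 => // r _ _; have -> : (fun t => g (z + 0 * (0 + rc r * cis t))) = fun=> g z.
    by apply/funext => t; rewrite mul0r addr0.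
  by rewrite avg_cst !mul0r addr0.
have b1 : 0 < cmod b by rewrite cmod_gt0.
have [r1 r10 cg1] := cnear_circ cg.
exists (Num.min rho r1 / cmod b); first by rewrite divr_gt0// lt_min rho0.
move=> r r0; rewrite ltr_pdivlMr// lt_min => /andP[rr rr1]; rewrite mulr0 addr0.
have [s /andP[s0 _] bE] := polar_form b.
have rb0 : 0 < r * cmod b by rewrite mulr_gt0.
apply: le_trans (rP _ rb0 rr) _.
pose G t := g (z + rc (r * cmod b) * cis t).
have cG : continuous G by apply: cg1; rewrite cmod_rc gtr0_norm.
have pG t : G (t + 2 * pi) = G t by rewrite /G cis2pi.
rewrite -(avg_shift_ge0 s0 cG pG).
have -> : (fun t => g (z + b * (0 + rc r * cis t))) = fun t => G (t + s); last exact: lexx.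
by apply/funext => t; rewrite /G add0r cisD {1}bE rcM; congr g; ring.
Qed.

Lemma continuous_fstC q : {for q, continuous (fun q : C * C => q.1)}.
Proof. exact: cvg_fst. Qed.

Lemma continuous_sndC q : {for q, continuous (fun q : C * C => q.2)}.
Proof. exact: cvg_snd. Qed.

Lemma near_fst (P : C -> Prop) p : (\forall z \near p.1, P z) -> \forall q \near p, P q.1.
Proof. exact: (@cvg_fst _ _ (nbhs p.1) (nbhs p.2) _). Qed.

Lemma near_snd (P : C -> Prop) p : (\forall z \near p.2, P z) -> \forall q \near p, P q.2.
Proof. exact: (@cvg_snd _ _ (nbhs p.1) (nbhs p.2) _). Qed.

Lemma near_pS (P Q : C * C -> Prop) p : (forall q, P q -> Q q) ->
  (\forall q \near p, P q) -> \forall q \near p, Q q.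
Proof. by move=> PQ; apply: filterS. Qed.

Lemma plh_fst g p : shl g p.1 -> plh (fun q => g q.1) p.
Proof.
move=> sg; apply: plh_lineP => [|b]; last exact: shl_affine.
apply: near_pS (near_fst sg.1) => q cq.
by have := continuous_at_compT (@continuous_fstC q) cq.
Qed.

Lemma plh_snd g p : shl g p.2 -> plh (fun q => g q.2) p.
Proof.
move=> sg; apply: plh_lineP => [|b]; last exact: shl_affine.
apply: near_pS (near_snd sg.1) => q cq.
by have := continuous_at_compT (@continuous_sndC q) cq.
Qed.

Lemma plh_ln_graph f p (c : R) : hnear f p.1 -> 0 < c ->
  plh (fun q => ln (Num.max (cmod (q.2 - f q.1)) c)) p.
Proof.
move=> hf c0; apply: plh_lineP => [|b].
  have cf : \forall q \near p, {for q, continuous (fun q => f q.1)}.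
    by apply: near_pS (near_fst (hnear_cont hf)) => q cq; have := continuous_at_compT (@continuous_fstC q) cq.
  apply: near_pS cf => q cq.
  have cd : {for q, continuous (fun q : C * C => q.2 - f q.1)} 
    by have cs := @continuous_sndC q; exact: (@continuousB (CC R) (CC R)^o _ _ _ q cs cq).
  have cm : {for q, continuous (fun q : C * C => Num.max (cmod (q.2 - f q.1)) c)}.
    apply: cont_max; last exact: cst_continuous.
    by have := continuous_at_compT cd (@continuous_cmod R _).
  have mc : 0 < Num.max (cmod (q.2 - f q.1)) c by rewrite lt_max c0 orbT.
  by have := continuous_at_compT cm (continuous_ln mc).
apply: (shl_ln_max (F := fun l => (p.2 + l * b.2) - f (p.1 + l * b.1))) => //.
have cl : {for 0 : C, continuous (fun l : C => p.1 + l * b.1)}.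
  have -> : (fun l => p.1 + l * b.1) = (fun l => p.1 + b.1 * l).
    by apply/funext => v; rewrite mulrC.
  exact: continuous_affine.
have hf' : \forall w \near p.1 + 0 * b.1, cdiff f w by rewrite mul0r addr0.
have hfl : \forall l \near 0, cdiff f (p.1 + l * b.1) := cl _ hf'.
apply: filterS hfl => l fl.
apply: cdiffB.
  have -> : (fun l => p.2 + l * b.2) = (fun l => id (p.2 + b.2 * l)).
    by apply/funext => v; rewrite mulrC.
  by apply: (@cdiff_affine R id); exact: cdiff_id.
have -> : (fun l => f (p.1 + l * b.1)) = (fun l => f (p.1 + b.1 * l)).
  by apply/funext => v; rewrite mulrC.
by apply: (@cdiff_affine R f); rewrite mulrC.
Qed.

End Plurisub.

(** * A plurisubharmonic exhaustion of the cylinder over the domain *)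

Section Exhaustion.
Variable R : realType.
Local Notation C := (CC R).
Implicit Types (z w : C) (p q : C * C).
Variable D : set C.
Hypothesis oD : open D.

Definition bdist z : R := inf [set cmod (z - y) | y in ~` D].

Let has_lb z : has_lbound [set cmod (z - y) | y in ~` D].
Proof. by exists 0 => _ [y _ <-]; exact: cmod_ge0. Qed.

Lemma bdist_le z y : ~ D y -> bdist z <= cmod (z - y).
Proof. by move=> nDy; apply: ge_inf; [exact: has_lb|exists y]. Qed.

Lemma bdist_ge z y0 (m : R) : ~ D y0 -> (forall y, ~ D y -> m <= cmod (z - y)) -> m <= bdist z.
Proof.
by move=> nD H; apply: lb_le_inf; [exists (cmod (z - y0)), y0|move=> _ [y Dy <-]; exact: H].
Qed.

Lemma bdist_lip z w y0 : ~ D y0 -> bdist w <= bdist z + cmod (w - z).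
Proof.
move=> nD; rewrite -lerBlDr; apply: (bdist_ge nD) => y Dy.
by have := bdist_le w Dy; have := cmod_tri z w y; lra.
Qed.

Lemma continuous_bdist z y0 : ~ D y0 -> {for z, continuous bdist}.
Proof.
move=> nD; apply/cont_cmodP => e e0; exists e => // w wz; rewrite ltr_norml.
have := bdist_lip z w nD; have := bdist_lip w z nD; rewrite (cmodB z w); lra.
Qed.

Lemma bdist_attained z y0 : ~ D y0 -> exists2 y, ~ D y & bdist z = cmod (z - y).
Proof.
move=> nD; pose K := cball z (cmod (z - y0)) `&` ~` D.
have cK : compact K.
  apply: (subclosed_compact _ (@compact_cball R z (cmod (z - y0)))) => //; last exact: subIsetl.
  apply: closedI; first exact: closed_cball.
  exact: open_closedC.
have [||y [_ nDy] yP] := @usc_attains_max R K (fun y => - cmod (z - y)) cK.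
- by exists y0; split => //; rewrite /cball /= (cmodB y0).
- move=> y c Ky yc; have e0 : 0 < c + cmod (z - y) by lra.
  apply: filterS (near_cmod y e0) => w wy _.
  by have := cmod_tri w z y; rewrite (cmodB w y) in wy *; lra.
exists y => //; apply/le_anti; rewrite bdist_le//=.
apply: (bdist_ge nD) => w nDw.
have [wz|wz] := leP (cmod (z - w)) (cmod (z - y0)).
  by rewrite -lerN2; apply: yP; split => //; rewrite /cball /= (cmodB w).
apply: le_trans (ltW wz); rewrite -lerN2; apply: yP; split => //.
by rewrite /cball /= (cmodB y0).
Qed.

Lemma bdist_gt0 z y0 : ~ D y0 -> D z -> 0 < bdist z.
Proof.
move=> nD Dz; have [y nDy ->] := bdist_attained z nD.
by rewrite cmod_gt0 subr_eq0; apply/negP => /eqP E; apply: nDy; rewrite -E.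
Qed.

Lemma bdist0 z : ~ D z -> bdist z = 0.
Proof.
move=> nD; apply/le_anti/andP; split.
  by have := bdist_le z nD; rewrite subrr cmod0.
by apply: (bdist_ge nD) => y _; exact: cmod_ge0.
Qed.

Lemma near_open z : D z -> \forall w \near z, D w.
Proof. by move=> Dz; apply: open_nbhs_nbhs; split. Qed.

(* When [D] is the whole plane [bdist] is [inf set0 = 0], so its inverse is [0] too. *)
Lemma shl_bdistV z : D z -> shl (fun w => (bdist w)^-1) z.
Proof.
move=> Dz; have [[y0 nD]|allD] := pselect (exists y, ~ D y); last first.
  have -> : (fun w => (bdist w)^-1) = fun=> 0; last exact: shl_cst.
  apply/funext => w; rewrite /bdist; have -> : [set cmod (w - y) | y in ~` D] = set0.
    by apply/seteqP; split => // x [y nD]; case: allD; exists y.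
  by rewrite inf0 invr0.
have [y nDy yE] := bdist_attained z nD.
have zy : z - y != 0 by rewrite subr_eq0; apply/eqP => E; apply: nDy; rewrite -E.
have H : shl (fun w => cmod ((w - y)^-1)) z.
  by apply: shl_cmod; apply: hnear_inv; [exact: hnear_sub|].
apply: (shl_dom H).
- apply: filterS (near_open Dz) => w Dw.
  have cw := continuous_bdist (z := w) nD.
  have bw : bdist w != 0 by rewrite gt_eqF// (bdist_gt0 nD).
  exact: (cvgV bw cw).
- apply: filterS (near_open Dz) => w Dw.
  have bw := bdist_gt0 nD Dw; have wy := bdist_le w nDy.
  by rewrite cmodV lef_pV2 ?posrE//; exact: lt_le_trans wy.
by rewrite cmodV yE.
Qed.

(** Continuous and plurisubharmonic over [D]; its sublevel sets there lie in products of a compact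
    part of [D] with a closed disk. *)
Definition exh p := Num.max (Num.max (cmod p.1) (cmod p.2)) (bdist p.1)^-1.

Lemma plh_exh p : D p.1 -> plh exh p.
Proof.
move=> Dp; have sc z : shl (@cmod R) z.
  by apply: (@shl_cmod R id); apply: near_all => w; exact: cdiff_id.
apply: plh_max; last by apply: (plh_fst (g := fun z => (bdist z)^-1)); exact: shl_bdistV.
by apply: plh_max; [apply: (plh_fst (g := @cmod R))|apply: (plh_snd (g := @cmod R))].
Qed.

(** The condition [D z] is not implied by the last one: off [D] the distance is zero and so is its
    inverse. *)
Definition core (m : R) := [set z | [/\ D z, cmod z <= m & (bdist z)^-1 <= m]].

Lemma exh_core p m : D p.1 -> exh p <= m -> core m p.1 /\ cmod p.2 <= m.
Proof. by move=> Dp; rewrite /exh !ge_max => /andP[/andP[h1 h2] h3]. Qed.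

Lemma closed_core m : 0 < m -> closed (core m).
Proof.
move=> m0.
rewrite -[X in closed X]setCK; apply: open_closedC.
rewrite openE => z /= nz; rewrite /interior.
have [zm|zm] := ltP m (cmod z).
  have e0 : 0 < cmod z - m by lra.
  apply: filterS (near_cmod z e0) => w wz [_ wm _].
  by have := cmod_tri w z 0; rewrite !subr0 (cmodB z w); lra.
have [[y0 nD]|allD] := pselect (exists y, ~ D y); last first.
  have Dz w : D w by apply: contrapT => nD; apply: allD; exists w.
  exfalso; apply: nz; split => //.
  rewrite /bdist; have -> : [set cmod (z - y) | y in ~` D] = set0.
    by apply/seteqP; split => // x [y nD]; case: allD; exists y.
  by rewrite inf0 invr0 ltW.
have zb : bdist z < m^-1.
  have [Dz|/bdist0 ->] := pselect (D z); last by rewrite invr_gt0.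
  rewrite ltNge; apply/negP => h; apply: nz; split => //.
  by rewrite -[m]invrK lef_pV2 ?posrE ?invr_gt0 ?(bdist_gt0 nD).
have e0 : 0 < m^-1 - bdist z by lra.
apply: filterS (near_cmod z e0) => w wz [Dw _ wm].
have bw := bdist_gt0 nD Dw.
have : m^-1 <= bdist w by rewrite -[bdist w]invrK lef_pV2 ?posrE ?invr_gt0.
by have := bdist_lip z w nD; lra.
Qed.

Lemma compact_core m : 0 < m -> compact (core m).
Proof.
move=> m0; apply: (subclosed_compact (closed_core m0) (@compact_cball R 0 m)).
by move=> z [_ zm _]; rewrite /cball /= subr0.
Qed.

End Exhaustion.

(** * The glued plurisubharmonic function *)

Section Glue.
Variable R : realType.
Local Notation C := (CC R).
Implicit Types (z w : C) (p q : C * C).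
Variables (D A : set C) (f : C -> C) (b : C) (m e eta r dl S c tau : R) (B P : C -> R).
Let M := m + 2.
Let O := [set z | [/\ D z, ~ A z & M + 2 < cmod (f z)]].
Let N p := c * ln (Num.max (cmod (p.2 - f p.1)) tau).
(** The barrier, cut at its useful value [-1] and lowered by [2 e], so that it is strictly negative
    when competing with [N]. *)
Let s z := Num.max (B z) (-1) - 2 * e.
Let G := [set p : C * C | core D M p.1 /\ cmod p.2 <= M].
Hypotheses (oD : open D) (Acl : forall z, D z -> ~ A z -> \forall w \near z, ~ A w)
  (df : forall z, D z -> ~ A z -> cdiff f z)
  (e0 : 0 < e) (e1 : e <= 1) (dl0 : 0 < dl) (c0 : 0 < c) (tau0 : 0 < tau)
  (shB : forall z, ~ O z -> shl B z) (B0 : forall z, ~ O z -> B z <= 0)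
  (Beta : forall z, ~ O z -> cmod (z - b) = eta -> - e <= B z)
  (Br : forall z, ~ O z -> r <= cmod (z - b) -> B z <= -1)
  (shP : forall z, shl P z)
  (Peta : forall z, cmod (z - b) = eta -> [/\ ~ A z, - e <= dl * P z & - S < P z])
  (PnA : forall z, core D M z -> - S <= P z -> ~ A z)
  (Ne : forall p, G p -> - S <= P p.1 -> N p <= e)
  (PM : forall z, core D M z -> dl * P z <= e)
  (dlS : 23 <= dl * S) (ctau : c * ln tau <= -4) (eta0 : 0 < eta) (etar : eta <= r).

(** On [O] the masses make [s] meaningless and [N] stands alone. For [cmod p.2 <= M] one has
    [N >= 0 > s] near the edge of [O], since [f p.1] has modulus at least [M + 2] there: the switch
    is invisible. *)
Let ug p := if `[< O p.1 >] then N p else Num.max (N p) (s p.1).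

Let ugO p : O p.1 -> ug p = N p.
Proof. by rewrite /ug; case: asboolP. Qed.

Let ugnO p : ~ O p.1 -> ug p = Num.max (N p) (s p.1).
Proof. by rewrite /ug; case: asboolP. Qed.

Let s_le z : ~ O z -> s z <= - (2 * e).
Proof. by move=> nO; rewrite /s gerDr ge_max B0//= lerN10. Qed.

Let hf z : D z -> ~ A z -> hnear f z.
Proof.
by move=> Dz nA; apply: filterS2 (near_open oD Dz) (Acl Dz nA) => w; exact: df.
Qed.

Let plhN p : D p.1 -> ~ A p.1 -> plh N p.
Proof. by move=> Dp nA; apply: (plhZ (ltW c0)); apply: plh_ln_graph => //; exact: hf. Qed.

Let N_ge0 p : 1 <= cmod (p.2 - f p.1) -> 0 <= N p.
Proof.
by move=> h; apply: mulr_ge0; [exact: ltW|apply: ln_ge0; rewrite le_max h].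
Qed.

Let far p : cmod p.2 <= M -> M + 2 <= cmod (f p.1) -> 2 <= cmod (p.2 - f p.1).
Proof.
by move=> h1 h2; have := cmod_tri p.2 (f p.1) 0; rewrite !subr0 (cmodB (f p.1)); lra.
Qed.

Let plh_ug p : G p -> ~ A p.1 -> plh ug p.
Proof.
move=> [cp pM] nA; have Dp : D p.1 by case: cp.
have cf := cdiff_cont (df Dp nA).
have ccf : {for p.1, continuous (fun z => cmod (f z))}.
  by have := continuous_at_compT cf (@continuous_cmod R _).
have [fk|fk] := ltP (cmod (f p.1)) (M + 2).
  have nO : ~ O p.1 by move=> [_ _]; lra.
  have ss : shl s p.1.
    apply: shlD; last exact: shl_cst.
    by apply: shl_max; [exact: shB|exact: shl_cst].
  apply: (plh_near (plh_max (plhN Dp nA) (plh_fst ss))).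
  have e2 : 0 < M + 2 - cmod (f p.1) by lra.
  have near1 : \forall z \near p.1, ~ O z.
    have /cont_cmodP/(_ _ e2)[d d0 dP] := ccf.
    by apply: filterS (near_cmod p.1 d0) => z /dP; rewrite ltr_norml => h [_ _]; lra.
  by apply: near_pS (near_fst near1) => q /ugnO ->.
apply: (plh_near (plhN Dp nA)).
have cd : {for p, continuous (fun q : C * C => cmod (q.2 - f q.1))}.
  have c1 := continuous_at_compT (@continuous_fstC R p) cf; have c2 := @continuous_sndC R p.
  have c3 : {for p, continuous (fun q : C * C => q.2 - f q.1)}.
    by exact: (@continuousB (CC R) (CC R)^o _ _ _ p c2 c1).
  by have := continuous_at_compT c3 (@continuous_cmod R _).
have gt1 : 1 < cmod (p.2 - f p.1) by have := far pM fk; lra.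
have near2 : \forall q \near p, 1 < cmod (q.2 - f q.1).
  exact: (cd _ (lt_nbhsr gt1)).
apply: near_pS near2 => q q1; have [Oq|nOq] := pselect (O q.1); first by rewrite ugO.
rewrite ugnO// max_l//; apply: le_trans (s_le nOq) _.
by have := N_ge0 (ltW q1); have := e0; lra.
Qed.

(** The level replacing the function near [A]: slightly negative inside the small circle, so that
    the fibre over [b] stays finite, and far below [-1] outside, so as not to spoil the estimate on
    the graph. *)
Let cut z : R := if cmod (z - b) < eta then - (6 * e) else -20.

Let cut_le z : cut z <= - (6 * e).
Proof. by rewrite /cut; case: ifP => _ //; have := e1; lra. Qed.

(** Where [P = - S] the sum is at most [e - 23 < -20], below either level. Hence the level takes
    over before [A] is reached, where [ug] is not controlled. *)
Let cutoff p := if P p.1 < - S then cut p.1 else Num.max (ug p + dl * P p.1) (cut p.1).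

Let ug_le p : G p -> - S <= P p.1 -> ug p <= e.
Proof.
move=> Gp hP; have NE := Ne Gp hP.
have [Op|nOp] := pselect (O p.1); first by rewrite ugO.
by rewrite ugnO// ge_max NE /=; have := s_le nOp; have := e0; lra.
Qed.

Let plhP p : plh (fun q => dl * P q.1) p.
Proof. by apply: (plhZ (ltW dl0)); exact: (plh_fst (shP p.1)). Qed.

Let near_lt (V : C * C -> R) p (x : R) : {for p, continuous V} -> V p < x ->
  \forall q \near p, V q < x.
Proof. by move=> cV h; exact: (cV _ (lt_nbhsl h)). Qed.

Let near_gt (V : C * C -> R) p (x : R) : {for p, continuous V} -> x < V p ->
  \forall q \near p, x < V q.
Proof. by move=> cV h; exact: (cV _ (lt_nbhsr h)). Qed.

Let cP p : {for p, continuous (fun q : C * C => P q.1)}.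
Proof. by have := continuous_at_compT (@continuous_fstC R p) (shl_at (shP p.1)). Qed.

Let cdist p : {for p, continuous (fun q : C * C => cmod (q.1 - b))}.
Proof. by have := continuous_at_compT (@continuous_fstC R p) (@continuous_dist R b p.1). Qed.

Let plh_cutoff_const p (k : R) : G p -> -20 <= k -> (\forall q \near p, cut q.1 = k) ->
  plh cutoff p.
Proof.
move=> Gp k20 ck; have [Pl|Pg] := ltP (P p.1) (- S).
  apply: (plh_near (plh_cst k p)).
  have nP := near_lt (@cP p) Pl.
  by apply: filterS2 nP ck => q h <-; rewrite /cutoff h.
have nA := PnA Gp.1 Pg; have sum := plhD (plh_ug Gp nA) (plhP p).
apply: (plh_near (plh_max sum (plh_cst k p))).
have [Pg'|Pl] := ltP (- S) (P p.1).
  have nP := near_gt (@cP p) Pg'.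
  by apply: filterS2 nP ck => q h <-; rewrite /cutoff ltNge ltW.
have PS : P p.1 = - S by apply/le_anti; rewrite Pl.
have small : ug p + dl * P p.1 < k.
  by have := ug_le Gp Pg; have := dlS; have := e1; rewrite PS mulrN; lra.
have nP := near_lt (plh_at sum) small.
by apply: filterS2 nP ck => q /ltW h cq; rewrite /cutoff cq; case: ifP => _; rewrite max_r.
Qed.

(** Away from the circle of radius [eta] the level is locally constant. On that circle the sum is at
    least [- 3 e - e], above [- 6 e], so the jump of [cut] goes unnoticed. *)
Let plh_cutoff p : G p -> plh cutoff p.
Proof.
move=> Gp; have [|] := ltP (cmod (p.1 - b)) eta => [pl|pg].
  apply: (plh_cutoff_const (k := - (6 * e)) Gp); first by have := e1; lra.
  by apply: near_pS (near_lt (@cdist p) pl) => q h; rewrite /cut h.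
have [pe|pn] := eqVneq (cmod (p.1 - b)) eta; last first.
  have pg' : eta < cmod (p.1 - b) by rewrite lt_neqAle eq_sym pn.
  apply: (plh_cutoff_const (k := -20) Gp); first by [].
  by apply: near_pS (near_gt (@cdist p) pg') => q h; rewrite /cut ltNge ltW.
have [nA Pe PS] := Peta pe; have sum := plhD (plh_ug Gp nA) (plhP p).
apply: (plh_near sum).
have ug3 : - (3 * e) <= ug p.
  have [[Dp _ fp]|nOp] := pselect (O p.1).
    rewrite ugO//; have := N_ge0 (p := p); have := far Gp.2 (ltW fp); have := e0.
    by move=> e0' h /(_ ltac:(lra)); lra.
  rewrite ugnO// le_max; apply/orP; right; rewrite /s.
  have : B p.1 <= Num.max (B p.1) (-1) by rewrite le_max lexx.
  by have := Beta nOp pe; lra.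
have big : - (6 * e) < ug p + dl * P p.1 by have := e0; lra.
apply: filterS2 (near_gt (plh_at sum) big) (near_gt (@cP p) PS) => q h1 h2.
rewrite /cutoff ltNge (ltW h2) /= max_l//.
by apply: le_trans (cut_le q.1) _; exact: ltW.
Qed.

Let cutoff_le p : G p -> cutoff p <= 2 * e.
Proof.
move=> Gp; have := cut_le p.1; have := e0; have := e1 => e1' e0' cl.
rewrite /cutoff; case: ltP => h; first by lra.
by rewrite ge_max; apply/andP; split; [have := ug_le Gp h; have := PM Gp.1|]; lra.
Qed.

Let rho := exh D.

(** Subtracting [2 e] makes the cutoff function nonpositive; [rho - (m + 1)] is positive for
    [rho > m + 1] and extends it beyond the compact part [rho < m + 2]. *)
Definition glued p := if rho p < M then Num.max (cutoff p - 2 * e) (rho p - (m + 1))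
  else rho p - (m + 1).

Let GM p : D p.1 -> rho p < M -> G p.
Proof. by move=> Dp /ltW h; exact: exh_core. Qed.

Let near_D p : D p.1 -> \forall q \near p, D q.1.
Proof. by move=> Dp; exact: near_fst (near_open oD Dp). Qed.

Lemma glued_plh p : D p.1 -> plh glued p.
Proof.
move=> Dp; have prho : plh (fun q => rho q - (m + 1)) p.
  by apply: plhD; [exact: plh_exh|exact: plh_cst].
have crho := plh_at (plh_exh oD Dp).
have [h|h] := ltP (rho p) M.
  have pc : plh (fun q => cutoff q - 2 * e) p.
    by apply: plhD; [apply: plh_cutoff; exact: GM|exact: plh_cst].
  apply: (plh_near (plh_max pc prho)).
  by apply: near_pS (near_lt crho h) => q hq; rewrite /glued hq.
apply: (plh_near prho).
have h1 : m + 1 < rho p by move: h; rewrite /M; lra.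
apply: filterS2 (near_gt crho h1) (near_D Dp) => q hq Dq.
rewrite /glued; case: ltP => // hM; rewrite max_r//.
by have := cutoff_le (GM Dq hM); move: hq; rewrite /rho; lra.
Qed.

Lemma glued_le0 p : D p.1 -> exh D p <= m + 1 -> glued p <= 0.
Proof.
move=> Dp h; rewrite /glued; case: ltP => hM; last by rewrite /rho; lra.
by rewrite ge_max; apply/andP; split; [have := cutoff_le (GM Dp hM)|rewrite /rho]; lra.
Qed.

Lemma glued_graph z : D z -> ~ A z -> exh D (z, f z) < m -> r <= cmod (z - b) ->
  glued (z, f z) <= -1.
Proof.
move=> Dz nA hm rz; have hM : rho (z, f z) < M by rewrite /M /rho; lra.
have Gz := GM (p := (z, f z)) Dz hM; have [/= cz fM] := Gz.
have nO : ~ O z by move=> [_ _]; lra.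
rewrite /glued hM ge_max; apply/andP; split; last by rewrite /rho; lra.
have ug1 : ug (z, f z) <= -1 - 2 * e.
  rewrite ugnO//= ge_max; apply/andP; split.
    by rewrite /N /= subrr cmod0 max_r ?(ltW tau0)//; have := ctau; have := e1; lra.
  by rewrite /s /= lerD2r ge_max lexx andbT; exact: Br.
have c20 : cut z = -20.
  by rewrite /cut ltNge (le_trans etar rz).
have := e0; have := e1; rewrite /cutoff /= c20 => e1' e0'.
case: ifP => _; first by lra.
rewrite lerBlDr ge_max; apply/andP; split; last by lra.
by have := PM cz; lra.
Qed.

(** The [8] is the level [6 e] of the cutoff at [b] plus the shift [2 e]. *)
Lemma glued_center w : D b -> - (8 * e) <= glued (b, w).
Proof.
move=> Db; rewrite /glued; have e0' := e0; case: ltP => hM; last by move: hM; rewrite /M; lra.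
rewrite le_max; apply/orP; left.
have cb : cut b = - (6 * e) by rewrite /cut subrr cmod0 eta0.
rewrite /cutoff /= cb; case: ifP => _; first by lra.
by rewrite lerBrDr le_max; apply/orP; right; lra.
Qed.

End Glue.

(** * Choice of the constants for one approximant *)

Section Approximant.
Variable R : realType.
Local Notation C := (CC R).
Implicit Types (z w : C) (p : C * C).
Implicit Types (D A : set C) (f : C -> C) (a b : C) (u : C -> \bar R).

Lemma compact_coreI D A (M : R) : open D ->
  (forall z, D z -> ~ A z -> \forall w \near z, ~ A w) -> 0 < M -> compact (core D M `&` A).
Proof.
move=> oD Acl M0; apply: (subclosed_compact _ (compact_core oD M0)); last exact: subIsetl.
rewrite -[X in closed X]setCK; apply: open_closedC.
rewrite openE => z /= nz; rewrite /interior.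
have [cz|ncz] := pselect (core D M z).
  have nA : ~ A z by move=> Az; apply: nz.
  by apply: filterS (Acl z (let: And3 h _ _ := cz in h) nA) => w nAw [_].
have : \forall w \near z, ~ core D M w.
  apply: open_nbhs_nbhs; split => //.
  by apply: closed_openC; exact: closed_core.
by apply: filterS => w ncw [].
Qed.

(** The sum of a local potential for the part of [A] in the disk about [a] and of [away_potential]
    for the rest. Near [b] the second is nonnegative, so the lower bound of [u] on a small circle
    about [b] bounds the sum below. The bounds [K] and [L] precede [T]. *)
Lemma center_potential D A f a b u (r0 t n M q : R) : open D -> A `<=` D ->
  (forall z, D z -> ~ A z -> \forall w \near z, ~ A w) -> polar A ->
  singular_center D A f a b u r0 t n -> 0 < M -> 0 < q ->
  exists eta K L : R, [/\ 0 < eta, eta <= q, 0 <= K, 0 <= L &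
   (forall z, cmod (z - b) = eta -> ~ A z) /\
   forall T : R, 0 <= T -> exists P : C -> R,
    [/\ (forall z, shl P z),
        (forall z, core D M z -> A z -> \forall w \near z, P w <= - T),
        (forall z, core D M z -> P z <= K) &
        (forall z, cmod (z - b) = eta -> - L <= P z)]].
Proof.
move=> oD AD Acl pA [[dD su nu uA] [[t0 tr un] [_ bt _]]] M0 q0.
have Ad z : disk a r0 z -> ~ A z -> \forall w \near z, ~ A w by move=> /dD; exact: Acl.
have [K0 [K00 _ loc]] := local_potential su uA Ad t0 tr un.
pose d := (t - cmod (b - a)) / 2; have d0 : 0 < d by rewrite /d; (clear - bt; lra).
have dE : 2 * d = t - cmod (b - a) by rewrite /d; (clear; lra).
clearbody d.
pose X := core D M `&` A `&` [set z | t <= cmod (z - a)].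
have cX : compact X.
  apply: (subclosed_compact _ (compact_coreI oD Acl M0)); last exact: subIsetl.
  apply: closedI; first by apply: compact_closed; [exact: norm_hausdorff|exact: compact_coreI].
  rewrite -[X in closed X]setCK; apply: open_closedC.
  have -> : ~` [set z | t <= cmod (z - a)] = disk a t.
    apply/seteqP; split => z; rewrite /disk /=; first by move/negP; rewrite -ltNge.
    by rewrite ltNge => /negP.
  exact: open_disk.
have XA : X `<=` A by move=> z [[]].
have Xb z : X z -> 2 * d <= cmod (z - b).
  by move=> [_ /= tz]; have := cmod_tri b z a; (clear - dE tz; lra).
have [K1 K10 away] := away_potential M oD AD Acl pA cX XA d0 Xb.
pose q' := Num.min q d.
have q'0 : 0 < q' by rewrite lt_min q0.
have q'q : q' <= q by rewrite ge_min lexx.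
have q'd : q' <= d by rewrite ge_min lexx orbT.
clearbody q'.
have [s s0 [_ lb]] := circle_lower_bound q'0.
have [|eta [n' [se eq lbn]]] := lb a r0 u b su nu; first by (clear - t0 tr dE q'0 q'd; lra).
pose H := (K0 + K1) * (1 + M).
have H0 : 0 <= H by rewrite mulr_ge0//; (clear - K00 K10 M0; lra).
have KM K z : 0 <= K -> core D M z -> K * (1 + cmod z) <= K * (1 + M).
  by move=> Kp [_ zM _]; apply: ler_wpM2l => //; rewrite lerD2l.
have HE : H = K0 * (1 + M) + K1 * (1 + M) by rewrite /H mulrDl.
have Hi : K0 * (1 + M) <= H /\ K1 * (1 + M) <= H.
  have h1 : 0 <= K0 * (1 + M) by rewrite mulr_ge0//; (clear - M0; lra).
  have h2 : 0 <= K1 * (1 + M) by rewrite mulr_ge0//; (clear - M0; lra).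
  by rewrite HE; split; (clear - h2 h1; lra).
clearbody H.
have etaD z : cmod (z - b) = eta -> cmod (z - a) <= t.
  by move=> ze; have := cmod_tri b z a; (clear - dE q'd s0 se eq ze; lra).
exists eta, H, (Num.max 0 (n' + K0)); split => //.
- by (clear - s0 se; lra).
- by (clear - q'q eq; lra).
- by rewrite le_max lexx.
split.
  move=> z ze Az; have := lbn z ze; rewrite uA//.
  by rewrite /disk /=; have := etaD z ze; (clear - t0 tr; lra).
(* Each summand is made deeper by the largest value the other can take in a neighbourhood of the
   core. *)
move=> T T0; have T2 : 0 <= T + (K0 + K1) * (2 + M).
    by rewrite addr_ge0// mulr_ge0//; (clear - K00 K10 M0; lra).
have [P0 [sP0 A0 M0P _ u0]] := loc _ T2; have [P1 [sP1 A1 M1P b1]] := away _ T2.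
exists (fun z => P0 z + P1 z); split.
- by move=> z; exact: shlD.
- move=> z cz Az; have zM : cmod z <= M by case: cz.
  have nM : \forall w \near z, cmod w <= M + 1.
    apply: filterS (near_cmod z ltr01) => w wz.
    by have := cmod_tri z w 0; rewrite !subr0; (clear - zM wz; lra).
  have c0 w : cmod w <= M + 1 -> K0 * (1 + cmod w) <= K0 * (2 + M).
    by move=> h; apply: ler_wpM2l => //; (clear - h; lra).
  have c1 w : cmod w <= M + 1 -> K1 * (1 + cmod w) <= K1 * (2 + M).
    by move=> h; apply: ler_wpM2l => //; (clear - h; lra).
  rewrite mulrDl in A0 A1 *.
  have [zt|zt] := leP (cmod (z - a)) t.
    apply: filterS2 (A0 z zt Az) nM => w h1 wM.
    by have := M1P w; have := c1 w wM; (clear - K00 HE Hi h1; lra).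
  have Xz : X z by split => //=; exact: ltW.
  apply: filterS2 (A1 z Xz zM) nM => w h1 wM.
  by have := M0P w; have := c0 w wM; (clear - K10 HE Hi h1; lra).
- move=> z cz; have h0 := M0P z; have h1 := M1P z.
  have := KM K0 z K00 cz; have := KM K1 z K10 cz; (clear - HE h0 h1; lra).
move=> z ze; have h0 := u0 z (etaD z ze); have h1 : 0 <= P1 z by apply: b1; (clear - q'd eq ze; lra).
have : ((- n')%:E <= (P0 z + K0)%:E)%E := le_trans (lbn z ze) h0.
rewrite lee_fin => h2.
have : n' + K0 <= Num.max 0 (n' + K0) by rewrite le_max lexx orbT.
(clear - h1 h2; lra).
Qed.

(** Order of choice: the barrier fixes [nn], then [eta], the bounds [K] and [L], the scale [dl], the
    depth [S], the potential [P], a bound [F] for [f] where [P >= - S], and last [c] and [tau]. *)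
Lemma approximant D A f a b u (r0 t n m e r : R) : open D -> A `<=` D ->
  (forall z, D z -> ~ A z -> \forall w \near z, ~ A w) -> polar A ->
  (forall z, D z -> ~ A z -> cdiff f z) ->
  singular_center D A f a b u r0 t n -> 0 < m -> 0 < e -> e <= 1 -> 0 < r ->
  exists V : C * C -> R,
   [/\ (forall p, D p.1 -> plh V p),
       (forall p, D p.1 -> exh D p <= m + 1 -> V p <= 0),
       (forall z, D z -> ~ A z -> exh D (z, f z) < m -> r <= cmod (z - b) -> V (z, f z) <= -1) &
       (forall w, - (8 * e) <= V (b, w))].
Proof.
move=> oD AD Acl pA df sc m0 e0 e1 rp; have [_ [_ [Ab _ fb]]] := sc.
 pose M := m + 2; have M0 : 0 < M by rewrite /M; (clear - m0; lra).
have cf z : D z -> ~ A z -> {for z, continuous (fun z => cmod (f z))}.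
  by move=> Dz nA; have := continuous_at_comp (cdiff_cont (df z Dz nA)) (@continuous_cmod R).
pose O := [set z | [/\ D z, ~ A z & M + 2 < cmod (f z)]].
have oO : open O.
  rewrite openE => z [Dz nA kz]; rewrite /interior.
  have /cont_cmodP := cf z Dz nA; move: kz; rewrite -subr_gt0 => kz /(_ _ kz)[d d0 dP].
  have DA : \forall w \near z, D w /\ ~ A w by exact: filterS2 (near_open oD Dz) (Acl z Dz nA).
  apply: filterS2 DA (near_cmod z d0) => w [Dw nAw] /dP.
  by rewrite ltr_norml => h; split => //; (clear - h; lra).
have [rk rk0 rkP] := fb (M + 2).
pose r' := Num.min r rk.
have r'0 : 0 < r' by rewrite lt_min rp.
have r'r : r' <= r by rewrite ge_min lexx.
have r'k : r' <= rk by rewrite ge_min lexx orbT.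
clearbody r'.
have [s [nn [s0 sr nn0 bar]]] := circle_barrier r'0 e0.
have [|B [shB B0 Br Be]] := bar b O oO.
  by move=> x /andP[sx xr]; apply: rkP; (clear - s0 sx r'k xr; lra).
(* A radius at most [nn] ensures that the barrier is at least [- e] on the small circle. *)
pose q := Num.min nn r'.
have q0 : 0 < q by rewrite lt_min nn0.
have qn : q <= nn by rewrite ge_min lexx.
have qr : q <= r' by rewrite ge_min lexx orbT.
clearbody q.
have [eta [K [L [eta0 etaq K0 L0 [etaA pot]]]]] := center_potential oD AD Acl pA sc M0 q0.
pose dl := e / (1 + K + L).
have KL : 0 < 1 + K + L by (clear - K0 L0; lra).
have dl0 : 0 < dl by rewrite divr_gt0.
have dlE : dl * (1 + K + L) = e by rewrite divfK// gt_eqF.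
have [dlK dlL] : dl * K <= e /\ dl * L <= e.
  by rewrite -dlE; split; rewrite ler_pM2l//; (clear - L0 K0; lra).
clearbody dl.
pose S := 23 / dl + L + 1.
have dlS : 23 <= dl * S.
  rewrite /S 2!mulrDr mulrCA divff ?gt_eqF// !mulr1 -addrA lerDl.
  by rewrite addr_ge0 ?mulr_ge0// ltW.
have SL : L < S by have : 0 <= 23 / dl := divr_ge0 (ler0n _ _) (ltW dl0); rewrite /S; (clear; lra).
clearbody S.
(* The potential is asked to be below [- S] on [A], so that [P >= - S] keeps away from [A]. *)
have T0 : 0 <= S + 2 by (clear - L0 SL; lra).
have [P [shP PA PK PL]] := pot _ T0.
have PnA z : core D M z -> - S <= P z -> ~ A z.
  by move=> cz hP Az; have := nbhs_singleton (PA z cz Az); (clear - hP; lra).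
have DY z : core D M z -> D z by case.
pose Y := core D M `&` [set z | - S <= P z].
have cY : compact Y.
  apply: (subclosed_compact _ (compact_core oD M0)); last exact: subIsetl.
  apply: closedI; first exact: closed_core.
  rewrite -[X in closed X]setCK; apply: open_closedC.
  rewrite openE => z /= /negP; rewrite -ltNge => Pz; rewrite /interior.
  have cP := shl_at (shP z).
  have H : \forall w \near z, P w < - S := cP _ (lt_nbhsl Pz).
  by apply: filterS H => w Pw; apply/negP; rewrite -ltNge.
have [F F0 FP] : exists2 F : R, 0 <= F & forall z, Y z -> cmod (f z) <= F.
  have [nY|Y0] := pselect (Y !=set0); last by exists 0 => // z Yz; case: Y0; exists z.
  have [|y0 _ y0P] := @usc_attains_max R Y (fun z => cmod (f z)) cY nY; last by exists (cmod (f y0)); [exact: cmod_ge0|].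
  move=> y c [cy Py] hc; have cfy := cf y (DY y cy) (PnA y cy Py).
  have H : \forall w \near y, cmod (f w) < c := cfy _ (lt_nbhsl hc).
  by apply: filterS H.
pose l := ln (1 + M + F).
have MF : 1 <= 1 + M + F by (clear - M0 F0; lra).
have l0 : 0 <= l by exact: ln_ge0.
(* Where [P >= - S] the distance from [w] to [f z] is at most [M + F]; this factor keeps the
   logarithm below [e] there, and [tau] is then taken so small that the value on the graph is
   [-4]. *)
pose c := e / (1 + l).
have c0 : 0 < c by rewrite divr_gt0//; (clear - l0; lra).
have cl : c * l <= e.
  by rewrite /c mulrAC ler_pdivrMr ?ler_pM2l//; (clear - l0; lra).
clearbody c.
pose tau := expR (- 4 / c).
have tau0 : 0 < tau by exact: expR_gt0.
have tau1 : tau <= 1.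
  by rewrite -expR0 ler_expR mulNr oppr_le0 divr_ge0// ltW.
have ctau : c * ln tau <= -4.
  by rewrite expRK mulrC divfK// gt_eqF.
clearbody tau.
have PM z : core D M z -> dl * P z <= e.
  by move=> cz; apply: le_trans dlK; rewrite ler_pM2l//; exact: PK.
have Peta z : cmod (z - b) = eta -> [/\ ~ A z, - e <= dl * P z & - S < P z].
  move=> ze; have h := PL z ze; split; [exact: etaA| |(clear - SL h; lra)].
  by apply: le_trans (_ : dl * - L <= _); [rewrite mulrN lerN2|rewrite ler_pM2l].
have Ne p : [set p : C * C | core D M p.1 /\ cmod p.2 <= M] p -> - S <= P p.1 ->
    c * ln (Num.max (cmod (p.2 - f p.1)) tau) <= e.
  move=> [cp pM] hP; apply: le_trans cl; rewrite ler_pM2l//.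
  have fF : cmod (f p.1) <= F by apply: FP.
  have m0' : 0 < Num.max (cmod (p.2 - f p.1)) tau by rewrite lt_max tau0 orbT.
  rewrite ler_ln ?posrE//; last by (clear - MF; lra).
  rewrite ge_max; apply/andP; split; last by (clear - MF tau1; lra).
  by have := cmod_tri 0 p.2 (f p.1); rewrite subr0 sub0r cmodN; (clear - pM fF; lra).
have Beta z : ~ O z -> cmod (z - b) = eta -> - e <= B z.
  by move=> nO ze; apply: Be => //; (clear - qn etaq ze; lra).
have Br' z : ~ O z -> r <= cmod (z - b) -> B z <= -1.
  by move=> nO rz; apply: Br => //; (clear - r'r rz; lra).
have etar : eta <= r by lra.
exists (glued D A f b m e eta dl S c tau B P); split.
- exact: glued_plh.
- exact: glued_le0.
- exact: (glued_graph S e0 e1 tau0 Br' PM ctau etar).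
by move=> w; apply: glued_center => //; exact: AD.
Qed.

End Approximant.

(** * Locally decreasing series of plurisubharmonic functions *)

Section Decreasing.
Variable R : realType.
Local Notation C := (CC R).
Local Notation mu := (@lebesgue_measure R).
Implicit Types (z w : C) (p : C * C).

(** Monotone convergence for [M - h n], with [M] an upper bound of [h 0] on the period. For real [x]
    the lower bound on the means makes the limit integrable, so that its integral can be split. *)
Lemma le_mean_of_decreasing (h : nat -> R -> R) (hv : R -> \bar R) (x : \bar R) :
  (forall n, continuous (h n)) -> (forall n t, h n.+1 t <= h n t) ->
  (forall t, hv t = ereal_inf (range (fun n => (h n t)%:E))) ->
  (forall n, (x <= (avg (h n))%:E)%E) ->
  (x <= ((2 * pi)^-1)%:E * \int[mu]_(t in `[0%R, (2 * pi)%R]) hv t)%E.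
Proof.
move=> ch hS hvE xh; have p0 := @twopi_gt0 R.
case: x xh => [x xh|/(_ 0%N)|_]; [|by rewrite leye_eq|exact: leNye].
pose I := (`[0%R, (2 * pi)%R] : set R)%classic.
have mI : measurable I by exact: measurable_itv.
have [M hM] : exists M, forall t, I t -> h 0%N t <= M.
  have [c _ cP] := @EVT_max R (h 0%N) 0 (2 * pi) (ltW p0) (continuous_subspaceT (ch 0%N)).
  by exists (h 0%N c) => t It; exact: cP.
have hle n t : h n t <= h 0%N t.
  by elim: n => // n; apply: le_trans; exact: hS.
pose g n t := (M - h n t)%:E : \bar R.
have g0 n t : I t -> (0 <= g n t)%E.
  by move=> It; rewrite lee_fin subr_ge0; apply: le_trans (hle n t) (hM t It).
have cg n : continuous (fun t => M - h n t).
  by move=> t; apply: contB; [exact: cst_continuous|exact: ch].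
have mg n : measurable_fun I (g n).
  apply/measurable_EFinP; apply: measurable_funTS.
  exact: continuous_measurable_fun.
have ndg t : nondecreasing_seq (g ^~ t).
  apply/nondecreasing_seqP => n; rewrite lee_fin lerD2l lerN2; exact: hS.
have gE t : limn (g ^~ t) = (M%:E - hv t)%E.
  apply: cvg_lim => //; rewrite hvE.
  have -> : g ^~ t = (fun n => M%:E - (h n t)%:E)%E by [].
  apply: cvgeB; [exact: fin_num_adde_defr|exact: cvg_cst|].
  apply: ereal_nonincreasing_cvgn.
  by apply/nonincreasing_seqP => n; rewrite lee_fin.
have mc := monotone_convergence mu mI mg g0 (fun t _ => ndg t).
have Ig n : (\int[mu]_(t in I) g n t)%E = (2 * pi * (M - avg (h n)))%:E.
  have ih : (\int[mu]_(t in I) g n t)%E = (Int 0 (2 * pi) (fun t => M - h n t))%:E.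
    rewrite /Int /Rintegral fineK//; apply: integrable_fin_num => //.
    exact: Int_integrable.
  rewrite ih IntB//; last exact: cst_continuous.
  rewrite Int_cst ?(ltW p0)// /avg mulrBr subr0; congr (_ - _)%:E.
  by rewrite mulrA divff ?mul1r// gt_eqF.
have Ile : (\int[mu]_(t in I) (M%:E - hv t) <= (2 * pi * (M - x))%:E)%E.
  have -> : (\int[mu]_(t in I) (M%:E - hv t))%E = (\int[mu]_(t in I) limn (g ^~ t))%E.
    by apply: eq_integral => t _; rewrite gE.
  rewrite mc; apply: lime_le.
    apply: ereal_nondecreasing_is_cvgn => m n mn; apply: ge0_le_integral => //.
    - by move=> t It; exact: g0.
    - exact: mg.
    - exact: mg.
    - by move=> t It; exact: (ndg t).
  apply: nearW => n; rewrite Ig lee_fin ler_pM2l// lerD2l lerN2 -lee_fin; exact: xh.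
have hv_fun : hv = (fun t => M%:E - limn (g ^~ t))%E.
  apply/funext => t; rewrite gE.
  by case: (hv t) => [y| |] //=; rewrite -EFinB opprB addrC subrK.
have mlim : measurable_fun I (fun t => limn (g ^~ t)).
  apply: (emeasurable_fun_cvg (fun n => g n)) => // t It.
  by apply: ereal_nondecreasing_is_cvgn; exact: ndg.
have lim0 t : I t -> (0 <= limn (g ^~ t))%E.
  move=> It; apply: lime_ge; first by apply: ereal_nondecreasing_is_cvgn; exact: ndg.
  by apply: nearW => n; exact: g0.
have ilim : mu.-integrable I (fun t => limn (g ^~ t)).
  apply/integrableP; split => //.
  have -> : (\int[mu]_(t in I) `|limn (g ^~ t)|)%E = (\int[mu]_(t in I) (M%:E - hv t))%E.
    by apply: eq_integral => t; rewrite inE => It; rewrite gee0_abs ?lim0// gE.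
  by apply: le_lt_trans Ile _; rewrite ltry.
have iM : mu.-integrable I (fun=> M%:E).
  by have := @Int_integrable R 0 (2 * pi) (fun=> M) (@cst_continuous _ _ M).
rewrite -/I hv_fun.
have -> : (\int[mu]_(t in I) (M%:E - limn (g ^~ t)) =
    \int[mu]_(t in I) M%:E - \int[mu]_(t in I) limn (g ^~ t))%E by exact: integralB.
have lI : mu I = (2 * pi)%:E.
  by rewrite /I lebesgue_measure_itv /= lte_fin p0 sube0.
rewrite integral_cst// [X in (M%:E * X)%E]lI.
have Ige : (0 <= \int[mu]_(t in I) limn (g ^~ t))%E by exact: integral_ge0.
have : (\int[mu]_(t in I) limn (g ^~ t) <= (2 * pi * (M - x))%:E)%E.
  apply: le_trans Ile; have -> //: (\int[mu]_(t in I) (M%:E - hv t))%E = (\int[mu]_(t in I) limn (g ^~ t))%E.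
  by apply: eq_integral => t _; rewrite gE.
move: Ige; case: (\int[mu]_(t in I) limn (g ^~ t))%E => [y| |] //.
rewrite !lee_fin => y0 yle.
rewrite mulrC ler_pdivlMr//; (clear - yle; lra).
Qed.

Section Series.
Variables (D : set C) (V : nat -> C * C -> R).
Hypotheses (oD : open D) (plhV : forall j p, D p.1 -> plh (V j) p)
  (V_le0 : forall j p, D p.1 -> exh D p <= j.+2%:R -> V j p <= 0).

Definition psum (n : nat) p : R := \sum_(i < n) V i p.

(** Where [exh D p <= n] all terms from index [n] on are nonpositive. Hence the admissible partial
    sums decrease, and their infimum is the sum of the series. *)
Definition vsum p : \bar R :=
  ereal_inf [set (psum n p)%:E | n in [set n : nat | exh D p <= n%:R]].

Let plh_psum n p : D p.1 -> plh (psum n) p.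
Proof.
move=> Dp; elim: n => [|n IH].
  have -> : psum 0 = fun=> 0; last exact: plh_cst.
  by apply/funext => q; rewrite /psum big_ord0.
have -> : psum n.+1 = fun q => psum n q + V n q.
  by apply/funext => q; rewrite /psum big_ord_recr.
by apply: plhD => //; exact: plhV.
Qed.

Let psumS n p : D p.1 -> exh D p <= n%:R -> psum n.+1 p <= psum n p.
Proof.
move=> Dp h; rewrite /psum big_ord_recr /= gerDl V_le0//.
by apply: le_trans h _; rewrite ler_nat; lia.
Qed.

Let psum_anti n k p : D p.1 -> exh D p <= n%:R -> psum (n + k) p <= psum n p.
Proof.
move=> Dp h; elim: k => [|k IH]; first by rewrite addn0.
rewrite addnS; apply: le_trans IH; apply: psumS => //.
by apply: le_trans h _; rewrite ler_nat leq_addr.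
Qed.

Let vsum_le n p : exh D p <= n%:R -> (vsum p <= (psum n p)%:E)%E.
Proof. by move=> h; apply: ereal_inf_lbound; exists n. Qed.

Let vsumE m p : D p.1 -> exh D p <= m%:R ->
  vsum p = ereal_inf (range (fun n => (psum (m + n) p)%:E)).
Proof.
move=> Dp h; apply/le_anti/andP; split.
  apply: le_ereal_inf_tmp => _ [n _ <-]; apply: vsum_le.
  by apply: le_trans h _; rewrite ler_nat leq_addr.
apply: le_ereal_inf_tmp => _ [n /= hn <-].
apply: le_trans (_ : (psum (m + n) p)%:E <= _)%E; first by apply: ereal_inf_lbound; exists n.
by rewrite lee_fin addnC psum_anti.
Qed.

Let level p : exists m : nat, exh D p < m%:R.
Proof. by exists (Num.truncn (exh D p)).+1; exact: truncnS_gt. Qed.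

Let near_level p (m : nat) : D p.1 -> exh D p < m%:R ->
  \forall q \near p, D q.1 /\ exh D q < m%:R.
Proof.
move=> Dp h; have ce := plh_at (plh_exh oD Dp).
have H : \forall q \near p, exh D q < m%:R := ce _ (lt_nbhsl h).
by apply: filterS2 (near_fst (near_open oD Dp)) H.
Qed.

Let vsum_lty p : (vsum p < +oo)%E.
Proof.
by have [m /ltW/vsum_le h] := level p; apply: le_lt_trans h _; rewrite ltry.
Qed.

Let vsum_usc p (c : R) : D p.1 -> (vsum p < c%:E)%E -> \forall q \near p, (vsum q < c%:E)%E.
Proof.
move=> Dp /ereal_inf_lt[_ [n /= hn <-]]; rewrite lte_fin => hc.
(* One more term makes the inequality for [exh] strict, hence stable near [p]. *)
have h1 : exh D p < n.+1%:R by apply: le_lt_trans hn _; rewrite ltr_nat.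
have hc1 : psum n.+1 p < c by apply: le_lt_trans (psumS Dp hn) hc.
have H : \forall q \near p, psum n.+1 q < c :=
  (plh_at (plh_psum n.+1 Dp) : continuous_at p (psum n.+1)) _ (lt_nbhsl hc1).
apply: filterS2 (near_level Dp h1) H => q [Dq /ltW/vsum_le h] hq.
by apply: le_lt_trans h _; rewrite lte_fin.
Qed.

Lemma psh_vsum : psh (D `*` setT) vsum.
Proof.
have oDT : open (D `*` [set: C]).
  rewrite openE => p [Dp _]; rewrite /interior.
  by apply: near_pS (near_fst (near_open oD Dp)) => q.
have near_dom a b l : (D `*` setT) (line2 a b l) -> \forall k \near l, D (line2 a b k).1.
  by move=> [Dl _]; exact: near_line2 (near_fst (near_open oD Dl)).
split => //; first by move=> p [Dp _] c; exact: vsum_usc.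
move=> a b; split => //.
- rewrite openE => l Dl; rewrite /interior.
  by apply: filterS (near_dom _ _ _ Dl) => k Dk; split.
- by move=> l [Dl _] c h; exact: near_line2 (vsum_usc Dl h).
(* A level valid on a whole disk of the line: all means are taken where the partial sums from [m] on
   decrease. *)
move=> l [Dl _]; have [m hm] := level (line2 a b l).
have /nbhs_cmodP[rho rho0 rP] := near_line2 (near_level Dl hm).
exists rho => //; split; first by move=> z /rP[Dz _]; split.
move=> r r0 rr; pose h n t := psum (m + n) (line2 a b (l + rc r * cis t)).
have circD t : D (line2 a b (l + rc r * cis t)).1 /\ exh D (line2 a b (l + rc r * cis t)) < m%:R.
  by apply: rP; rewrite cmod_circ cmod_rc gtr0_norm.
have sl n z : cmod (z - l) <= r -> shl (fun k => psum (m + n) (line2 a b k)) z.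
  move=> zr; apply: plh_shl_line; apply: plh_psum.
  by have [] := rP z (le_lt_trans zr rr).
have sc n t : {for l + rc r * cis t, continuous (fun k => psum (m + n) (line2 a b k))}.
  by apply: shl_at; apply: sl; rewrite cmod_circ cmod_rc gtr0_norm.
apply: (le_mean_of_decreasing (h := h)) => [n|n t|t|n].
- exact: continuous_circ (sc n).
- have [Dt ht] := circD t; rewrite /h addnS; apply: psumS => //.
  by apply: le_trans (ltW ht) _; rewrite ler_nat leq_addr.
- by have [Dt ht] := circD t; rewrite (vsumE Dt (ltW ht)).
apply: le_trans (vsum_le (n := m + n) _) _.
  by apply: le_trans (ltW hm) _; rewrite ler_nat leq_addr.
rewrite lee_fin; apply: (@submean_disk _ (fun k => psum (m + n) (line2 a b k)) l (rc r)).
  by rewrite cmod_rc gtr0_norm// => z zr; exact: shl_at (sl n z zr).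
by rewrite cmod_rc gtr0_norm// => z /ltW zr; exact: sl.
Qed.

Lemma vsum_eqNy p (J : nat) : D p.1 -> (forall j, (J <= j)%N -> V j p <= -1) -> vsum p = -oo%E.
Proof.
move=> Dp hV; have [m hm] := level p.
have hn n : psum (maxn m J + n) p <= psum (maxn m J) p - n%:R.
  elim: n => [|n IH]; first by rewrite addn0 subr0.
  have E : psum (maxn m J + n).+1 p = psum (maxn m J + n) p + V (maxn m J + n) p.
    by rewrite /psum big_ord_recr.
  have hj := hV (maxn m J + n)%N (leq_trans (leq_maxr m J) (leq_addr _ _)).
  by rewrite addnS E -natr1; lra.
have vle n : (vsum p <= (psum (maxn m J) p - n%:R)%:E)%E.
  apply: le_trans (vsum_le (n := maxn m J + n) _) _; last by rewrite lee_fin.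
  by apply: le_trans (ltW hm) _; rewrite ler_nat -addnC; lia.
move: vle; case: (vsum p) => [y vle| vle|//]; last by have := vle 0%N; rewrite leye_eq.
have := vle (Num.truncn `|psum (maxn m J) p - y|).+1.
have := truncnS_gt `|psum (maxn m J) p - y|; have := ler_norm (psum (maxn m J) p - y).
by rewrite lee_fin => *; exfalso; lra.
Qed.

Lemma vsum_ge p (c : R) : (forall n, c <= psum n p) -> (c%:E <= vsum p)%E.
Proof. by move=> h; apply: le_ereal_inf_tmp => _ [n _ <-]; rewrite lee_fin. Qed.

End Series.

End Decreasing.

(** * Summation of the approximants and conclusion *)

Section Main.
Variable R : realType.
Local Notation C := (CC R).
Implicit Types (z w a b : C) (p : C * C) (D A : set C) (f : C -> C).

Lemma rel_closed_near D A z : rel_closed D A -> D z -> ~ A z -> \forall w \near z, ~ A w.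
Proof.
move=> [_ Acl] Dz nA.
have /open_cmodP/(_ z)[|d d0 dP] := closed_openC (@closed_closure _ A).
  by move=> /Acl h; apply: nA; exact: h.
by apply: filterS (near_cmod z d0) => w /dP h Aw; apply: h; exact: subset_closure.
Qed.

(** A single function, finite on the whole fibre over [b], excludes all [w] at once. *)
Lemma exists_point_off_hull D A f a (q : R) :
  open D -> rel_closed D A -> polar A -> holomorphic_on (D `\` A) f -> no_holo_ext D A f ->
  A a -> 0 < q ->
  exists b, [/\ A b, cmod (b - a) < q & forall w, ~ pstar (D `*` setT) (graph D A f) (b, w)].
Proof.
move=> oD cA pA hf nf Aa q0; have AD := cA.1.
have Acl z : D z -> ~ A z -> \forall w \near z, ~ A w by exact: rel_closed_near.
have df z : D z -> ~ A z -> cdiff f z.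
  by move=> Dz nA; apply/derivable_cdiff; apply: hf.
have [b [u [r0 [t [n [r0q sc]]]]]] := exists_center oD AD Acl pA df nf Aa q0.
have [_ [[t0 tr _] [Ab bt _]]] := sc.
exists b; split => //; first by lra.
have half_gt0 j : 0 < 2^-1 ^+ j :> R by rewrite exprn_gt0// invr_gt0.
have half_le1 j : 2^-1 ^+ j <= 1 :> R by rewrite exprn_ile1// ?invr_ge0// invf_le1// ler1n.
have /choice[V VP] : forall j : nat, exists V : C * C -> R,
   [/\ (forall p, D p.1 -> plh V p),
       (forall p, D p.1 -> exh D p <= j.+1%:R + 1 -> V p <= 0),
       (forall z, D z -> ~ A z -> exh D (z, f z) < j.+1%:R -> j.+1%:R^-1 <= cmod (z - b) ->
          V (z, f z) <= -1) &
       (forall w, - (8 * 2^-1 ^+ j) <= V (b, w))].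
  move=> j; have j0 : 0 < j.+1%:R^-1 :> R by rewrite invr_gt0.
  have j1 : 0 < j.+1%:R :> R by [].
  (* Level [m = j + 1], error [e = 2^-j] and radius [r = 1 / (j + 1)]: errors are summable, and
     every point of the graph is eventually covered. *)
  exact: (approximant oD AD Acl pA df sc j1 (half_gt0 j) (half_le1 j) j0).
have plhV j p : D p.1 -> plh (V j) p by have [h _ _ _] := VP j; exact: h.
have V0 j p : D p.1 -> exh D p <= j.+2%:R -> V j p <= 0.
  by have [_ h _ _] := VP j => Dp; rewrite -natr1; exact: h.
move=> w [_ /(_ _ (psh_vsum oD plhV V0))] hN.
(* The [16] is the sum of the errors [8 * 2^-j]. *)
have sum_ge k : -16 + 16 * 2^-1 ^+ k <= psum V k (b, w).
  elim: k => [|k IH]; first by rewrite /psum big_ord0 expr0; lra.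
  have [_ _ _ /(_ w)] := VP k; rewrite /psum big_ord_recr /= -/(psum V k (b, w)) exprSr.
  by move: IH; rewrite /psum; set x := 2^-1 ^+ k; lra.
have : ((-16)%:E <= vsum D V (b, w))%E.
  by apply: vsum_ge => k; apply: le_trans (sum_ge k); rewrite lerDl mulr_ge0// ltW.
rewrite hN// => _ [z [Dz nA] ->].
have zb : 0 < cmod (z - b).
  by rewrite cmod_gt0 subr_eq0; apply/negP => /eqP E; apply: nA; rewrite E.
(* From [J] on, the graph point is below the level [j + 1] and at distance at least [1 / (j + 1)]
   from the fibre over [b]; this uses [z != b], as [b] is in [A]. *)
pose J := maxn (Num.truncn (exh D (z, f z))) (Num.truncn (cmod (z - b))^-1).
apply: (vsum_eqNy (J := J)) => // j; rewrite geq_max => /andP[j1 j2].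
have [_ _ h _] := VP j; apply: h => //.
  by apply: lt_le_trans (truncnS_gt _) _; rewrite ler_nat.
rewrite -[leRHS]invrK lef_pV2 ?posrE ?invr_gt0//.
by apply: le_trans (ltW (truncnS_gt _)) _; rewrite ler_nat.
Qed.

End Main.

Theorem theorem4p4 (R : realType) (D A : set (CC R)) (f : CC R -> CC R) :
  domain D -> rel_closed D A -> polar A ->
  holomorphic_on (D `\` A) f -> no_holo_ext D A f ->
  exists B : set (CC R),
    [/\ B `<=` A, A `<=` closure B &
        pstar (D `*` setT) (graph D A f) `&` (B `*` setT) = set0].
Proof.
move=> [oD _ _] cA pA hf nf.
(* The largest possible choice of [B], so that only density needs an argument. *)
exists [set b | A b /\ forall w, ~ pstar (D `*` setT) (graph D A f) (b, w)]; split.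
- by move=> b [].
- move=> a Aa U /nbhs_cmodP[q q0 qU].
  have [b [Ab ba nb]] := exists_point_off_hull oD cA pA hf nf Aa q0.
  by exists b; split; [|exact: qU].
by apply/seteqP; split => // -[b w] [hb [[_ nb] _]]; exact: (nb w).
Qed.
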